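(* Consider families (indexed by $\eta\in\mathbb N$) of two-sided queueing systems with $n$ customer types and $n$ server types on a bipartite graph that has a perfect matching, operated under the two-price policy with parameters $\boldsymbol\theta,\boldsymbol\phi\in\mathbb R^n_{>0}$, $\sigma^\eta>0$, $\tau_{\max}^\eta\geq 0$: $$\lambda_j(\mathbf q)=\eta\lambda_j^*-\theta_j\sigma^\eta\,\mathbf 1\{q_j^{(c)}>\tau_{\max}^\eta\},\qquad \mu_i(\mathbf q)=\eta\mu_i^*-\phi_i\sigma^\eta\,\mathbf 1\{q_i^{(s)}>\tau_{\max}^\eta\}.$$ (i) Under randomized matching, for $\sigma^\eta=\eta^{2/3}$ and $\tau_{\max}^\eta=\gamma\eta^{1/3}$, $L^\eta=O(\eta^{1/3})$. (ii) Under randomized matching with $\sigma^\eta=\eta^{2/3}$ and $\tau_{\max}^\eta=\gamma\eta^{1/3}$, for any choice of $\boldsymbol\theta>\mathbf 0$, $\boldsymbol\phi>\mathbf 0$ and $\gamma>0$ there exists $(\boldsymbol\lambda^*,\boldsymbol\mu^*,\boldsymbol\chi^* )$ satisfying the complete resource pooling condition and the perfect matching condition such that $$\liminf_{\eta\to\infty}\frac{L^\eta}{\eta^{1/3}}=\Omega(n).$$ (iii) Under max-weight matching (with the complete resource pooling condition in force), with $\boldsymbol\theta=\boldsymbol\phi=\mathbf 1_n$ and $\sigma^\eta=n^{-1/3}\eta^{2/3}$, if $\lim_{\eta\to\infty}\tau_{\max}^\eta/\eta^{1/3}=0$, then $$\limsup_{\eta\to\infty}\frac{L^\eta}{\eta^{1/3}}\le\Bigg(\sum_{i}\Big(\frac{\mu_i^*G_i''(\mu_i^*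 )}2+G_i'(\mu_i^* )\Big)-\sum_{j}\Big(\frac{\lambda_j^*F_j''(\lambda_j^* )}2+F_j'(\lambda_j^* )\Big)+\frac{\max_{i\in N,j\in M}\{s_i^{(s)},s_j^{(c)}\}}{2}\Big(\sum_j\lambda_j^*+\sum_i\mu_i^*\Big)\Bigg)n^{-2/3}=O(n^{1/3}).$$
   Context: **Model.** $N$ is a set of $n$ server types, $M$ a set of $m$ customer types (here $m=n$), $E\subseteq N\times M$ the set of compatible pairs. The state $\mathbf q=(q^{(c)}_j,j\in M;\ q^{(s)}_i,i\in N)\in\mathbb Z_+^{m+n}$ records the numbers of waiting customers and servers of each type. In state $\mathbf q$, type-$j$ customers arrive at Poisson rate $\lambda_j(\mathbf q)$ and type-$i$ servers at Poisson rate $\mu_i(\mathbf q)$, chosen by the operator (pricing). A matched compatible pair leaves at once. **Curves.** $F_j$ (inverse demand curve) is strictly decreasing, $G_i$ (inverse supply curve) is strictly increasing; both are nonnegative and twice continuously differentiable on the range of feasible rates, $\lambda\mapsto\lambda F_j(\lambda)$ has strictly negative second derivative, $\mu\mapsto\mu G_i(\mu)$ has strictly positive second derivative. Unit waiting costs $s_j^{(c)},s_i^{(s)}>0$ are given. **Fluid problem.** $\gamma^*=\max\sum_j\lambda_jF_j(\lambda_j)-\sum_i\mu_iG_i(\mu_i)$ over $\boldsymbol\lambda,\boldsymbol\mu,\boldsymbol\chi$ subject to $\lambda_j=\sum_i\chi_{ij}$, $\mu_i=\sum_j\chi_{ij}$, $\chi_{ij}\ge0$ for $(i,j)\in E$ and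 $\chi_{ij}=0$ for $(i,j)\notin E$. $(\boldsymbol\lambda^*,\boldsymbol\mu^*,\boldsymbol\chi^* )$ denotes an optimal solution; it is assumed that $\boldsymbol\lambda^*,\boldsymbol\mu^*>0$. **Scaling.** The $\eta$-th system has the same graph and waiting costs, with curves $F^\eta_j(\eta\lambda)=F_j(\lambda)$, $G_i^\eta(\eta\mu)=G_i(\mu)$; its fluid optimum is $\eta\gamma^*$. Only $\eta$ large enough that all rates of the two-price policy are nonnegative is considered. Here $\gamma$ is a positive constant; $O(\cdot)$ in (i) is as $\eta\to\infty$, while $\Omega(n)$ and $O(n^{1/3})$ describe the dependence on the number of types $n$. **Profit loss.** With $\mathbb E$ the stationary expectation, $$L^\eta=\eta\gamma^*-\Big(\mathbb E\Big[\sum_j\lambda_j(\mathbf q)F_j^\eta(\lambda_j(\mathbf q))-\sum_i\mu_i(\mathbf q)G_i^\eta(\mu_i(\mathbf q))\Big]-\sum_js_j^{(c)}\mathbb E[q_j^{(c)}]-\sum_is_i^{(s)}\mathbb E[q_i^{(s)}]\Big).$$ **Max-weight matching.** An arriving server of type $i$ is immediately matched with a waiting customer of a type $j$ maximizing $q_j^{(c)}$ over $\{j:(i,j)\in E\}$ if this maximum is positive; symmetrically for an arriving customer. Ties are broken arbitrarily. If all compatible queues are empty, the arrival joins its own queue. **Randomized matching** (for a given fluid solution $\boldsymbol\chi^*$). An arriving server of type $i$ is matched with a waiting type-$j$ customer with probability $\chi^*_{ij}\mathbf 1\{q_j^{(c)}>0\}/\sum_{j'}\chi^*_{ij'}\mathbf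 1\{q_{j'}^{(c)}>0\}$; an arriving customer of type $j$ is matched with a waiting type-$i$ server with probability $\chi^*_{ij}\mathbf 1\{q_i^{(s)}>0\}/\sum_{i'}\chi^*_{i'j}\mathbf 1\{q_{i'}^{(s)}>0\}$. If the denominator is zero, the arrival joins its own queue. **Perfect matching condition.** The graph has a perfect matching; without loss of generality server type $i$ is compatible with customer type $i$ for each $i\in\{1,\dots,n\}$. **Complete resource pooling condition.** There is an optimal fluid solution $(\boldsymbol\lambda^*,\boldsymbol\mu^* )$ such that for all nonempty $J\subsetneq M$ and nonempty $I\subsetneq N$, $$\sum_{j\in J}\lambda_j^*<\sum_{i:\exists j\in J,(i,j)\in E}\mu_i^*,\qquad \sum_{i\in I}\mu_i^*<\sum_{j:\exists i\in I,(i,j)\in E}\lambda_j^*.$$ *)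

(* Defs.v *)
From HB Require Import structures.
From mathcomp Require Import all_boot all_order all_algebra perm.
From mathcomp Require Import all_classical all_reals all_analysis.

Set Implicit Arguments.
Unset Strict Implicit.
Unset Printing Implicit Defensive.

Import Order.TTheory GRing.Theory Num.Theory.
Import numFieldNormedType.Exports.

Local Open Scope ring_scope.
Local Open Scope classical_set_scope.

(* Server types and customer types are both indexed by 'I_n; in every
   two-index object the server type i comes first and the customer type j
   second. *)

(* The feasible rates of a type form the interval [0, b[ with b possibly +oo.
   The interval is open on the right, so that a positive feasible rate is an
   interior one. *)
Definition feasible_rate (R : realType) (b : \bar R) : set R :=
  [set x | 0 <= x /\ (x%:E < b)%E].

(* Two-sided derivatives at 0 lose no generality: a function that is C^2 on
   [0, b[ with one-sided derivatives at 0 extends to one that is C^2 around 0,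
   and only its values at nonnegative rates are ever used. *)
Definition twice_continuously_differentiable (R : realType) (D : set R)
    (f : R -> R) : Prop :=
  forall x, D x ->
    [/\ derivable f x 1, derivable f^`() x 1 & {for x, continuous f^`(2)}].

Definition inverse_demand_curve (R : realType) (b : \bar R) (f : R -> R) : Prop :=
  let D := feasible_rate b in
  [/\ forall x y, D x -> D y -> x < y -> f y < f x,
      forall x, D x -> 0 <= f x,
      twice_continuously_differentiable D f
    & forall x, D x -> (fun z => z * f z)^`(2) x < 0].

Definition inverse_supply_curve (R : realType) (b : \bar R) (g : R -> R) : Prop :=
  let D := feasible_rate b in
  [/\ forall x y, D x -> D y -> x < y -> g x < g y,
      forall x, D x -> 0 <= g x,
      twice_continuously_differentiable D g
    & forall x, D x -> 0 < (fun z => z * g z)^`(2) x].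

Record market (R : realType) (n : nat) : Type := Market {
  compatible : rel 'I_n;
  demand : 'I_n -> R -> R;
  supply : 'I_n -> R -> R;
  demand_bound : 'I_n -> \bar R;
  supply_bound : 'I_n -> \bar R;
  customer_cost : 'I_n -> R;
  server_cost : 'I_n -> R
}.

Definition market_assumptions (R : realType) (n : nat) (m : market R n) : Prop :=
  [/\ forall j, inverse_demand_curve (demand_bound m j) (demand m j),
      forall i, inverse_supply_curve (supply_bound m i) (supply m i),
      forall j, 0 < customer_cost m j
    & forall i, 0 < server_cost m i].

Definition perfect_matching (n : nat) (E : rel 'I_n) : Prop :=
  exists s : 'S_n, forall i, E i (s i).

Definition fluid_feasible (R : realType) (n : nat) (m : market R n)
    (lam mu : 'I_n -> R) (chi : 'I_n -> 'I_n -> R) : Prop :=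
  [/\ (forall j, lam j = \sum_(i < n) chi i j) /\
      (forall i, mu i = \sum_(j < n) chi i j),
      forall i j, compatible m i j -> 0 <= chi i j,
      forall i j, ~~ compatible m i j -> chi i j = 0,
      forall j, feasible_rate (demand_bound m j) (lam j)
    & forall i, feasible_rate (supply_bound m i) (mu i)].

Definition fluid_profit (R : realType) (n : nat) (m : market R n)
    (lam mu : 'I_n -> R) : R :=
  \sum_(j < n) lam j * demand m j (lam j)
  - \sum_(i < n) mu i * supply m i (mu i).

Definition fluid_value (R : realType) (n : nat) (m : market R n) : R :=
  sup [set v | exists lam mu chi,
    fluid_feasible m lam mu chi /\ v = fluid_profit m lam mu].

Definition fluid_optimal (R : realType) (n : nat) (m : market R n)
    (lam mu : 'I_n -> R) (chi : 'I_n -> 'I_n -> R) : Prop :=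
  fluid_feasible m lam mu chi /\
  forall lam' mu' chi', fluid_feasible m lam' mu' chi' ->
    fluid_profit m lam' mu' <= fluid_profit m lam mu.

Definition positive_fluid_solution (R : realType) (n : nat) (m : market R n)
    (lam mu : 'I_n -> R) (chi : 'I_n -> 'I_n -> R) : Prop :=
  [/\ fluid_optimal m lam mu chi, forall j, 0 < lam j & forall i, 0 < mu i].

Definition complete_resource_pooling (R : realType) (n : nat) (E : rel 'I_n)
    (lam mu : 'I_n -> R) : Prop :=
  (forall J : {set 'I_n}, (0 < #|J| < n)%N ->
    \sum_(j in J) lam j < \sum_(i < n | [exists j in J, E i j]) mu i) /\
  (forall I : {set 'I_n}, (0 < #|I| < n)%N ->
    \sum_(i in I) mu i < \sum_(j < n | [exists i in I, E i j]) lam j).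

Record state (n : nat) : Type := State {
  customers : {ffun 'I_n -> nat};
  servers : {ffun 'I_n -> nat}
}.

Definition state_pair (n : nat) (q : state n) := (customers q, servers q).
Definition pair_state (n : nat) (c : {ffun 'I_n -> nat} * {ffun 'I_n -> nat}) :=
  State c.1 c.2.
Lemma state_pairK (n : nat) : cancel (@state_pair n) (@pair_state n).
Proof. by case. Qed.

HB.instance Definition _ (n : nat) :=
  Countable.copy (state n) (can_type (@state_pairK n)).
HB.instance Definition _ (n : nat) :=
  isPointed.Build (state n) (State [ffun=> 0%N] [ffun=> 0%N]).
HB.instance Definition _ (n : nat) :=
  @isMeasurable.Build default_measure_display (state n) discrete_measurable
    discrete_measurable0 discrete_measurableC discrete_measurableU.

Definition increase (n : nat) (f : {ffun 'I_n -> nat}) (k : 'I_n) :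
    {ffun 'I_n -> nat} :=
  [ffun l => if l == k then (f l).+1 else f l].
Definition decrease (n : nat) (f : {ffun 'I_n -> nat}) (k : 'I_n) :
    {ffun 'I_n -> nat} :=
  [ffun l => if l == k then (f l).-1 else f l].

Definition customer_joins (n : nat) (q : state n) (j : 'I_n) : state n :=
  State (increase (customers q) j) (servers q).
Definition customer_leaves (n : nat) (q : state n) (j : 'I_n) : state n :=
  State (decrease (customers q) j) (servers q).
Definition server_joins (n : nat) (q : state n) (i : 'I_n) : state n :=
  State (customers q) (increase (servers q) i).
Definition server_leaves (n : nat) (q : state n) (i : 'I_n) : state n :=
  State (customers q) (decrease (servers q) i).

(* [server_match q i j] is the probability that a type-i server arriving in
   state q is matched with a waiting type-j customer, and [customer_match q i j]
   the probability that an arriving type-j customer is matched with a waiting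
   type-i server.  With the remaining probability the arrival joins its own
   queue. *)
Record matching (R : realType) (n : nat) : Type := Matching {
  server_match : state n -> 'I_n -> 'I_n -> R;
  customer_match : state n -> 'I_n -> 'I_n -> R
}.

(* Since x / 0 = 0, a zero denominator means that the arrival joins. *)
Definition randomized_matching (R : realType) (n : nat)
    (chi : 'I_n -> 'I_n -> R) : matching R n :=
  {| server_match := fun q i j =>
       chi i j * (0 < customers q j)%N%:R /
       (\sum_(j' < n) chi i j' * (0 < customers q j')%N%:R);
     customer_match := fun q i j =>
       chi i j * (0 < servers q i)%N%:R /
       (\sum_(i' < n) chi i' j * (0 < servers q i')%N%:R) |}.

(* [w] is a rule choosing one of the types compatible with the arrival (as
   told by [c]) that have the longest queue, if this queue is nonempty; ties
   may be broken in any, possibly random, state-dependent way. *)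
Definition longest_queue_rule (R : realType) (n : nat) (c : pred 'I_n)
    (queue : 'I_n -> nat) (w : 'I_n -> R) : Prop :=
  [/\ forall k, 0 <= w k,
      forall k, w k != 0 ->
        [/\ c k, (0 < queue k)%N & forall k', c k' -> (queue k' <= queue k)%N]
    & (exists2 k, c k & (0 < queue k)%N) -> \sum_(k < n) w k = 1].

Definition max_weight_matching (R : realType) (n : nat) (E : rel 'I_n)
    (M : matching R n) : Prop :=
  forall q : state n,
    (forall i, longest_queue_rule (fun j => E i j) (customers q)
                 (fun j => server_match M q i j)) /\
    (forall j, longest_queue_rule (fun i => E i j) (servers q)
                 (fun i => customer_match M q i j)).

Record pricing (R : realType) (n : nat) : Type := Pricing {
  customer_rate : state n -> 'I_n -> R;
  server_rate : state n -> 'I_n -> R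
}.

Definition two_price_policy (R : realType) (n : nat) (eta : nat)
    (lam mu theta phi : 'I_n -> R) (sigma tau : R) : pricing R n :=
  {| customer_rate := fun q j =>
       eta%:R * lam j - theta j * sigma * (tau < (customers q j)%:R)%R%:R;
     server_rate := fun q i =>
       eta%:R * mu i - phi i * sigma * (tau < (servers q i)%:R)%R%:R |}.

Definition transition_rate (R : realType) (n : nat) (p : pricing R n)
    (M : matching R n) (x y : state n) : R :=
  \sum_(j < n) customer_rate p x j *
    (\sum_(i < n) customer_match M x i j * (y == server_leaves x i)%:R
     + (1 - \sum_(i < n) customer_match M x i j) * (y == customer_joins x j)%:R)
  + \sum_(i < n) server_rate p x i *
    (\sum_(j < n) server_match M x i j * (y == customer_leaves x j)%:R
     + (1 - \sum_(j < n) server_match M x i j) * (y == server_joins x i)%:R).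

(* Nonnegative rates and global balance: the flow into y equals the flow out
   of y.  The total rates out of the states are bounded for the policies considered
   here, so that these are the invariant laws of the Markov process. *)
Definition stationary (R : realType) (n : nat) (rate : state n -> state n -> R)
    (P : probability (state n) R) : Prop :=
  (forall x y, 0 <= rate x y) /\
  forall y, ('E_P[fun x => rate x y] =
             P [set y] * \esum_(z in [set: state n]) (rate y z)%:E)%E.

(* The curve f^eta given by f^eta (eta * x) = f x. *)
Definition scaled_curve (R : realType) (eta : nat) (f : R -> R) : R -> R :=
  fun x => f (x / eta%:R).

(* Extended-real valued: the loss is +oo if some mean queue length is. *)
Definition profit_loss (R : realType) (n : nat) (m : market R n) (eta : nat)
    (p : pricing R n) (P : probability (state n) R) : \bar R :=
  ((eta%:R * fluid_value m)%:E
   - ('E_P[fun q : state n =>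
          (\sum_(j < n) customer_rate p q j *
             scaled_curve eta (demand m j) (customer_rate p q j)
           - \sum_(i < n) server_rate p q i *
             scaled_curve eta (supply m i) (server_rate p q i))%R]
      - \sum_(j < n) (customer_cost m j)%:E *
          'E_P[fun q : state n => (customers q j)%:R%R]
      - \sum_(i < n) (server_cost m i)%:E *
          'E_P[fun q : state n => (servers q i)%:R%R]))%E.

(* All costs are positive, so the default value 0 is harmless. *)
Definition max_cost (R : realType) (n : nat) (m : market R n) : R :=
  Num.max (\big[Num.max/0]_(i < n) server_cost m i)
          (\big[Num.max/0]_(j < n) customer_cost m j).

Definition max_weight_bound (R : realType) (n : nat) (m : market R n)
    (lam mu : 'I_n -> R) : R :=
  (\sum_(i < n) (mu i * derive1n 2 (supply m i) (mu i) / 2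
                  + derive1 (supply m i) (mu i))
   - \sum_(j < n) (lam j * derive1n 2 (demand m j) (lam j) / 2
                   + derive1 (demand m j) (lam j))
   + max_cost m / 2 * (\sum_(j < n) lam j + \sum_(i < n) mu i))
  * n%:R `^ (- (2 / 3)).

(* The per-type data that enter [max_weight_bound] are at most K. *)
Definition data_bounded_by (R : realType) (n : nat) (m : market R n)
    (lam mu : 'I_n -> R) (K : R) : Prop :=
  (forall j, [/\ lam j <= K, `|derive1 (demand m j) (lam j)| <= K,
                 `|derive1n 2 (demand m j) (lam j)| <= K & customer_cost m j <= K]) /\
  (forall i, [/\ mu i <= K, `|derive1 (supply m i) (mu i)| <= K,
                 `|derive1n 2 (supply m i) (mu i)| <= K & server_cost m i <= K]).

(* Main.v *)
Require Import Defs.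
From HB Require Import structures.
From mathcomp Require Import all_boot all_order all_algebra perm.
From mathcomp Require Import all_classical all_reals all_analysis.
From mathcomp Require Import measurable_realfun.
From mathcomp Require Import ring lra.

Set Implicit Arguments.
Unset Strict Implicit.
Unset Printing Implicit Defensive.

Import Order.TTheory GRing.Theory Num.Theory.
Import numFieldNormedType.Exports.

Local Open Scope ring_scope.
Local Open Scope classical_set_scope.

(** Everything rests on drift arguments for the generator [A f x], the sum over
the events [e] of [r_e x * (f (t_e x) - f x)].  Under a stationary law
[E (A f) = 0] for bounded [f], and truncating a nonnegative [V] shows that
[A V <= h - g] forces [E g <= E h].  A stationary law exists as soon as
[A V <= b - eps * (number in system)]: it is an ultrafilter limit of the Cesaro
averages of the uniformized chain, the drift making these averages tight.

Prices.  By optimality the marginal revenues and costs agree on the edges that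
the matching uses, so the first-order terms of the loss form [E (A W) = 0] for a
linear [W].  What remains are second-order terms of size [sigma ^ 2 / eta] and
the holding costs.

Queues.  With [V] the sum of the squared queue lengths, the sigma-perturbation of
the rates gives [E (total) = O (eta / sigma + tau)].  Under max-weight and
resource pooling [V - (Y - Z) ^ 2 / n], with [Y] customers and [Z] servers
waiting, has drift at most [- eta * c * (spread of the queues)] up to a constant
times [eta]; hence the queues of the waiting side stay balanced up to [O (1)], and
the drift of [(Y - Z) ^ 2] is [- 2 * sigma * n * |Y - Z|] up to lower order, which
gains the factor [1 / n] in the mean total.

Lower bound.  If the flow is a perfect matching inside a complete graph, the
network splits into independent pairs; on the levels below [tau] each is an
unbiased walk, whose mean distance from [0] is at least of the order of [tau]. *)

(** * Means of bounded observables *)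

(** The obstacle is integrability: stationarity gives balance at single states only, and no moment
    of the queue lengths is known beforehand. Hence real means serve for bounded observables,
    extended expectations for nonnegative ones, and queue lengths get real means only once a drift
    bound has made them finite.

    Both matchings are treated at once through a graph [H] on which a waiting partner is never
    refused: the support of [chi] for the randomized one, all compatible pairs for max-weight.
    Prices must agree across every edge of [H]: on the support of [chi] optimality gives this, on
    all compatible pairs it takes resource pooling. Drift bounds hold only in states where no
    [H]-pair waits on both sides, so the other states must be shown null.

    With [eta = s ^ 3] and [sigma] of order [s ^ 2], the price loss [sigma ^ 2 / eta] and the
    holding cost [eta / sigma] are both of order [s]. Under max-weight the former is summed over
    [2 * n] types and the latter is [eta * Lam / (2 * sigma * n)] with [Lam] of order [n]; the
    factor [n ^ (- 1 / 3)] in [sigma] makes both of order [n ^ (1 / 3) * s]. *)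

Definition bounded_observable (R : realType) (T : Type) (f : T -> R) : Prop :=
  exists C : R, forall x, `|f x| <= C.

Section BoundedObservables.
Variables (R : realType) (T : Type).
Implicit Types f g : T -> R.

Lemma bounded_observable_cst (c : R) : bounded_observable (fun _ : T => c).
Proof. by exists `|c|. Qed.

Lemma bounded_observable_add f g : bounded_observable f -> bounded_observable g ->
  bounded_observable (fun x => f x + g x).
Proof.
move=> [C fC] [D gD]; exists (C + D) => x.
by rewrite (le_trans (ler_normD _ _)) ?lerD.
Qed.

Lemma bounded_observable_mul f g : bounded_observable f -> bounded_observable g ->
  bounded_observable (fun x => f x * g x).
Proof.
move=> [C fC] [D gD]; exists (C * D) => x.
by rewrite normrM ler_pM.
Qed.

Lemma bounded_observable_opp f : bounded_observable f -> bounded_observable (fun x => - f x).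
Proof. by move=> [C fC]; exists C => x; rewrite normrN. Qed.

Lemma bounded_observable_sub f g : bounded_observable f -> bounded_observable g ->
  bounded_observable (fun x => f x - g x).
Proof. by move=> bf /bounded_observable_opp; exact: bounded_observable_add. Qed.

Lemma bounded_observable_sum (I : Type) (s : seq I) (Q : pred I) (F : I -> T -> R) :
  (forall i, bounded_observable (F i)) ->
  bounded_observable (fun x => \sum_(i <- s | Q i) F i x).
Proof.
move=> bF; elim: s => [|i s IH].
  by exists 0 => x; rewrite big_nil normr0.
case: (boolP (Q i)) => Qi; last first.
  by move: IH => [C IH]; exists C => x; rewrite big_cons (negPf Qi).
have [C h] := bounded_observable_add (bF i) IH.
by exists C => x; rewrite big_cons Qi.
Qed.

Lemma bounded_observable_indicator (p : T -> bool) : bounded_observable (fun x => (p x)%:R : R).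
Proof. by exists 1 => x; case: (p x); rewrite ?normr1 ?normr0. Qed.

End BoundedObservables.

(** States carry the discrete sigma-algebra, so as a hint this discharges the measurability side
    conditions below. *)
Lemma measurable_fun_state (n : nat) d (U : measurableType d)
  (D : set (state n)) (f : state n -> U) : measurable_fun D f.
Proof. by []. Qed.
#[local] Hint Resolve measurable_fun_state : core.

Section Mean.
Variables (R : realType) (n : nat) (P : probability (state n) R).
Local Notation T := (state n).
Implicit Types f g : T -> R.

Lemma bounded_integrable f : bounded_observable f ->
  P.-integrable setT (EFin \o f).
Proof.
move=> [C fC]; apply: (@measurable_bounded_integrable _ _ _ P) => //.
  by rewrite (le_lt_trans (probability_le1 _ _)) ?ltry.
exists C; split; first exact: num_real.
by move=> D CD x _; apply: le_trans (fC x) (ltW CD).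
Qed.

(** Through [fine], an infinite integral has mean 0; identities with ['E_P] therefore ask for
    boundedness or for a finite bound on the expectation. *)
Definition mean f : R := \int[P]_x f x.

Lemma expectation_mean f : bounded_observable f -> 'E_P[f]%E = (mean f)%:E.
Proof.
move=> bf; rewrite unlock /mean /Rintegral fineK//.
by apply: integrable_fin_num => //; exact: bounded_integrable.
Qed.

Lemma meanD f g : bounded_observable f -> bounded_observable g ->
  mean (fun x => f x + g x) = mean f + mean g.
Proof. by move=> bf bg; apply: RintegralD => //; exact: bounded_integrable. Qed.

Lemma meanZ c f : bounded_observable f -> mean (fun x => c * f x) = c * mean f.
Proof. by move=> bf; apply: RintegralZl => //; exact: bounded_integrable. Qed.

Lemma meanN f : bounded_observable f -> mean (fun x => - f x) = - mean f.
Proof.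
move=> bf; rewrite -mulN1r -meanZ//; congr mean; apply/funext => x.
by rewrite mulN1r.
Qed.

Lemma meanB f g : bounded_observable f -> bounded_observable g ->
  mean (fun x => f x - g x) = mean f - mean g.
Proof. by move=> bf bg; rewrite meanD ?meanN//; exact: bounded_observable_opp. Qed.

Lemma mean_cst c : mean (fun=> c) = c.
Proof.
by rewrite /mean Rintegral_cst//= probability_setT mulr1.
Qed.

Lemma mean_sum (I : finType) (F : I -> T -> R) :
  (forall i, bounded_observable (F i)) ->
  mean (fun x => \sum_i F i x) = \sum_i mean (F i).
Proof.
move=> bF; elim: (index_enum I) => [|i s IH].
  by rewrite big_nil -[RHS](mean_cst 0); congr mean; apply/funext => x; rewrite big_nil.
rewrite big_cons -IH -meanD//; last exact: bounded_observable_sum.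
by congr mean; apply/funext => x; rewrite big_cons.
Qed.

Lemma ae_le_mean f g : bounded_observable f -> bounded_observable g ->
  P [set x | g x < f x] = 0%E -> mean f <= mean g.
Proof.
move=> bf bg N0.
rewrite -lee_fin -!expectation_mean// -sube_ge0; last first.
  by rewrite expectation_mean.
rewrite (expectation_mean bf) (expectation_mean bg) -EFinB -meanB//.
have bfg := bounded_observable_sub bg bf.
rewrite -expectation_mean// unlock.
rewrite (@negligible_integral _ _ _ P setT [set x | g x < f x])//.
- apply: integral_ge0 => x [_] /= /negP.
  by rewrite -leNgt lee_fin subr_ge0.
- exact: bounded_integrable.
Qed.

Lemma le_mean f g : bounded_observable f -> bounded_observable g ->
  (forall x, f x <= g x) -> mean f <= mean g.
Proof.
move=> bf bg fg; apply: ae_le_mean => //.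
rewrite (_ : [set _ | _] = set0) ?measure0//.
by apply/seteqP; split => x //=; rewrite ltNge fg.
Qed.

Lemma mean_ge0 f : bounded_observable f -> (forall x, 0 <= f x) -> 0 <= mean f.
Proof.
by move=> bf f0; rewrite -(mean_cst 0); apply: le_mean => //; exact: bounded_observable_cst.
Qed.

Lemma mean_indicator (p : T -> bool) :
  (mean (fun x => (p x)%:R))%:E = P [set x | p x].
Proof.
rewrite -expectation_mean; last exact: bounded_observable_indicator.
rewrite -expectation_indic//; congr expectation; apply/funext => x.
rewrite indicE; congr (_ %:R); congr nat_of_bool.
by apply/idP/idP => [px|]; [rewrite inE|rewrite inE].
Qed.

End Mean.

(** * Global balance tested against observables *)

Section Generator.
Variables (R : realType) (n : nat) (I : finType).
Variables (r : I -> state n -> R) (t : I -> state n -> state n).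
Local Notation T := (state n).
Implicit Types f g V : T -> R.

Definition generator f (x : T) : R := \sum_(e : I) r e x * (f (t e x) - f x).

(** A finite set of events keeps the generator a finite sum. Events with the same target add their
    rates, and events that leave the state unchanged cancel from both sides of the balance. *)
Definition event_rate (x y : T) : R := \sum_(e : I) r e x * (y == t e x)%:R.

Hypothesis r_ge0 : forall e x, 0 <= r e x.
Hypothesis r_bounded : forall e, bounded_observable (r e).

Lemma generator_bounded f : bounded_observable f -> bounded_observable (generator f).
Proof.
move=> [C fC]; apply: bounded_observable_sum => e; apply: bounded_observable_mul => //.
apply: bounded_observable_sub; last by exists C.
by exists C => x; exact: fC.
Qed.

Lemma esum_event_rate (y : T) :
  (\esum_(z in [set: T]) (event_rate y z)%:E = (\sum_e r e y)%:E)%E.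
Proof.
under eq_esum => z _ do rewrite /event_rate -sumEFin.
rewrite esum_sum; last by move=> z e _ _; rewrite lee_fin mulr_ge0.
rewrite -sumEFin; apply: eq_bigr => e _.
rewrite (esumID [set t e y]); last by move=> z _; rewrite lee_fin mulr_ge0.
rewrite setTI esum_set1; last by rewrite lee_fin mulr_ge0.
rewrite eqxx mulr1 esum1 ?adde0// => z [_ /= /eqP].
by move=> /negPf ->; rewrite mulr0.
Qed.

Variable P : probability T R.
Hypothesis statP : stationary event_rate P.

Let flux_in f x := \sum_e r e x * f (t e x).
Let flux_out f x := (\sum_e r e x) * f x.

Let bounded_in f : bounded_observable f -> bounded_observable (flux_in f).
Proof.
move=> [C fC]; apply: bounded_observable_sum => e; apply: bounded_observable_mul => //.
by exists C => x; exact: fC.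
Qed.

(** Global balance at [y], read as an identity between two means whose difference is the mean of the
    generator applied to the indicator of [y]. *)
Lemma mean_flux_point (y : T) :
  mean P (flux_in (fun x => (x == y)%:R)) = mean P (flux_out (fun x => (x == y)%:R)).
Proof.
have b1 : bounded_observable (fun x : T => (x == y)%:R : R) by exact: bounded_observable_indicator.
apply: EFin_inj; rewrite -expectation_mean; last exact: bounded_in.
have := statP.2 y; rewrite esum_event_rate => E.
transitivity ('E_P[fun x => event_rate x y])%E.
  congr expectation; apply/funext => x; apply: eq_bigr => e _.
  by rewrite eq_sym.
have Py : (P [set y] = (mean P (fun x => (x == y)%:R))%:E)%E.
  rewrite mean_indicator; congr (P _).
  by apply/seteqP; split => x /= /eqP.
rewrite E Py -EFinM; congr EFin.
rewrite mulrC -meanZ//; congr mean; apply/funext => x.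
by rewrite /flux_out; case: eqP => [->//|]; rewrite !mulr0.
Qed.

End Generator.

Section MeanConvergence.
Variables (R : realType) (n : nat) (P : probability (state n) R).
Local Notation T := (state n).

Lemma mean_cvg (F : nat -> T -> R) (f : T -> R) (C : R) :
  (forall N x, `|F N x| <= C) ->
  (forall x, \forall N \near \oo, F N x = f x) ->
  (fun N => mean P (F N)) @ \oo --> mean P f.
Proof.
move=> FC Ff.
have fC x : `|f x| <= C.
  have [N _ /(_ N (leqnn N)) <-] := Ff x.
  exact: FC.
have bF N : bounded_observable (F N) by exists C.
have bf : bounded_observable f by exists C.
have mF N : measurable_fun [set: T] (fun x => (F N x)%:E) by [].
have mf : measurable_fun [set: T] (fun x => (f x)%:E) by [].
have cF : {ae P, forall x : T, setT x -> (F N x)%:E @[N --> \oo] --> (f x)%:E}.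
  apply: aeW => x _; apply: cvg_near_cst.
  by apply: filterS (Ff x) => N /= ->.
have iC : P.-integrable [set: T] (fun=> C%:E) by exact: finite_measure_integrable_cst.
have dF : {ae P, forall (x : T) N, setT x -> (`|(F N x)%:E| <= C%:E)%E}.
  by apply: aeW => x N _; rewrite /= lee_fin.
have [_ _] := dominated_convergence measurableT mF mf cF iC dF.
have -> : (\int[P]_x (EFin \o f) x)%E = (mean P f)%:E.
  by rewrite -expectation_mean// unlock.
move=> /fine_cvg; apply: cvg_trans; apply: near_eq_cvg; near=> N => /=.
by rewrite /mean /Rintegral.
Unshelve. all: by end_near. Qed.

End MeanConvergence.

Section StationaryGenerator.
Variables (R : realType) (n : nat) (I : finType).
Variables (r : I -> state n -> R) (t : I -> state n -> state n).
Local Notation T := (state n).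
Local Notation A := (generator r t).
Hypothesis r_ge0 : forall e x, 0 <= r e x.
Hypothesis r_bounded : forall e, bounded_observable (r e).
Variable P : probability T R.
Hypothesis statP : stationary (event_rate r t) P.

Lemma mean_generator_point (y : T) (c : R) :
  mean P (A (fun x => c * (x == y)%:R)) = 0.
Proof.
have := mean_flux_point r_ge0 r_bounded statP y.
move/eqP; rewrite -subr_eq0 -meanB; last 2 first.
- apply: bounded_observable_sum => e; apply: bounded_observable_mul => //.
  exact: (@bounded_observable_indicator R T (fun x => t e x == y)).
- apply: bounded_observable_mul; first exact: bounded_observable_sum.
  exact: bounded_observable_indicator.
set h := (X in mean P X == _) => /eqP h0.
have bh : bounded_observable h.
  apply: bounded_observable_sub.
  - apply: bounded_observable_sum => e; apply: bounded_observable_mul => //.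
    exact: (@bounded_observable_indicator R T (fun x => t e x == y)).
  - apply: bounded_observable_mul; first exact: bounded_observable_sum.
    exact: bounded_observable_indicator.
rewrite -[RHS](mulr0 c) -h0 -meanZ//; congr mean; apply/funext => x.
rewrite /h /generator big_distrl /= -sumrB big_distrr /=.
by apply: eq_bigr => e _; ring.
Qed.

(** States are countable, so [f] cut off to the states of code below [N] gains at most one point as
    [N] grows by one: induction on [N] gives mean 0 for the cut-off, and dominated convergence
    removes it. *)
Lemma mean_generator (f : T -> R) : bounded_observable f -> mean P (A f) = 0.
Proof.
move=> [C fC].
pose F N := A (fun x => f x * (pickle x < N)%N%:R).
have bi N : bounded_observable (fun x => f x * (pickle x < N)%N%:R).
  by apply: bounded_observable_mul; [exists C|exact: (@bounded_observable_indicator R T (fun x => (pickle x < N)%N))].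
have F0 N : mean P (F N) = 0.
  elim: N => [|N IH].
    rewrite -[RHS](mean_cst P 0); congr mean; apply/funext => x.
    by rewrite /F /generator big1// => e _; rewrite !ltn0 !mulr0 subrr mulr0.
  pose G : T -> R := A (fun x => f x * (pickle x == N)%N%:R).
  have bG : bounded_observable (fun x => f x * (pickle x == N)%N%:R).
    by apply: bounded_observable_mul; [exists C|exact: (@bounded_observable_indicator R T (fun x => (pickle x == N)))].
  have G0 : mean P G = 0.
    case: (pselect (exists y : T, pickle y = N)) => [[y yN]|noy].
      rewrite -(mean_generator_point y (f y)); congr (mean P (A _)).
      apply/funext => x; rewrite -yN (inj_eq (pcan_inj (@pickleK T))).
      by case: eqP => [->//|]; rewrite !mulr0.
    rewrite -[RHS](mean_cst P 0); congr mean; apply/funext => x.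
    rewrite /G /generator big1// => e _.
    have z (w : T) : (pickle w == N) = false.
      by apply/negP => /eqP wN; apply: noy; exists w.
    by rewrite !z !mulr0 subrr mulr0.
  rewrite -[0]addr0 -{1}IH -G0 -meanD; [|exact: generator_bounded..].
  congr mean; apply/funext => x; rewrite /F /G /generator -big_split /=.
  apply: eq_bigr => e _; rewrite -mulrDr; congr (_ * _).
  have z (w : T) : (pickle w < N.+1)%N%:R = (pickle w < N)%N%:R + (pickle w == N)%:R :> R.
    rewrite ltnS leq_eqVlt; case: ltngtP => //= _; rewrite ?addr0 ?add0r//.
  by rewrite !z; ring.
have [B hB] : exists B, forall N x, `|F N x| <= B.
  have [B rB] : bounded_observable (fun x => \sum_e r e x) by exact: bounded_observable_sum.
  exists (B * (C + C)) => N x.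
  have C0 : 0 <= C by apply: le_trans (fC point).
  have fN w : `|f w * (pickle w < N)%N%:R| <= C.
    by case: (_ < _)%N; rewrite ?mulr1// mulr0 normr0.
  apply: le_trans (ler_norm_sum _ _ _) _.
  apply: (@le_trans _ _ ((\sum_e r e x) * (C + C))).
    rewrite big_distrl /=; apply: ler_sum => e _.
    rewrite normrM (ger0_norm (r_ge0 e x)) ler_wpM2l//.
    by rewrite (le_trans (ler_normB _ _)) ?lerD.
  by rewrite ler_wpM2r ?addr_ge0// (le_trans (ler_norm _)).
have H : (fun N => mean P (F N)) @ \oo --> mean P (A f).
  apply: (mean_cvg (C := B)) => // x.
  near=> N; apply: eq_bigr => e _.
  suff [-> ->] : (pickle (t e x) < N)%N /\ (pickle x < N)%N by rewrite !mulr1.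
  (* Beyond the codes of [x] and of its finitely many successors the cut-off is invisible at [x]. *)
  have : ((\max_e pickle (t e x)) + pickle x < N)%N by near: N; exact: nbhs_infty_gt.
  have := @leq_bigmax I (fun e => pickle (t e x)) e.
  by move=> h1 h2; split; apply: leq_ltn_trans h2; [apply: leq_trans h1 _; exact: leq_addr|exact: leq_addl].
have : (fun N => mean P (F N)) @ \oo --> (0 : R).
  by under eq_fun do rewrite F0; exact: cvg_cst.
by move/(cvg_unique (@norm_hausdorff _ R) H).
Unshelve. all: by end_near. Qed.

End StationaryGenerator.

(** * Drift inequalities for unbounded functions *)

Section Comparison.
Variables (R : realType) (n : nat) (I : finType).
Variables (r : I -> state n -> R) (t : I -> state n -> state n).
Local Notation T := (state n).
Local Notation A := (generator r t).
Hypothesis r_ge0 : forall e x, 0 <= r e x.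
Hypothesis r_bounded : forall e, bounded_observable (r e).
Variable P : probability T R.
Hypothesis statP : stationary (event_rate r t) P.

(** Clipping to [[- K, K]] is 1-Lipschitz, so the generators of the clipped functions are bounded
    uniformly in [K], and dominated convergence applies although [W] itself may fail to be
    integrable. *)
Lemma mean_generator_lipschitz (W : T -> R) (c : R) :
  (forall e x, `|W (t e x) - W x| <= c) -> mean P (A W) = 0.
Proof.
move=> Wc.
pose cl (K : R) x := Num.max (- K) (Num.min (W x) K).
have cl_id (K : R) x : `|W x| <= K -> cl K x = W x.
  by rewrite ler_norml /cl => /andP[h1 h2]; rewrite (min_idPl h2) (max_idPr h1).
have max_lip (a x y : R) : `|Num.max a x - Num.max a y| <= `|x - y|.
  have [h|h] := lerP 0 (x - y); [rewrite (ger0_norm h)|rewrite (ltr0_norm h)];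
  by rewrite ler_norml; case: (lerP a x) => ?; case: (lerP a y) => ?; apply/andP; split; lra.
have min_lip (a x y : R) : `|Num.min x a - Num.min y a| <= `|x - y|.
  have [h|h] := lerP 0 (x - y); [rewrite (ger0_norm h)|rewrite (ltr0_norm h)];
  by rewrite ler_norml; case: (lerP x a) => ?; case: (lerP y a) => ?; apply/andP; split; lra.
have cl_lip K x y : `|cl K x - cl K y| <= `|W x - W y|.
  exact: le_trans (max_lip _ _ _) (min_lip _ _ _).
have cl_bd (K : nat) : bounded_observable (cl K%:R).
  exists K%:R => x; rewrite ler_norml /cl le_max lexx /= ge_max ge_min lexx orbT andbT.
  by rewrite lerNl (le_trans _ (ler0n R K))// oppr_le0.
have [B rB] : bounded_observable (fun x => \sum_e r e x) by exact: bounded_observable_sum.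
have H : (fun N : nat => mean P (A (cl N%:R))) @ \oo --> mean P (A W).
  apply: (mean_cvg (C := B * `|c|)) => [N x|x].
    apply: le_trans (ler_norm_sum _ _ _) _.
    apply: (@le_trans _ _ ((\sum_e r e x) * `|c|)).
      rewrite big_distrl /=; apply: ler_sum => e _.
      rewrite normrM (ger0_norm (r_ge0 e x)) ler_wpM2l//.
      by rewrite (le_trans (cl_lip _ _ _))// (le_trans (Wc _ _))// ler_norm.
    by rewrite ler_wpM2r// (le_trans (ler_norm _)).
  near=> N; apply: eq_bigr => e _.
  have hN : `|W x| + \sum_e `|W (t e x)| <= N%:R by near: N; exact: nbhs_infty_ger.
  have Se : `|W (t e x)| <= \sum_e `|W (t e x)|.
    by rewrite (bigD1 e)//= lerDl sumr_ge0.
  rewrite !cl_id//; first by apply: le_trans hN; rewrite lerDl sumr_ge0.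
  by apply: le_trans hN; rewrite (le_trans Se)// lerDr.
have : (fun N : nat => mean P (A (cl N%:R))) @ \oo --> (0 : R).
  rewrite (_ : (fun N : nat => _) = fun=> 0); first exact: cvg_cst.
  by apply/funext => N; apply: mean_generator.
by move/(cvg_unique (@norm_hausdorff _ R) H).
Unshelve. all: by end_near. Qed.

(* Truncating the Lyapunov function at level K only helps: the generator
   applied to min (V, K) is at most that of V below the level and nonpositive
   above it. *)
Lemma expectation_drift (good : T -> bool) (V g h : T -> R) :
  P [set x | ~~ good x] = 0%E ->
  (forall x, 0 <= V x) -> (forall x, 0 <= g x) -> (forall x, 0 <= h x) ->
  (forall x, good x -> A V x <= h x - g x) ->
  ('E_P[g] <= 'E_P[h])%E.
Proof.
move=> bad0 V0 g0 h0 drift.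
pose VK (K : nat) x := Num.min (V x) K%:R.
pose gK (K : nat) x := g x * (V x < K%:R)%R%:R.
have gK0 K x : 0 <= gK K x by rewrite mulr_ge0.
have bVK K : bounded_observable (VK K).
  exists K%:R => x; rewrite ger0_norm; first by rewrite /VK ge_min lexx orbT.
  by rewrite le_min V0 ler0n.
have AVK K x : good x -> A (VK K) x + gK K x <= h x.
  move=> gx; rewrite /gK; have [VK_lt|VK_ge] := ltrP (V x) K%:R.
    rewrite mulr1 -lerBrDr; apply: le_trans (drift x gx).
    apply: ler_sum => e _; rewrite ler_wpM2l//.
    rewrite {2}/VK (min_idPl (ltW VK_lt)) lerD2r.
    by rewrite /VK ge_min lexx.
  rewrite mulr0 addr0; apply: le_trans (h0 x).
  rewrite /generator sumr_le0// => e _; rewrite mulr_ge0_le0// subr_le0.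
  by rewrite {2}/VK (min_idPr VK_ge) /VK ge_min lexx orbT.
have gK_le K : ('E_P[gK K] <= 'E_P[h])%E.
  (* [A (VK K)] has mean 0 but changes sign; adding its bound [C] makes every integrand nonnegative,
     so expectations can be split before [gK K] or [h] is known to be integrable. *)
  have [C hC] := generator_bounded t r_bounded (bVK K).
  have C0 : 0 <= C by apply: le_trans (hC point).
  have mA := mean_generator r_ge0 r_bounded statP (bVK K).
  have bA := generator_bounded t r_bounded (bVK K).
  have AC0 x : 0 <= A (VK K) x + C.
    by have := hC x; rewrite ler_norml => /andP[]; lra.
  have EAC : 'E_P[(fun x => A (VK K) x + C)%R]%E = C%:E.
    have bC : bounded_observable (fun _ : T => C) by exact: bounded_observable_cst.
    by rewrite (expectation_mean P (bounded_observable_add bA bC)) meanD// mA add0r mean_cst.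
  have key : ('E_P[(fun x => (A (VK K) x + C) + gK K x)%R] <= 'E_P[(fun x => h x + C)%R])%E.
    apply: expectation_le => //.
    - by move=> x; rewrite addr_ge0.
    - by move=> x; rewrite addr_ge0.
    exists [set x | ~~ good x]; split => // x /= /negP.
    by rewrite -ltNge => H; apply/negP => /(AVK K); move: H; lra.
  have ED (f1 f2 : T -> R) : (forall x, 0 <= f1 x) -> (forall x, 0 <= f2 x) ->
      'E_P[(fun x => f1 x + f2 x)%R]%E = ('E_P[f1] + 'E_P[f2])%E.
    move=> f10 f20; rewrite unlock -ge0_integralD//=; last 2 first.
    - by move=> x _; rewrite lee_fin.
    - by move=> x _; rewrite lee_fin.
  move: key; rewrite (ED _ _ AC0 (gK0 K)) EAC (ED _ (fun=> C) h0 (fun=> C0)).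
  have EC : 'E_P[(fun _ : T => C)]%E = C%:E.
      by rewrite expectation_mean ?mean_cst//; exact: bounded_observable_cst.
    by rewrite EC (addeC C%:E) leeD2rE.
(* [gK] increases to [g] with the level, so the bound passes to the limit by monotone
   convergence. *)
pose G (K : nat) (x : T) := (gK K x)%:E.
have GE x : limn (G ^~ x) = (g x)%:E.
  apply/cvg_lim => //; apply: cvg_near_cst; near=> N.
  suff VN : V x < N%:R by rewrite /G /gK VN mulr1.
  by near: N; exact: nbhs_infty_gtr.
have ndG x : setT x -> nondecreasing_seq (G ^~ x).
  move=> _ a b ab; rewrite lee_fin /gK ler_wpM2l// ler_nat.
  by case: ltrP => //= ha; rewrite (lt_le_trans ha)// ler_nat.
have mG K : measurable_fun [set: T] (G K) by [].
have G0 K x : setT x -> (0 <= G K x)%E by rewrite lee_fin.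
have := monotone_convergence P measurableT mG G0 ndG.
under eq_integral do rewrite GE.
rewrite unlock => ->; apply: lime_le.
  apply: ereal_nondecreasing_is_cvgn => a b ab.
  by apply: ge0_le_integral => // x _; rewrite ?lee_fin//; exact: ndG.
by near=> N; have := gK_le N; rewrite unlock.
Unshelve. all: by end_near. Qed.

End Comparison.

(** * Existence of a stationary law *)

Lemma ultrafilter_map (T U : Type) (f : T -> U) (F : set_system T) :
  UltraFilter F -> UltraFilter (f @ F).
Proof.
move=> FU; split; first exact: fmap_proper_filter.
move=> G PG FG; apply/seteqP; split => // B GB.
have [//|Bc] := in_ultra_setVsetC (f @^-1` B) FU.
have FBc : (f @ F) (~` B) by [].
have : G (B `&` ~` B) by apply: filterI => //; exact: FG.
by rewrite setICr => /(@filter_not_empty _ G PG).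
Qed.

Lemma bounded_ultrafilter_cvg (R : realType) (T : Type) (F : set_system T)
    (u : T -> R) (C : R) : UltraFilter F -> (forall x, `|u x| <= C) ->
  u x @[x --> F] --> lim (u x @[x --> F]).
Proof.
move=> FU uC; have UU := ultrafilter_map u FU.
have FC : (u @ F) `[- C, C]%classic.
  by apply: (@filterS _ F _ setT); [move=> x _; rewrite /= in_itv /= -ler_norml|exact: filterT].
have := @segment_compact R (- C) C; rewrite compact_ultra => /(_ _ UU FC)[l [_ /= ul]].
by apply/cvg_ex; exists l.
Qed.

Definition total (n : nat) (x : state n) : nat :=
  (\sum_(j < n) customers x j + \sum_(i < n) servers x i)%N.

Definition box_state (n K : nat) (p : {ffun 'I_n -> 'I_K.+1} * {ffun 'I_n -> 'I_K.+1}) :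
  state n := State [ffun j => p.1 j : nat] [ffun i => p.2 i : nat].

Lemma box_state_inj (n K : nat) : injective (@box_state n K).
Proof.
move=> [a b] [c d] /= [/ffunP ac /ffunP bd]; congr pair; apply/ffunP => j; apply: val_inj.
  by have := ac j; rewrite !ffunE.
by have := bd j; rewrite !ffunE.
Qed.

Lemma box_stateP (n K : nat) (x : state n) : (total x <= K)%N ->
  exists p : {ffun 'I_n -> 'I_K.+1} * {ffun 'I_n -> 'I_K.+1}, x = box_state p.
Proof.
move=> xK; exists ([ffun j => inord (customers x j)], [ffun i => inord (servers x i)]).
case: x xK => y z; rewrite /total /box_state /= => xK.
congr State; apply/ffunP => k; rewrite !ffunE inordK// ltnS; apply: leq_trans xK.
  by rewrite (bigD1 k)//= -addnA leq_addr.
by rewrite addnC (bigD1 k)//= -addnA leq_addr.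
Qed.

Section Cesaro.
Variables (R : realType) (n : nat) (I : finType).
Variables (r : I -> state n -> R) (t : I -> state n -> state n).
Local Notation T := (state n).
Local Notation A := (generator r t).
Hypothesis r_ge0 : forall e x, 0 <= r e x.
Variable L : R.
Hypothesis L_gt0 : 0 < L.
Hypothesis r_le : forall x, \sum_e r e x <= L.
Variable good : T -> bool.
Variable x0 : T.
Hypothesis good0 : good x0.
Hypothesis good_step : forall e x, good x -> r e x != 0 -> good (t e x).
Implicit Types f g : T -> R.

(** The transition operator of the chain uniformized at rate [L], acting on observables: no law has
    to be built before the limit is taken. *)
Definition step f x := f x + L^-1 * A f x.
Definition cesaro (N : nat) f := N.+1%:R^-1 * \sum_(k < N.+1) iter k step f x0.

Lemma stepD f g : step (fun x => f x + g x) = (fun x => step f x + step g x).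
Proof.
apply/funext => x; rewrite /step addrACA -mulrDr; congr (_ + _ * _).
by rewrite /generator -big_split; apply: eq_bigr => e _ /=; ring.
Qed.

Lemma stepZ c f : step (fun x => c * f x) = (fun x => c * step f x).
Proof.
apply/funext => x; rewrite /step mulrDr; congr (_ + _).
rewrite mulrCA; congr (_ * _); rewrite /generator big_distrr.
by apply: eq_bigr => e _ /=; ring.
Qed.

Lemma step_cst c : step (fun=> c) = (fun=> c).
Proof.
apply/funext => x; rewrite /step /generator big1 ?mulr0 ?addr0// => e _.
by rewrite subrr mulr0.
Qed.

(** A step averages [f x] and the [f (t e x)] with nonnegative weights because [L] dominates the
    total rate, and from a good state only good targets carry weight. *)
Lemma step_le f g : (forall x, good x -> f x <= g x) ->
  forall x, good x -> step f x <= step g x.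
Proof.
move=> fg x gx.
have E h : step h x = (1 - L^-1 * \sum_e r e x) * h x + L^-1 * \sum_e r e x * h (t e x).
  rewrite /step /generator; under eq_bigr do rewrite mulrBr.
  rewrite sumrB -big_distrl /=; ring.
rewrite !E lerD//.
  by rewrite ler_wpM2l ?fg// subr_ge0 ler_pdivrMl// mulr1.
rewrite ler_wpM2l ?invr_ge0 ?(ltW L_gt0)//; apply: ler_sum => e _.
have [->|re0] := eqVneq (r e x) 0; first by rewrite !mul0r.
by rewrite ler_wpM2l// fg// good_step.
Qed.

Lemma iter_stepD k f g :
  iter k step (fun x => f x + g x) = (fun x => iter k step f x + iter k step g x).
Proof. by elim: k => //= k ->; rewrite stepD. Qed.

Lemma iter_stepZ k c f : iter k step (fun x => c * f x) = (fun x => c * iter k step f x).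
Proof. by elim: k => //= k ->; rewrite stepZ. Qed.

Lemma iter_step_cst k c : iter k step (fun=> c) = (fun=> c).
Proof. by elim: k => //= k ->; rewrite step_cst. Qed.

Lemma iter_step_le k f g : (forall x, good x -> f x <= g x) ->
  forall x, good x -> iter k step f x <= iter k step g x.
Proof. by move=> fg; elim: k => //= k IH; exact: step_le. Qed.

Lemma cesaroD N f g : cesaro N (fun x => f x + g x) = cesaro N f + cesaro N g.
Proof.
rewrite /cesaro -[RHS]mulrDr -big_split; congr (_ * _).
by apply: eq_bigr => k _; rewrite iter_stepD.
Qed.

Lemma cesaroZ N c f : cesaro N (fun x => c * f x) = c * cesaro N f.
Proof.
rewrite /cesaro [RHS]mulrCA; congr (_ * _); rewrite big_distrr.
by apply: eq_bigr => k _; rewrite iter_stepZ.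
Qed.

Lemma cesaro_cst N c : cesaro N (fun=> c) = c.
Proof.
rewrite /cesaro; under eq_bigr do rewrite iter_step_cst.
by rewrite sumr_const card_ord -[c *+ _]mulr_natl mulKf// pnatr_eq0.
Qed.

Lemma cesaro_le N f g : (forall x, good x -> f x <= g x) -> cesaro N f <= cesaro N g.
Proof.
move=> fg; rewrite /cesaro ler_wpM2l ?invr_ge0//.
by apply: ler_sum => k _; exact: iter_step_le.
Qed.

Lemma cesaro_norm N f C : (forall x, `|f x| <= C) -> `|cesaro N f| <= C.
Proof.
move=> fC; rewrite ler_norml -{1}(cesaro_cst N (- C)) -{2}(cesaro_cst N C).
by apply/andP; split; apply: cesaro_le => x _; have := fC x; rewrite ler_norml => /andP[].
Qed.

Lemma cesaro_step N f :
  cesaro N (step f) = cesaro N f + N.+1%:R^-1 * (iter N.+1 step f x0 - f x0).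
Proof.
rewrite /cesaro -[RHS]mulrDr; congr (_ * _).
rewrite big_ord_recr [in RHS]big_ord_recl /=.
have -> : \sum_(i < N) iter i step (step f) x0 = \sum_(i < N) iter (bump 0 i) step f x0.
  by apply: eq_bigr => i _; rewrite -iterSr.
by rewrite -iterSr /=; ring.
Qed.

(** Telescoping the drift over the iterates leaves only the end values of [V]. The last one is
    nonnegative and the first enters with weight [L / N.+1], so the bound is uniform in [N]. *)
Lemma cesaro_drift N (V g : T -> R) (b : R) : (forall x, 0 <= V x) ->
  (forall x, good x -> A V x <= b - g x) ->
  cesaro N g <= b + L * V x0.
Proof.
move=> V0 drift.
have : cesaro N (step V) <= cesaro N (fun x => V x + (L^-1 * b + (- L^-1) * g x)).
  apply: cesaro_le => x gx; rewrite /step lerD2l mulNr -mulrBr.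
  by rewrite ler_wpM2l ?invr_ge0 ?(ltW L_gt0)// drift.
rewrite cesaro_step cesaroD lerD2l cesaroD cesaro_cst cesaroZ => H.
have V1 : 0 <= iter N.+1 step V x0.
  have := @iter_step_le N.+1 (fun=> 0) V (fun x _ => V0 x) _ good0.
  by rewrite iter_step_cst.
have : - V x0 <= L^-1 * (b - cesaro N g).
  rewrite mulrBr -mulNr; apply: le_trans H.
  apply: (@le_trans _ _ (N.+1%:R^-1 * - V x0)).
    rewrite mulrN lerN2 ler_piMl// invf_le1 ?ltr0n//.
    by rewrite ler1n.
  by rewrite ler_wpM2l ?invr_ge0// lerBrDr addrC subrr.
rewrite -(ler_pM2l L_gt0) mulrA divff ?gt_eqF// mul1r; lra.
Qed.

End Cesaro.

Section Existence.
Variables (R : realType) (n : nat) (I : finType).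
Variables (r : I -> state n -> R) (t : I -> state n -> state n).
Local Notation T := (state n).
Local Notation A := (generator r t).
Hypothesis r_ge0 : forall e x, 0 <= r e x.
Hypothesis r_bounded : forall e, bounded_observable (r e).
Variable L : R.
Hypothesis L_gt0 : 0 < L.
Hypothesis r_le : forall x, \sum_e r e x <= L.
Variable good : T -> bool.
Variable x0 : T.
Hypothesis good0 : good x0.
Hypothesis good_step : forall e x, good x -> r e x != 0 -> good (t e x).
Hypothesis total_step : forall e x, (total x <= (total (t e x)).+1)%N.
Variable V : T -> R.
Variables b eps : R.
Hypothesis V_ge0 : forall x, 0 <= V x.
Hypothesis eps_gt0 : 0 < eps.
Hypothesis drift : forall x, good x -> A V x <= b - eps * (total x)%:R.
Variable U : set_system nat.
Hypothesis ultraU : UltraFilter U.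
Hypothesis U_infty : \oo `<=` U.

Local Notation step := (step r t L).
Local Notation cesaro := (cesaro r t L x0).

(** Along an ultrafilter the averages of all bounded observables converge at once, which makes [phi]
    linear without extracting subsequences; countable additivity is not automatic. *)
Definition phi (f : T -> R) : R := lim (cesaro N f @[N --> U]).

Lemma phi_cvg (f : T -> R) : bounded_observable f ->
  cesaro N f @[N --> U] --> phi f.
Proof.
move=> [C fC]; apply: (bounded_ultrafilter_cvg (C := C)) => N.
exact: (cesaro_norm r_ge0 L_gt0 r_le good0 good_step).
Qed.

Lemma phiD (f g : T -> R) : bounded_observable f -> bounded_observable g ->
  phi (fun x => f x + g x) = phi f + phi g.
Proof.
move=> bf bg; apply/cvg_lim => //.
under eq_fun do rewrite cesaroD.
by apply: cvgD; exact: phi_cvg.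
Qed.

Lemma phiZ (c : R) (f : T -> R) : bounded_observable f ->
  phi (fun x => c * f x) = c * phi f.
Proof.
move=> bf; apply/cvg_lim => //.
under eq_fun do rewrite cesaroZ.
by apply: cvgMl_tmp; exact: phi_cvg.
Qed.

Lemma phi_cst (c : R) : phi (fun=> c) = c.
Proof.
apply/cvg_lim => //; under eq_fun do rewrite cesaro_cst.
exact: cvg_cst.
Qed.

Lemma phi_le (f g : T -> R) : bounded_observable f -> bounded_observable g ->
  (forall x, f x <= g x) -> phi f <= phi g.
Proof.
move=> bf bg fg.
apply: (ler_cvg_to (phi_cvg bf) (phi_cvg bg)); apply: nearW => N.
exact: (cesaro_le r_ge0 L_gt0 r_le good0 good_step).
Qed.

Lemma phi_sum (J : finType) (F : J -> T -> R) :
  (forall j, bounded_observable (F j)) ->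
  phi (fun x => \sum_j F j x) = \sum_j phi (F j).
Proof.
move=> bF; elim: (index_enum J) => [|j s IH].
  by rewrite big_nil -[RHS](phi_cst 0); congr phi; apply/funext => x; rewrite big_nil.
rewrite big_cons -IH -phiD//; last exact: bounded_observable_sum.
by congr phi; apply/funext => x; rewrite big_cons.
Qed.

(** Shifting a Cesaro average by one step changes only its two end terms, which are [O (1 / N)]; as
    [U] refines [\oo], [phi] is invariant under [step]. *)
Lemma phi_generator (f : T -> R) : bounded_observable f -> phi (A f) = 0.
Proof.
move=> [C fC].
have bf : bounded_observable f by exists C.
have bA := generator_bounded t r_bounded bf.
have E : phi (step f) = phi f.
  apply/cvg_lim => //; under eq_fun do rewrite cesaro_step.
  rewrite -[phi f]addr0; apply: cvgD; first exact: phi_cvg.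
  suff : (fun N => N.+1%:R^-1 * (iter N.+1 step f x0 - f x0)) @ \oo --> (0 : R).
    by apply: cvg_trans => B; exact: U_infty.
  apply: norm_cvg0; apply: (@squeeze_cvgr _ _ _ _ (fun=> 0) (fun N => N.+1%:R^-1 * (C + C))).
  - apply: nearW => N; rewrite normr_ge0 normrM ger0_norm ?invr_ge0//=.
    rewrite ler_wpM2l ?invr_ge0// (le_trans (ler_normB _ _))// lerD//.
    rewrite ler_norml; apply/andP; split.
      have := @iter_step_le _ _ _ _ t r_ge0 L L_gt0 r_le good good_step N.+1 (fun=> - C) f.
      rewrite iter_step_cst; apply => // x _; have := fC x.
      by rewrite ler_norml => /andP[].
    have := @iter_step_le _ _ _ _ t r_ge0 L L_gt0 r_le good good_step N.+1 f (fun=> C).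
    rewrite iter_step_cst; apply => // x _; have := fC x.
    by rewrite ler_norml => /andP[].
  - exact: cvg_cst.
  - rewrite -[0](mul0r (C + C)); apply: cvgMr_tmp.
    exact: cvg_harmonic.
have : phi (step f) = phi f + L^-1 * phi (A f).
  rewrite -phiZ// -phiD//; apply: bounded_observable_mul => //.
  exact: bounded_observable_cst.
rewrite E => /eqP; rewrite -subr_eq0 opprD addrA subrr add0r oppr_eq0 mulf_eq0.
by rewrite invr_eq0 (gt_eqF L_gt0) => /eqP.
Qed.

Let M := (b + L * V x0) / eps.

(** Markov's inequality: [M] bounds the Cesaro means of the total uniformly in [N]. *)
Lemma phi_tail (K : nat) : phi (fun x => (K < total x)%N%:R) <= M / K.+1%:R.
Proof.
have bi : bounded_observable (fun x : T => (K < total x)%N%:R : R).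
  exact: (@bounded_observable_indicator R T (fun x => (K < total x)%N)).
apply: (ler_cvg_to (phi_cvg bi) (cvg_cst (M / K.+1%:R))).
apply: nearW => N; rewrite ler_pdivlMr ?ltr0n// /M ler_pdivlMr//.
apply: le_trans (cesaro_drift r_ge0 L_gt0 r_le good0 good_step N V_ge0 drift).
rewrite -mulrA mulrC -cesaroZ.
apply: (cesaro_le r_ge0 L_gt0 r_le good0 good_step) => x _.
case: ltnP => [Kx|_]; last by rewrite mulr0 mulr_ge0// ltW.
by rewrite mulr1 mulrC ler_wpM2l ?(ltW eps_gt0)// ler_nat.
Qed.

(* A family that is pointwise eventually zero tends to zero uniformly on the
   finite boxes, which carry all the mass of phi up to a small tail. *)
Lemma phi_vanish (F : nat -> T -> R) :
  (forall N x, 0 <= F N x <= 1) -> (forall x, \forall N \near \oo, F N x = 0) ->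
  (fun N => phi (F N)) @ \oo --> (0 : R).
Proof.
move=> F01 Fx0.
have bF N : bounded_observable (F N).
  by exists 1 => x; have /andP[F0 F1] := F01 N x; rewrite ger0_norm.
apply/cvgrPdist_le => e e0.
have [K hK] : exists K : nat, M / K.+1%:R <= e.
  have [K _ hK] := nbhs_infty_ger (M / e).
  exists K; rewrite ler_pdivrMr ?ltr0n// mulrC -ler_pdivrMr//.
  by rewrite (le_trans (hK K (leqnn K)))// ler_nat.
pose box := @box_state n K.
have [N0 hN0] : exists N0, forall p N, (N0 <= N)%N -> F N (box p) = 0.
  have /choice[m hm] : forall p, exists m, forall N, (m <= N)%N -> F N (box p) = 0.
    by move=> p; have [m _ hm] := Fx0 (box p); exists m => N; exact: hm.
  exists (\max_p m p) => p N le_N; apply: hm.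
  by apply: leq_trans le_N; exact: leq_bigmax.
exists N0 => // N /= le_N; rewrite sub0r normrN ger0_norm; last first.
  rewrite -(phi_cst 0); apply: phi_le => //; first exact: bounded_observable_cst.
  by move=> x; have /andP[] := F01 N x.
apply: le_trans hK; apply: le_trans (phi_tail K); apply: phi_le => //.
  exact: (@bounded_observable_indicator R T (fun x => (K < total x)%N)).
move=> x; case: ltnP => [_|xK]; first by have /andP[] := F01 N x.
by have [p ->] := box_stateP xK; rewrite hN0.
Qed.

Definition limit_measure (B : set T) : \bar R := (phi (\1_B))%:E.

Let bounded_indic (B : set T) : bounded_observable (\1_B : T -> R).
Proof. by exists 1 => x; rewrite indicE; case: (_ \in _); rewrite ?normr1 ?normr0. Qed.

Let limit_measure0 : limit_measure set0 = 0%E.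
Proof.
rewrite /limit_measure (_ : \1_set0 = fun=> 0) ?phi_cst//.
by apply/funext => x; rewrite indicE in_set0.
Qed.

Let limit_measure_ge0 B : (0 <= limit_measure B)%E.
Proof.
rewrite lee_fin -(phi_cst 0); apply: phi_le => //; exact: bounded_observable_cst.
Qed.

(** The defect after [N] sets is [phi] of the indicator of the points that lie only in later sets;
    at each point it is eventually 0, and tightness makes its [phi] vanish. *)
Let limit_measure_sigma_additive : semi_sigma_additive limit_measure.
Proof.
move=> B _ triv _; pose S N (x : T) := \sum_(i < N) (\1_(B i) x : R).
have SE N x : S N x = (`[< exists2 i, (i < N)%N & B i x >])%:R.
  rewrite /S; case: asboolP => [[i iN Bi]|no]; last first.
    rewrite big1// => i _; rewrite indicE; case: (boolP (_ \in _)) => //.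
    by rewrite inE => Bi; exfalso; apply: no; exists i.
  rewrite (bigD1 (Ordinal iN))//= indicE mem_set// big1 ?addr0// => j ji.
  rewrite indicE; case: (boolP (_ \in _)) => //; rewrite inE => Bj.
  have : (j : nat) = i by apply: (triv j i) => //; exists x.
  by move=> ji'; move: ji; rewrite -val_eqE /= ji' eqxx.
have -> : (fun N => \sum_(0 <= i < N) limit_measure (B i))%E = fun N => (phi (S N))%:E.
  apply/funext => N; rewrite big_mkord sumEFin phi_sum//.
apply: cvg_EFin; first by apply: nearW.
have bS N : bounded_observable (S N) by apply: bounded_observable_sum => i; exact: bounded_indic.
have -> : fine \o (fun N => (phi (S N))%:E) =
    fun N => phi (\1_(\bigcup_i B i)) - phi (fun x => \1_(\bigcup_i B i) x - S N x).
  apply/funext => N /=; rewrite phiD//; last exact: bounded_observable_opp.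
  rewrite (_ : (fun x => - S N x) = fun x => (-1) * S N x); last first.
    by apply/funext => x; rewrite mulN1r.
  by rewrite phiZ//; ring.
rewrite -[X in _ --> X]subr0; apply: cvgB; first exact: cvg_cst.
have DE x N : \1_(\bigcup_i B i) x - S N x =
   (`[< exists i, B i x >] && ~~ `[< exists2 i, (i < N)%N & B i x >])%:R.
  rewrite SE indicE; have -> : (x \in \bigcup_i B i) = `[< exists i, B i x >].
    apply/idP/asboolP; first by rewrite inE => -[i _]; exists i.
    by move=> [i Bi]; rewrite inE; exists i.
  case: asboolP => [ex|nex]; case: asboolP => [ex2|nex2] //=; rewrite ?subrr ?subr0//.
  by exfalso; apply: nex; move: ex2 => [i _]; exists i.
apply: phi_vanish => [N x|x]; first by rewrite DE ler0n lern1 leq_b1.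
case: (pselect (exists i, B i x)) => [[i Bi]|no].
  exists i.+1 => // N /= iN; rewrite DE; case: asboolP => //= _.
  by case: asboolP => // nex; exfalso; apply: nex; exists i.
by exists 0%N => // N _; rewrite /= DE; case: asboolP.
Qed.

HB.instance Definition _ := @isMeasure.Build _ _ _ limit_measure
  limit_measure0 limit_measure_ge0 limit_measure_sigma_additive.

Let limit_measureT : limit_measure setT = 1%E.
Proof.
rewrite /limit_measure (_ : \1_setT = fun=> 1) ?phi_cst//.
by apply/funext => x; rewrite indicE in_setT.
Qed.

HB.instance Definition _ :=
  @Measure_isProbability.Build _ _ _ limit_measure limit_measureT.

Local Notation Q := (limit_measure : probability T R).

(** On indicators integral and [phi] agree by definition, hence on finite combinations of them.
    Balance at [y] asks for no more: a jump lowers the total by at most one, so the inflow into [y]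
    is supported where the total is at most [(total y).+1]. *)
Lemma mean_limit_measure (f : T -> R) (K : nat) :
  (forall x, f x != 0 -> (total x <= K)%N) -> mean Q f = phi f.
Proof.
move=> fK; pose box := @box_state n K.
have fE : f = fun x => \sum_p f (box p) * (x == box p)%:R.
  apply/funext => x; case: (pselect (exists p, x = box p)) => [[p ->]|no].
    rewrite (bigD1 p)//= eqxx mulr1 big1 ?addr0// => p' p'p.
    by rewrite (inj_eq (@box_state_inj n K)) eq_sym (negPf p'p) mulr0.
  rewrite big1 => [|p _].
    by apply/eqP; apply: contra_notT no => /fK /box_stateP.
  by case: eqP => [xp|_]; [exfalso; apply: no; exists p|rewrite mulr0].
have b1 y : bounded_observable (fun x : T => (x == y)%:R : R).
  exact: bounded_observable_indicator.
have bc c y : bounded_observable (fun x : T => c * (x == y)%:R : R).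
  by apply: bounded_observable_mul => //; exact: bounded_observable_cst.
rewrite fE phi_sum// mean_sum//; apply: eq_bigr => p _.
rewrite phiZ// meanZ//; congr (_ * _); apply: EFin_inj; rewrite mean_indicator.
rewrite /= /limit_measure; congr (phi _)%:E; apply/funext => x.
by rewrite indicE; congr (nat_of_bool _)%:R; apply/idP/idP; rewrite inE.
Qed.

Lemma limit_measure_stationary : stationary (event_rate r t) Q.
Proof.
split=> [x y|y]; first by rewrite sumr_ge0// => e _; rewrite mulr_ge0.
have b1 : bounded_observable (fun x : T => (x == y)%:R : R).
  exact: bounded_observable_indicator.
have b2 e : bounded_observable (fun x : T => (y == t e x)%:R : R).
  exact: (@bounded_observable_indicator R T (fun x => y == t e x)).
have bR : bounded_observable (fun x => event_rate r t x y).
  by apply: bounded_observable_sum => e; exact: bounded_observable_mul.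
rewrite expectation_mean// (mean_limit_measure (K := (total y).+1)); last first.
  move=> x; apply: contraNT; rewrite -ltnNge => xy; apply/eqP.
  rewrite /event_rate big1// => e _; case: eqP => [ye|]; last by rewrite mulr0.
  by have := total_step e x; rewrite -ye leqNgt xy.
rewrite (esum_event_rate t r_ge0).
have -> : (Q [set y] = (phi (fun x => (x == y)%:R))%:E)%E.
  rewrite /= /limit_measure; congr (phi _)%:E; apply/funext => x.
  by rewrite indicE; congr (nat_of_bool _)%:R; apply/idP/eqP; rewrite inE.
rewrite -EFinM mulrC -phiZ//; congr EFin; apply/eqP; rewrite -subr_eq0.
have bc : bounded_observable (fun x : T => (\sum_e r e y) * (x == y)%:R : R).
  by apply: bounded_observable_mul => //; exact: bounded_observable_cst.
apply/eqP; rewrite -[RHS](phi_generator b1) -[in LHS]mulN1r -phiZ// -phiD//; last first.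
  by apply: bounded_observable_mul => //; exact: bounded_observable_cst.
congr phi; apply/funext => x; rewrite /event_rate /generator.
under [RHS]eq_bigr do rewrite mulrBr.
rewrite sumrB -big_distrl /= mulN1r; congr (_ - _).
  by apply: eq_bigr => e _; rewrite eq_sym.
by case: eqP => [->//|]; rewrite !mulr0.
Qed.

End Existence.

Lemma stationary_exists (R : realType) (n : nat) (I : finType)
    (r : I -> state n -> R) (t : I -> state n -> state n) (good : state n -> bool)
    (x0 : state n) (V : state n -> R) (b eps : R) :
  (forall e x, 0 <= r e x) -> (forall e, bounded_observable (r e)) ->
  good x0 -> (forall e x, good x -> r e x != 0 -> good (t e x)) ->
  (forall e x, (total x <= (total (t e x)).+1)%N) ->
  (forall x, 0 <= V x) -> 0 < eps ->
  (forall x, good x -> generator r t V x <= b - eps * (total x)%:R) ->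
  exists P : probability (state n) R, stationary (event_rate r t) P.
Proof.
move=> r0 rb g0 gs ts V0 e0 dr.
have [L hL] : bounded_observable (fun x => \sum_e r e x) by exact: bounded_observable_sum.
have L0 : 0 < `|L| + 1 by rewrite ltr_wpDl.
have rL x : \sum_e r e x <= `|L| + 1.
  apply: le_trans (ler_norm _) _; apply: le_trans (hL x) _.
  by rewrite (le_trans (ler_norm L))// lerDl.
have [U [uU subU]] := @ultraFilterLemma nat \oo _.
eexists; exact: (limit_measure_stationary r0 rb L0 rL g0 gs ts V0 e0 dr uU subU).
Qed.

(** * The queueing process *)

(** The default 1 of the minimum covers an empty [p]. Such margins make finitely many strict
    inequalities quantitative. *)
Lemma finite_positive_bound (R : realType) (T : finType) (p : pred T) (f : T -> R) :
  (forall x, p x -> 0 < f x) -> exists2 c, 0 < c & forall x, p x -> c <= f x.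
Proof.
move=> f0; exists (\big[Num.min/1]_(x | p x) f x).
  by apply: lt_bigmin.
by move=> x px; apply: bigmin_le_cond.
Qed.

Section ServiceRule.
Variables (R : realType) (n : nat).

(** The part of the max-weight rule that randomized matching shares. *)
Definition service_rule (c : pred 'I_n) (queue : 'I_n -> nat) (w : 'I_n -> R) : Prop :=
  [/\ forall k, 0 <= w k,
      forall k, w k != 0 -> c k /\ (0 < queue k)%N
    & (exists2 k, c k & (0 < queue k)%N) -> \sum_(k < n) w k = 1].

Lemma service_rule_idle c queue w : service_rule c queue w ->
  (forall k, c k -> queue k = 0%N) -> forall k, w k = 0.
Proof.
move=> [_ w_c _] q0 k; apply/eqP; apply: contraT => /w_c[/q0 ->].
by rewrite ltnn.
Qed.

Lemma service_rule_sum c queue w : service_rule c queue w ->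
  \sum_(k < n) w k = 0 \/ \sum_(k < n) w k = 1.
Proof.
move=> S; have [_ _ w1] := S.
case: (pselect (exists2 k, c k & (0 < queue k)%N)) => [/w1|no]; first by right.
left; rewrite big1// => k _; apply: (service_rule_idle S) => l cl.
by apply/eqP; rewrite -leqn0 leqNgt; apply/negP => q0; apply: no; exists l.
Qed.

Lemma service_rule_sum_le1 c queue w : service_rule c queue w ->
  \sum_(k < n) w k <= 1.
Proof. by move=> /service_rule_sum [] ->; rewrite ?ler01. Qed.

Lemma service_rule_le1 c queue w k : service_rule c queue w -> w k <= 1.
Proof.
move=> S; apply: le_trans (service_rule_sum_le1 S); have [w0 _ _] := S.
by rewrite (bigD1 k)//= lerDl sumr_ge0.
Qed.

Definition greedy_matching (H : rel 'I_n) (M : matching R n) : Prop :=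
  forall q : state n,
    (forall i, service_rule (fun j => H i j) (customers q) (fun j => server_match M q i j)) /\
    (forall j, service_rule (fun i => H i j) (servers q) (fun i => customer_match M q i j)).

End ServiceRule.

Section Events.
Variables (R : realType) (n : nat) (p : pricing R n) (M : matching R n).
Local Notation T := (state n).

Definition event : finType := (('I_n * 'I_n + 'I_n) + ('I_n * 'I_n + 'I_n))%type.

Definition event_target (e : event) (x : T) : T :=
  match e with
  | inl (inl (i, _)) => server_leaves x i
  | inl (inr j) => customer_joins x j
  | inr (inl (_, j)) => customer_leaves x j
  | inr (inr i) => server_joins x i
  end.

Definition event_intensity (e : event) (x : T) : R :=
  match e with
  | inl (inl (i, j)) => customer_rate p x j * customer_match M x i j
  | inl (inr j) => customer_rate p x j * (1 - \sum_(i < n) customer_match M x i j)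
  | inr (inl (i, j)) => server_rate p x i * server_match M x i j
  | inr (inr i) => server_rate p x i * (1 - \sum_(j < n) server_match M x i j)
  end.

Lemma sum_event (F : event -> R) :
  \sum_e F e = \sum_(j < n) (\sum_(i < n) F (inl (inl (i, j))) + F (inl (inr j))) +
               \sum_(i < n) (\sum_(j < n) F (inr (inl (i, j))) + F (inr (inr i))).
Proof.
rewrite big_sumType !big_sumType /= !big_split /=.
congr (_ + _ + (_ + _)); last by rewrite pair_bigA; apply: eq_bigr => -[].
by rewrite exchange_big pair_bigA; apply: eq_bigr => -[].
Qed.

Lemma transition_event_rate x y :
  transition_rate p M x y = event_rate event_intensity event_target x y.
Proof.
rewrite /event_rate sum_event /=; congr (_ + _); apply: eq_bigr => k _;
  by rewrite mulrDr mulr_sumr mulrA; congr (_ + _); apply: eq_bigr => l _; rewrite mulrA.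
Qed.

Lemma generatorE (f : T -> R) x :
  generator event_intensity event_target f x =
  \sum_(j < n) customer_rate p x j *
    (\sum_(i < n) customer_match M x i j * (f (server_leaves x i) - f x)
     + (1 - \sum_(i < n) customer_match M x i j) * (f (customer_joins x j) - f x))
  + \sum_(i < n) server_rate p x i *
    (\sum_(j < n) server_match M x i j * (f (customer_leaves x j) - f x)
     + (1 - \sum_(j < n) server_match M x i j) * (f (server_joins x i) - f x)).
Proof.
rewrite /generator sum_event /=; congr (_ + _); apply: eq_bigr => k _;
  by rewrite [RHS]mulrDr mulr_sumr mulrA; congr (_ + _); apply: eq_bigr => l _; rewrite mulrA.
Qed.

Lemma sum_increase (u : 'I_n -> nat -> R) (y : {ffun 'I_n -> nat}) k :
  \sum_j u j (increase y k j) - \sum_j u j (y j) = u k (y k).+1 - u k (y k).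
Proof.
rewrite (bigD1 k)//= [X in _ - X](bigD1 k)//= ffunE eqxx.
rewrite [X in _ + X - _](eq_bigr (fun j => u j (y j))); first by ring.
by move=> j /negPf jk; rewrite ffunE jk.
Qed.

Lemma sum_decrease (u : 'I_n -> nat -> R) (y : {ffun 'I_n -> nat}) k :
  \sum_j u j (decrease y k j) - \sum_j u j (y j) = u k (y k).-1 - u k (y k).
Proof.
rewrite (bigD1 k)//= [X in _ - X](bigD1 k)//= ffunE eqxx.
rewrite [X in _ + X - _](eq_bigr (fun j => u j (y j))); first by ring.
by move=> j /negPf jk; rewrite ffunE jk.
Qed.

(** A jump moves one coordinate, so one increment survives per event; the quadratic, price and link
    drifts all start from here. *)
Lemma generator_separable (u v : 'I_n -> nat -> R) x :
  let y := customers x in let z := servers x in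
  generator event_intensity event_target
    (fun q => \sum_j u j (customers q j) + \sum_i v i (servers q i)) x =
  \sum_(j < n) customer_rate p x j *
    (\sum_(i < n) customer_match M x i j * (v i (z i).-1 - v i (z i))
     + (1 - \sum_(i < n) customer_match M x i j) * (u j (y j).+1 - u j (y j)))
  + \sum_(i < n) server_rate p x i *
    (\sum_(j < n) server_match M x i j * (u j (y j).-1 - u j (y j))
     + (1 - \sum_(j < n) server_match M x i j) * (v i (z i).+1 - v i (z i))).
Proof.
move=> y z; rewrite generatorE; congr (_ + _); apply: eq_bigr => k _; congr (_ * (_ + _ * _)).
- apply: eq_bigr => i _; congr (_ * _).
  by rewrite /= opprD addrACA subrr add0r sum_decrease.
- by rewrite /= opprD addrACA subrr addr0 sum_increase.
- apply: eq_bigr => i _; congr (_ * _).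
  by rewrite /= opprD addrACA subrr addr0 sum_decrease.
- by rewrite /= opprD addrACA subrr add0r sum_increase.
Qed.

Lemma total_step e x : (total x <= (total (event_target e x)).+1)%N.
Proof.
have inc (y : {ffun 'I_n -> nat}) k : (\sum_j y j <= \sum_j increase y k j)%N.
  by apply: leq_sum => j _; rewrite ffunE; case: eqP.
have dec (y : {ffun 'I_n -> nat}) k : (\sum_j y j <= (\sum_j decrease y k j).+1)%N.
  rewrite (bigD1 k)//= [X in (_ <= X.+1)%N](bigD1 k)//= ffunE eqxx -addSn leq_add ?leqSpred//.
  by apply: leq_sum => j /negPf jk; rewrite ffunE jk.
rewrite /total; case: e => -[[i j]|k] /=.
- by rewrite -addnS leq_add2l.
- by rewrite -addSn leq_add2r leqW.
- by rewrite -addSn leq_add2r.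
- by rewrite -addnS leq_add2l leqW.
Qed.

Hypothesis customer_rate_ge0 : forall x j, 0 <= customer_rate p x j.
Hypothesis server_rate_ge0 : forall x i, 0 <= server_rate p x i.
Variable H : rel 'I_n.
Hypothesis HM : greedy_matching H M.

Lemma event_intensity_ge0 e x : 0 <= event_intensity e x.
Proof.
have [S C] := HM x.
case: e => -[[i j]|k] /=; rewrite mulr_ge0//.
- by have [] := C j.
- by rewrite subr_ge0 (service_rule_sum_le1 (C k)).
- by have [] := S i.
- by rewrite subr_ge0 (service_rule_sum_le1 (S k)).
Qed.

Lemma event_intensity_bounded e :
  (forall j, bounded_observable (fun x => customer_rate p x j)) ->
  (forall i, bounded_observable (fun x => server_rate p x i)) ->
  bounded_observable (event_intensity e).
Proof.
move=> bc bs.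
have b01 (w : T -> R) : (forall x, 0 <= w x <= 1) -> bounded_observable w.
  by move=> w01; exists 1 => x; have /andP[w0 w1] := w01 x; rewrite ger0_norm.
case: e => -[[i j]|k] /=; apply: bounded_observable_mul => //; apply: b01 => x;
  have [S C] := HM x.
- by have [w0 _ _] := C j; rewrite w0 (service_rule_le1 i (C j)).
- rewrite subr_ge0 (service_rule_sum_le1 (C k))//= lerBlDr lerDl sumr_ge0// => i _.
  by have [w0 _ _] := C k.
- by have [w0 _ _] := S i; rewrite w0 (service_rule_le1 j (S i)).
- rewrite subr_ge0 (service_rule_sum_le1 (S k))//= lerBlDr lerDl sumr_ge0// => i _.
  by have [w0 _ _] := S k.
Qed.

Definition good (x : T) : bool :=
  [forall i, forall j, H i j ==> (customers x j == 0%N) || (servers x i == 0%N)].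

Lemma goodP x : reflect
  (forall i j, H i j -> (0 < customers x j)%N -> servers x i = 0%N) (good x).
Proof.
apply: (iffP forallP) => [g i j Hij yj|g i].
  by move: (forallP (g i) j); rewrite Hij -leqn0 leqNgt yj /= => /eqP.
apply/forallP => j; apply/implyP => Hij.
by have [//|yj] := posnP (customers x j); rewrite (g i j).
Qed.

Lemma good_customers x : good x ->
  forall i j, H i j -> (0 < servers x i)%N -> customers x j = 0%N.
Proof.
move=> /goodP g i j Hij zi; apply/eqP; rewrite -leqn0 leqNgt; apply/negP => yj.
by move: zi; rewrite (g i j).
Qed.

(* No transition of positive rate increases it, and in a bad state some such
   transition decreases it; hence bad states have stationary probability 0. *)
Definition overlap (x : T) : nat :=
  (\sum_(i < n) \sum_(j < n | H i j) customers x j * servers x i)%N.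

End Events.

(** What the drift arguments ask of matching and policy. The strict bounds keep every rate positive
    after the price change; the last two fields say that the matching removes at least as much queue
    weight as service by the flow [chi] would. *)
Record two_price_regime (R : realType) (n : nat) (H : rel 'I_n)
    (chi : 'I_n -> 'I_n -> R) (M : matching R n) (eta : nat)
    (lam mu theta phi : 'I_n -> R) (sigma tau : R) : Prop := TwoPriceRegime {
  regime_sigma : 0 < sigma;
  regime_tau : 0 <= tau;
  regime_theta : forall j, 0 < theta j;
  regime_phi : forall i, 0 < phi i;
  regime_lam : forall j, theta j * sigma < eta%:R * lam j;
  regime_mu : forall i, phi i * sigma < eta%:R * mu i;
  regime_greedy : greedy_matching H M;
  regime_lamE : forall j, lam j = \sum_(i < n) chi i j;
  regime_muE : forall i, mu i = \sum_(j < n) chi i j;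
  regime_server : forall x i,
    \sum_(j < n) chi i j * (customers x j)%:R <=
    mu i * \sum_(j < n) server_match M x i j * (customers x j)%:R;
  regime_customer : forall x j,
    \sum_(i < n) chi i j * (servers x i)%:R <=
    lam j * \sum_(i < n) customer_match M x i j * (servers x i)%:R
}.

(** * Quadratic drift under the two-price policy *)

Section HalfDrift.
Variables (R : realType) (n : nat).

(** One side of the market: [y] waits and [w] serves it. A type that serves some queue has no queue
    of its own, hence is not slowed down, which removes [b]. The thinning by [1 - s] is dropped
    since rates are nonnegative; the slowing [a] of the arrivals remains as negative drift. *)
Lemma half_drift (y z : 'I_n -> nat) (A B a b s : 'I_n -> R) (tau : R)
    (w : 'I_n -> 'I_n -> R) :
  0 <= tau ->
  (forall j, 0 <= s j) ->
  (forall j, 0 <= A j - a j * (tau < (y j)%:R)%R%:R) ->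
  (forall i j, w i j != 0 -> z i = 0%N) ->
  \sum_j (A j - a j * (tau < (y j)%:R)%R%:R) * ((1 - s j) * (y j)%:R)
  - \sum_i (B i - b i * (tau < (z i)%:R)%R%:R) * (\sum_j w i j * (y j)%:R)
  <= - (\sum_j a j * ((y j)%:R * (tau < (y j)%:R)%R%:R))
     - (\sum_i B i * (\sum_j w i j * (y j)%:R) - \sum_j A j * (y j)%:R).
Proof.
move=> tau0 s0 rate0 wz.
have -> : \sum_i (B i - b i * (tau < (z i)%:R)%R%:R) * (\sum_j w i j * (y j)%:R)
        = \sum_i B i * (\sum_j w i j * (y j)%:R).
  apply: eq_bigr => i _; have [|] := ltrP tau (z i)%:R; last by rewrite mulr0 subr0.
  move=> tz; rewrite big1 ?mulr0// => j _.
  apply/eqP; rewrite mulf_eq0; apply/orP; left; apply: contraT => /wz zi.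
  by move: tz; rewrite zi ltNge tau0.
have : \sum_j (A j - a j * (tau < (y j)%:R)%R%:R) * ((1 - s j) * (y j)%:R) <=
       \sum_j A j * (y j)%:R - \sum_j a j * ((y j)%:R * (tau < (y j)%:R)%R%:R).
  rewrite -sumrB; apply: ler_sum => j _.
  rewrite [X in _ <= X](_ : _ = (A j - a j * (tau < (y j)%:R)%R%:R) * (y j)%:R); last by ring.
  by rewrite ler_wpM2l// ler_piMl// lerBlDr lerDl.
lra.
Qed.

End HalfDrift.

Section TwoPrice.
Variables (R : realType) (n : nat) (H : rel 'I_n).
Variables (chi : 'I_n -> 'I_n -> R) (M : matching R n) (eta : nat).
Variables (lam mu theta phi : 'I_n -> R) (sigma tau : R).
Hypothesis regime : two_price_regime H chi M eta lam mu theta phi sigma tau.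
Local Notation T := (state n).

Let p := two_price_policy eta lam mu theta phi sigma tau.
Local Notation A := (generator (event_intensity p M) (@event_target n)).

Let sigma0 : 0 < sigma := regime_sigma regime.
Let tau0 : 0 <= tau := regime_tau regime.
Let HM : greedy_matching H M := regime_greedy regime.

Lemma customer_rate_gt0 x j : 0 < customer_rate p x j.
Proof.
rewrite /= subr_gt0; apply: le_lt_trans (regime_lam regime j).
have h : 0 < theta j * sigma by rewrite mulr_gt0 ?(regime_theta regime).
by case: (_ < _)%R; rewrite ?mulr1// mulr0 ltW.
Qed.

Lemma server_rate_gt0 x i : 0 < server_rate p x i.
Proof.
rewrite /= subr_gt0; apply: le_lt_trans (regime_mu regime i).
have h : 0 < phi i * sigma by rewrite mulr_gt0 ?(regime_phi regime).
by case: (_ < _)%R; rewrite ?mulr1// mulr0 ltW.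
Qed.

Lemma customer_rate_le x j : customer_rate p x j <= eta%:R * lam j.
Proof.
rewrite /= lerBlDr lerDl mulr_ge0// mulr_ge0// ltW//; exact: (regime_theta regime).
Qed.

Lemma server_rate_le x i : server_rate p x i <= eta%:R * mu i.
Proof.
rewrite /= lerBlDr lerDl mulr_ge0// mulr_ge0// ltW//; exact: (regime_phi regime).
Qed.

Lemma regime_intensity_ge0 e x : 0 <= event_intensity p M e x.
Proof.
by apply: event_intensity_ge0 HM e x => x k; apply: ltW;
  [exact: customer_rate_gt0|exact: server_rate_gt0].
Qed.

Lemma regime_intensity_bounded e : bounded_observable (event_intensity p M e).
Proof.
apply: (event_intensity_bounded HM) => k.
  exists (eta%:R * lam k) => x.
  by rewrite ger0_norm ?customer_rate_le// ltW// customer_rate_gt0.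
exists (eta%:R * mu k) => x.
by rewrite ger0_norm ?server_rate_le// ltW// server_rate_gt0.
Qed.

Lemma regime_stationary (P : probability T R) :
  stationary (transition_rate p M) P <->
  stationary (event_rate (event_intensity p M) (@event_target n)) P.
Proof.
suff -> : transition_rate p M = event_rate (event_intensity p M) (@event_target n) by [].
by apply/funext => x; apply/funext => y; exact: transition_event_rate.
Qed.

(** Arrivals join only if no [H]-partner waits, and departures only shorten queues. *)
Lemma good_step e x : good H x -> event_intensity p M e x != 0 ->
  good H (event_target e x).
Proof.
move=> gx; have [S C] := HM x.
case: e => -[[i j]|k] /=.
- move=> _; apply/goodP => i' j' Hij yj /=; rewrite ffunE.
  by rewrite (goodP _ _ gx i' j' Hij yj); case: eqP.
- move=> rate; apply/goodP => i' j' Hij /=; rewrite ffunE.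
  case: eqP => [jk _|_]; last exact: (goodP _ _ gx).
  apply/eqP; rewrite -leqn0 leqNgt; apply/negP => zi.
  have [_ _ s1] := C k; move: rate; rewrite s1 ?subrr ?mulr0 ?eqxx//.
  by exists i' => //; rewrite -jk.
- move=> _; apply/goodP => i' j' Hij /=; rewrite ffunE => yj.
  apply: (goodP _ _ gx i' j' Hij); move: yj.
  by case: eqP => // _ yj; apply: leq_trans yj (leq_pred _).
- move=> rate; apply/goodP => i' j' Hij yj /=; rewrite ffunE.
  case: eqP => [ik|_]; last exact: (goodP _ _ gx i' j').
  have [_ _ s1] := S k; move: rate; rewrite s1 ?subrr ?mulr0 ?eqxx//.
  by exists j' => //; rewrite -ik.
Qed.

Lemma overlap_server_leaves x i : (overlap H (server_leaves x i) <= overlap H x)%N.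
Proof.
apply: leq_sum => i' _; apply: leq_sum => j' _ /=; rewrite ffunE leq_mul//.
by case: ifP; rewrite ?leq_pred.
Qed.

Lemma overlap_customer_leaves x j : (overlap H (customer_leaves x j) <= overlap H x)%N.
Proof.
apply: leq_sum => i' _; apply: leq_sum => j' _ /=; rewrite ffunE leq_mul//.
by case: ifP; rewrite ?leq_pred.
Qed.

Lemma overlap_server_leaves_lt x i j : H i j -> (0 < customers x j)%N ->
  (0 < servers x i)%N -> (overlap H (server_leaves x i) < overlap H x)%N.
Proof.
move=> Hij yj zi; rewrite /overlap (bigD1 i)//= [ltnRHS](bigD1 i)//=.
rewrite -addSn leq_add//; last first.
  by apply: leq_sum => i' /negPf i'i; apply: leq_sum => j' _; rewrite ffunE i'i.
rewrite (bigD1 j)//= [ltnRHS](bigD1 j)//= ffunE eqxx -addSn leq_add//.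
  by rewrite ltn_pmul2l// prednK.
by apply: leq_sum => j' _; rewrite leq_mul2l leq_pred orbT.
Qed.

Lemma overlap_customer_joins x j : (forall i, H i j -> servers x i = 0%N) ->
  overlap H (customer_joins x j) = overlap H x.
Proof.
move=> z0; apply: eq_bigr => i' _; apply: eq_bigr => j' Hij /=; rewrite ffunE.
by case: eqP => // j'j; rewrite z0 ?muln0// -j'j.
Qed.

Lemma overlap_server_joins x i : (forall j, H i j -> customers x j = 0%N) ->
  overlap H (server_joins x i) = overlap H x.
Proof.
move=> y0; apply: eq_bigr => i' _; apply: eq_bigr => j' Hij /=; rewrite ffunE.
by case: eqP => // i'i; rewrite y0 ?mul0n// -i'i.
Qed.

Lemma overlap_target e x : event_intensity p M e x != 0 ->
  (overlap H (event_target e x) <= overlap H x)%N.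
Proof.
have [S C] := HM x; case: e => -[[i j]|k] /=.
- by move=> _; exact: overlap_server_leaves.
- move=> rate; rewrite overlap_customer_joins// => i Hi.
  apply/eqP; rewrite -leqn0 leqNgt; apply/negP => zi.
  have [_ _ s1] := C k; move: rate; rewrite s1 ?subrr ?mulr0 ?eqxx//.
  by exists i.
- by move=> _; exact: overlap_customer_leaves.
- move=> rate; rewrite overlap_server_joins// => j Hj.
  apply/eqP; rewrite -leqn0 leqNgt; apply/negP => yj.
  have [_ _ s1] := S k; move: rate; rewrite s1 ?subrr ?mulr0 ?eqxx//.
  by exists j.
Qed.

(** Drift with [V] the overlap: it never rises, and in a bad state it falls at rate at least [c], a
    lower bound of the customer rates; hence [c] times the mass of the bad states is at most 0. *)
Lemma bad_null (P : probability T R) : stationary (transition_rate p M) P ->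
  P [set x | ~~ good H x] = 0%E.
Proof.
move=> /regime_stationary statP.
have [c c0 hc] : exists2 c, 0 < c & forall j : 'I_n, true -> c <= eta%:R * lam j - theta j * sigma.
  by apply: finite_positive_bound => j _; rewrite subr_gt0; exact: (regime_lam regime).
have rate_c x j : c <= customer_rate p x j.
  apply: le_trans (hc j isT) _; rewrite /= lerD2l lerN2 ler_piMr//.
    by rewrite mulr_ge0// ltW// (regime_theta regime).
  by case: (_ < _)%R.
pose bad x := ~~ good H x.
have drift x : xpredT x -> A (fun x => (overlap H x)%:R) x <= 0 - c * (bad x)%:R.
  have le0D (a b : R) : a <= 0 -> b <= 0 -> a + b <= 0 by lra.
  move=> _; have le_term e : event_intensity p M e x *
      ((overlap H (event_target e x))%:R - (overlap H x)%:R) <= 0 :> R.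
    have [->|e0] := eqVneq (event_intensity p M e x) 0; first by rewrite mul0r.
    rewrite mulr_ge0_le0 ?regime_intensity_ge0// subr_le0 ler_nat.
    exact: overlap_target.
  rewrite /bad; have [gx|bx] := boolP (good H x).
    by rewrite mulr0 subr0 /generator sumr_le0.
  rewrite mulr1 sub0r; move: bx; rewrite negb_forall => /existsP[i].
  rewrite negb_forall => /existsP[j]; rewrite negb_imply negb_or -!lt0n.
  move=> /and3P[Hij yj zi].
  rewrite /generator sum_event -[leRHS]addr0 lerD//; last first.
    rewrite sumr_le0// => k _. apply: le0D; last exact: (le_term (inr (inr k))).
    by rewrite sumr_le0// => l _; exact: (le_term (inr (inl (k, l)))).
  rewrite (bigD1 j)//= -[leRHS]addr0 lerD//; last first.
    rewrite sumr_le0// => k _; apply: le0D; last exact: (le_term (inl (inr k))).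
    by rewrite sumr_le0// => l _; exact: (le_term (inl (inl (l, k)))).
  rewrite -[leRHS]addr0 lerD//; last exact: (le_term (inl (inr j))).
  have [_ C] := HM x; have [w0 wc w1] := C j.
  (* Arrivals of type [j] suffice: each is matched with some waiting neighbour [i'], possibly not
     [i], and as [j] is waiting too, that departure lowers the overlap. *)
  apply: (@le_trans _ _ (\sum_(i < n) customer_rate p x j * customer_match M x i j * -1)).
    apply: ler_sum => i' _; have [->|w_i'] := eqVneq (customer_match M x i' j) 0.
      by rewrite mulr0 !mul0r.
    rewrite ler_wpM2l//; first by rewrite mulr_ge0 ?w0// ltW ?customer_rate_gt0.
    have [Hi' zi'] := wc _ w_i'.
    rewrite lerBlDr addrC -[_ - _]/(_ - 1%:R) lerBrDr -natrD ler_nat addn1.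
    exact: overlap_server_leaves_lt Hi' yj zi'.
  rewrite -big_distrl -big_distrr /= w1; last by exists i.
  by rewrite mulr1 mulrN1 lerN2 rate_c.
have bad_ge0 x : 0 <= c * (bad x)%:R by rewrite mulr_ge0// ltW.
have := expectation_drift regime_intensity_ge0 regime_intensity_bounded statP
  (good := xpredT) _ (fun x => ler0n R (overlap H x)) bad_ge0 (fun=> lexx 0) drift.
rewrite (_ : [set x | ~~ true] = set0); last by apply/seteqP; split.
move=> /(_ (measure0 _)).
have bi : bounded_observable (fun x : T => (bad x)%:R : R) by exact: bounded_observable_indicator.
have bci : bounded_observable (fun x : T => c * (bad x)%:R : R).
  by apply: bounded_observable_mul => //; exact: bounded_observable_cst.
rewrite !expectation_mean//; last exact: bounded_observable_cst.
rewrite mean_cst meanZ// lee_fin pmulr_rle0// => mb.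
have := mean_ge0 P bi (fun x => ler0n R _); rewrite -mean_indicator.
by move=> ?; congr EFin; apply/eqP; rewrite eq_le mb.
Qed.

Definition quadratic (x : T) : R :=
  \sum_j (customers x j)%:R ^+ 2 + \sum_i (servers x i)%:R ^+ 2.

(** Queue weight drained at full rates minus the weight fed in by arrivals. The flow [chi] would
    drain exactly what is fed in, so this is the gain of the matching over [chi]. *)
Definition customer_slack (x : T) : R :=
  \sum_i mu i * (\sum_j server_match M x i j * (customers x j)%:R)
  - \sum_j lam j * (customers x j)%:R.

Definition server_slack (x : T) : R :=
  \sum_j lam j * (\sum_i customer_match M x i j * (servers x i)%:R)
  - \sum_i mu i * (servers x i)%:R.

Lemma customer_slack_ge0 x : 0 <= customer_slack x.
Proof.
rewrite subr_ge0; apply: le_trans (ler_sum _ (fun i _ => regime_server regime x i)).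
rewrite exchange_big /=; apply: ler_sum => j _.
by rewrite (regime_lamE regime) mulr_suml.
Qed.

Lemma server_slack_ge0 x : 0 <= server_slack x.
Proof.
rewrite subr_ge0; apply: le_trans (ler_sum _ (fun j _ => regime_customer regime x j)).
rewrite exchange_big /=; apply: ler_sum => i _.
by rewrite (regime_muE regime) mulr_suml.
Qed.

Definition excess (k : nat) : R := k%:R * (tau < k%:R)%R%:R.

(** A square changes by [2 * k + 1] upwards and by [1 - 2 * k] downwards: the ones add up to the
    total rate, the rest is joining minus service. *)
Lemma quadratic_generator x :
  A quadratic x = \sum_j customer_rate p x j + \sum_i server_rate p x i
   + 2 * (\sum_j customer_rate p x j *
            ((1 - \sum_i customer_match M x i j) * (customers x j)%:R)
          - \sum_i server_rate p x i *
              \sum_j server_match M x i j * (customers x j)%:R)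
   + 2 * (\sum_i server_rate p x i *
            ((1 - \sum_j server_match M x i j) * (servers x i)%:R)
          - \sum_j customer_rate p x j *
              \sum_i customer_match M x i j * (servers x i)%:R).
Proof.
rewrite (generator_separable p M (fun _ k => k%:R ^+ 2) (fun _ k => k%:R ^+ 2)) /=.
have [S C] := HM x.
have E (c : pred 'I_n) (q : 'I_n -> nat) (w : 'I_n -> R) (a : nat) : service_rule c q w ->
    \sum_i w i * ((q i).-1%:R ^+ 2 - (q i)%:R ^+ 2)
      + (1 - \sum_i w i) * (a.+1%:R ^+ 2 - a%:R ^+ 2)
    = 1 - 2 * (\sum_i w i * (q i)%:R) + 2 * ((1 - \sum_i w i) * a%:R).
  move=> [_ wc _].
  have -> : \sum_i w i * ((q i).-1%:R ^+ 2 - (q i)%:R ^+ 2) =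
            \sum_i w i - 2 * (\sum_i w i * (q i)%:R).
    rewrite mulr_sumr -sumrB; apply: eq_bigr => i _.
    (* The truncated predecessor is harmless: a nonzero weight forces a nonempty queue. *)
    have [->|/wc[_ qi]] := eqVneq (w i) 0; first by rewrite !mul0r mulr0 subrr.
    by rewrite -(prednK qi) /= -natr1; ring.
  by rewrite -natr1; ring.
under eq_bigr => j _ do rewrite (E _ _ _ _ (C j)).
under [X in _ + X = _]eq_bigr => i _ do rewrite (E _ _ _ _ (S i)).
have D (r w s : 'I_n -> R) : \sum_j r j * (1 - 2 * w j + 2 * s j) =
    \sum_j r j - 2 * (\sum_j r j * w j) + 2 * (\sum_j r j * s j).
  rewrite !mulr_sumr -sumrB -big_split; apply: eq_bigr => j _ /=; ring.
rewrite !D; ring.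
Qed.

(** [half_drift] for each side; goodness supplies its condition that a serving type has an empty
    queue. *)
Lemma quadratic_drift x : good H x ->
  A quadratic x <= eta%:R * (\sum_j lam j + \sum_i mu i)
    - 2 * sigma * (\sum_j theta j * excess (customers x j) + \sum_i phi i * excess (servers x i))
    - 2 * eta%:R * (customer_slack x + server_slack x).
Proof.
move=> gx; rewrite quadratic_generator.
have [S C] := HM x.
have sum_ge0 (c : pred 'I_n) q (w : 'I_n -> R) : service_rule c q w -> 0 <= \sum_k w k.
  by move=> [w0 _ _]; rewrite sumr_ge0.
have hy := @half_drift R n (customers x) (servers x)
  (fun j => eta%:R * lam j) (fun i => eta%:R * mu i)
  (fun j => theta j * sigma) (fun i => phi i * sigma)
  (fun j => \sum_i customer_match M x i j) tau (fun i j => server_match M x i j) tau0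
  (fun j => sum_ge0 _ _ _ (C j)) (fun j => ltW (customer_rate_gt0 x j)).
have hz := @half_drift R n (servers x) (customers x)
  (fun i => eta%:R * mu i) (fun j => eta%:R * lam j)
  (fun i => phi i * sigma) (fun j => theta j * sigma)
  (fun i => \sum_j server_match M x i j) tau (fun j i => customer_match M x i j) tau0
  (fun i => sum_ge0 _ _ _ (S i)) (fun i => ltW (server_rate_gt0 x i)).
have {}hy : _ := hy _; have {}hz : _ := hz _.
have wy i j : server_match M x i j != 0 -> servers x i = 0%N.
  by have [_ wc _] := S i => /wc[Hij yj]; exact: (goodP _ _ gx i j).
have wz j i : customer_match M x i j != 0 -> customers x j = 0%N.
  by have [_ wc _] := C j => /wc[Hij zi]; exact: (good_customers gx Hij).
move: hy hz => /(_ wy) hy /(_ wz) hz.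
have pull (a : 'I_n -> R) (f : 'I_n -> R) (c : R) :
    \sum_j c * a j * f j = c * \sum_j a j * f j.
  by rewrite mulr_sumr; apply: eq_bigr => j _; rewrite mulrA.
have pull2 (a : 'I_n -> R) (q : {ffun 'I_n -> nat}) :
    \sum_j a j * sigma * ((q j)%:R * (tau < (q j)%:R)%R%:R) = sigma * \sum_j a j * excess (q j).
  by rewrite mulr_sumr; apply: eq_bigr => j _; rewrite /excess; ring.
move: hy hz; rewrite !pull !pull2.
have := ler_sum (P := xpredT) (index_enum 'I_n) (fun j _ => customer_rate_le x j).
have := ler_sum (P := xpredT) (index_enum 'I_n) (fun j _ => server_rate_le x j).
rewrite -!mulr_sumr /customer_slack /server_slack /=.
move: (\sum_i mu i) (\sum_j lam j) => sm sl h1 h2 h3 h4.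
nra.
Qed.

End TwoPrice.

(** The loss beyond first order when a rate is lowered from [x] by [d]. If [a] is the derivative of
    [r] at [x], it is about [- r'' (x) / 2 * d ^ 2], positive for a strictly concave revenue. *)
Definition secant_gap (R : realType) (r : R -> R) (a x d : R) : R :=
  r x - r (x - d) - a * d.

(** * Mean queue lengths and an exact formula for the profit loss *)

Section QueueMeans.
Variables (R : realType) (n : nat) (P : probability (state n) R).
Local Notation T := (state n).

Lemma expectation_le_mean (f : T -> R) (B : R) : (forall x, 0 <= f x) ->
  ('E_P[f] <= B%:E)%E -> 'E_P[f]%E = (mean P f)%:E /\ mean P f <= B.
Proof.
move=> f0 fB; have Ef : 'E_P[f]%E = (mean P f)%:E.
  rewrite /mean /Rintegral; move: fB; rewrite unlock => fB; rewrite fineK//.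
  rewrite ge0_fin_numE; first by rewrite (le_lt_trans fB)// ltry.
  by apply: integral_ge0 => x _; rewrite lee_fin.
by split => //; rewrite -lee_fin -Ef.
Qed.

Lemma expectation_mono (f g : T -> R) : (forall x, 0 <= f x) -> (forall x, 0 <= g x) ->
  (forall x, f x <= g x) -> ('E_P[f] <= 'E_P[g])%E.
Proof. by move=> f0 g0 fg; apply: expectation_le => //; apply: aeW. Qed.

Lemma expectation_ge0_sum (I : finType) (f : I -> T -> R) :
  (forall i x, 0 <= f i x) ->
  'E_P[(fun x => \sum_i f i x)%R]%E = (\sum_i 'E_P[f i])%E.
Proof.
move=> f0; rewrite unlock; under eq_integral do rewrite -sumEFin.
by rewrite ge0_integral_sum// => i x _; rewrite lee_fin.
Qed.

Lemma expectation_ge0D (f g : T -> R) :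
  (forall x, 0 <= f x) -> (forall x, 0 <= g x) ->
  'E_P[(fun x => f x + g x)%R]%E = ('E_P[f] + 'E_P[g])%E.
Proof.
move=> f0 g0; rewrite unlock; under eq_integral do rewrite EFinD.
by rewrite ge0_integralD// => x _; rewrite lee_fin.
Qed.

Lemma expectation_ge0Z (c : R) (f : T -> R) : 0 <= c -> (forall x, 0 <= f x) ->
  'E_P[(fun x => c * f x)%R]%E = (c%:E * 'E_P[f])%E.
Proof.
move=> c0 f0; rewrite unlock; under eq_integral do rewrite EFinM.
by rewrite ge0_integralZl_EFin// => x _; rewrite lee_fin.
Qed.

Lemma total_mean (B : R) : ('E_P[(fun x => (total x)%:R)%R] <= B%:E)%E ->
  [/\ forall j, 'E_P[(fun x => (customers x j)%:R)%R]%E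
                = (mean P (fun x => (customers x j)%:R))%:E,
      forall i, 'E_P[(fun x => (servers x i)%:R)%R]%E
                = (mean P (fun x => (servers x i)%:R))%:E
    & \sum_j mean P (fun x => (customers x j)%:R)
      + \sum_i mean P (fun x => (servers x i)%:R) <= B].
Proof.
move=> tB.
have tE : (fun x : T => (total x)%:R : R) =
    (fun x => \sum_j (customers x j)%:R + \sum_i (servers x i)%:R).
  by apply/funext => x; rewrite /total natrD !natr_sum.
have cy j : 'E_P[(fun x => (customers x j)%:R)%R]%E = (mean P (fun x => (customers x j)%:R))%:E.
  apply: (expectation_le_mean (B := B) _ _).1 => //; apply: le_trans tB.
  apply: expectation_mono => // x; rewrite ler_nat /total (bigD1 j)//= -addnA.
  exact: leq_addr.
have cz i : 'E_P[(fun x => (servers x i)%:R)%R]%E = (mean P (fun x => (servers x i)%:R))%:E.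
  apply: (expectation_le_mean (B := B) _ _).1 => //; apply: le_trans tB.
  apply: expectation_mono => // x; rewrite ler_nat /total addnC (bigD1 i)//= -addnA.
  exact: leq_addr.
split => //; rewrite -lee_fin EFinD -!sumEFin; apply: le_trans tB.
rewrite tE expectation_ge0D; try by move=> x; rewrite sumr_ge0.
rewrite !expectation_ge0_sum//.
by rewrite (eq_bigr _ (fun j _ => cy j)) (eq_bigr _ (fun i _ => cz i)).
Qed.

End QueueMeans.

Section Loss.
Variables (R : realType) (n : nat) (H : rel 'I_n).
Variables (chi : 'I_n -> 'I_n -> R) (M : matching R n) (eta : nat).
Variables (lam mu theta phi : 'I_n -> R) (sigma tau : R).
Hypothesis regime : two_price_regime H chi M eta lam mu theta phi sigma tau.
Local Notation T := (state n).
Let p := two_price_policy eta lam mu theta phi sigma tau.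
Local Notation A := (generator (event_intensity p M) (@event_target n)).
Let sigma0 : 0 < sigma := regime_sigma regime.
Let tau0 : 0 <= tau := regime_tau regime.

(** Both slacks are dropped, and a queue exceeds its [excess] by at most [tau]. *)
Lemma total_drift (c : R) x : 0 < c -> (forall j, c <= theta j) ->
  (forall i, c <= phi i) -> good H x ->
  A (@quadratic R n) x <= eta%:R * (\sum_j lam j + \sum_i mu i)
     + 2 * sigma * tau * (\sum_j theta j + \sum_i phi i)
    - 2 * sigma * c * (total x)%:R.
Proof.
move=> c0 ct cp gx.
have Ds := customer_slack_ge0 regime x; have Dc := server_slack_ge0 regime x.
have E (a : 'I_n -> R) (q : {ffun 'I_n -> nat}) : (forall k, c <= a k) ->
    c * (\sum_k (q k)%:R) - tau * \sum_k a k <= \sum_k a k * excess tau (q k).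
  move=> ca; rewrite !mulr_sumr -sumrB; apply: ler_sum => k _; rewrite /excess.
  have a0 : 0 <= a k by rewrite (le_trans (ltW c0)) ?ca.
  have h : c * (q k)%:R <= a k * (q k)%:R by rewrite ler_wpM2r.
  have [tq|qt] := ltrP tau (q k)%:R.
    have h0 : 0 <= tau * a k by rewrite mulr_ge0.
    by rewrite mulr1; lra.
  rewrite !mulr0 subr_le0 (le_trans h)// mulrC ler_wpM2r//.
have hy := E theta (customers x) ct; have hz := E phi (servers x) cp.
apply: le_trans (quadratic_drift regime gx) _.
rewrite /total natrD !natr_sum.
have hs : sigma * (c * (\sum_j (customers x j)%:R + \sum_i (servers x i)%:R)
     - tau * (\sum_j theta j + \sum_i phi i)) <=
     sigma * (\sum_j theta j * excess tau (customers x j) + \sum_i phi i * excess tau (servers x i)).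
  rewrite ler_wpM2l ?(ltW sigma0)//; lra.
have he : 0 <= eta%:R * (customer_slack M lam mu x + server_slack M lam mu x).
  by rewrite mulr_ge0// addr_ge0.
move: hs he; lra.
Qed.

Lemma quadratic_ge0 (x : T) : 0 <= quadratic R x.
Proof. by rewrite addr_ge0// sumr_ge0// => k _; rewrite sqr_ge0. Qed.

Lemma regime_lower_price : exists c, [/\ 0 < c, forall j, c <= theta j & forall i, c <= phi i].
Proof.
have [c c0 hc] : exists2 c, 0 < c & forall k : 'I_n, true -> c <= Num.min (theta k) (phi k).
  apply: finite_positive_bound => k _.
  by rewrite lt_min (regime_theta regime) (regime_phi regime).
by exists c; split=> // k; have := hc k isT; rewrite le_min => /andP[].
Qed.

Lemma regime_stationary_exists :
  exists P : probability T R, stationary (transition_rate p M) P.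
Proof.
have [c [c0 ct cp]] := regime_lower_price.
have [P statP] := @stationary_exists R n _ (event_intensity p M) (@event_target n)
  (good H) (State [ffun=> 0%N] [ffun=> 0%N]) (@quadratic R n)
  (eta%:R * (\sum_j lam j + \sum_i mu i) + 2 * sigma * tau * (\sum_j theta j + \sum_i phi i))
  (2 * sigma * c)
  (regime_intensity_ge0 regime) (regime_intensity_bounded regime)
  ltac:(by apply/goodP => i j _; rewrite ffunE)
  (good_step regime) (@total_step n) quadratic_ge0
  ltac:(by rewrite mulr_gt0// mulr_gt0) (fun x => @total_drift c x c0 ct cp).
by exists P; apply/(regime_stationary M eta lam mu theta phi sigma tau).
Qed.

Variable P : probability T R.
Hypothesis statP : stationary (transition_rate p M) P.
Let statP' := (regime_stationary M eta lam mu theta phi sigma tau P).1 statP.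

Lemma regime_drift (V g h : T -> R) :
  (forall x, 0 <= V x) -> (forall x, 0 <= g x) -> (forall x, 0 <= h x) ->
  (forall x, good H x -> A V x <= h x - g x) ->
  ('E_P[g] <= 'E_P[h])%E.
Proof.
apply: (expectation_drift (regime_intensity_ge0 regime)
  (regime_intensity_bounded regime) statP').
exact: bad_null regime P statP.
Qed.

Lemma total_expectation (c : R) : 0 < c -> (forall j, c <= theta j) ->
  (forall i, c <= phi i) ->
  ('E_P[(fun x => (total x)%:R)%R] <=
   ((eta%:R * (\sum_j lam j + \sum_i mu i)
     + 2 * sigma * tau * (\sum_j theta j + \sum_i phi i)) / (2 * sigma * c))%:E)%E.
Proof.
move=> c0 ct cp.
set b := (X in X / _); have sc : 0 < 2 * sigma * c by rewrite mulr_gt0// mulr_gt0.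
have b0 : 0 <= b.
  rewrite addr_ge0//.
    rewrite mulrDr !mulr_sumr addr_ge0// sumr_ge0// => k _.
      by apply: le_trans (ltW (regime_lam regime k)); rewrite mulr_ge0// ltW// (regime_theta regime).
    by apply: le_trans (ltW (regime_mu regime k)); rewrite mulr_ge0// ltW// (regime_phi regime).
  rewrite !mulr_ge0// ?(ltW sigma0)// addr_ge0// sumr_ge0// => k _; apply: ltW.
    exact: (regime_theta regime).
  exact: (regime_phi regime).
have g0 (x : T) : 0 <= 2 * sigma * c * (total x)%:R by rewrite mulr_ge0// ltW.
have := regime_drift quadratic_ge0 g0 (fun _ : T => b0) (fun x => @total_drift c x c0 ct cp).
rewrite expectation_ge0Z//; last exact: ltW.
rewrite (expectation_mean P (bounded_observable_cst T b)) mean_cst => h.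
by rewrite [(b / _)%R]mulrC EFinM lee_pdivlMl.
Qed.

Variables (m : market R n).
Hypothesis eta_gt0 : (0 < eta)%N.
Variables a c : 'I_n -> R.
Hypothesis tight : forall i j, H i j -> a j = c i.
Hypothesis balanced : \sum_j a j * lam j = \sum_i c i * mu i.

(** An arriving customer of type [j] raises this potential by [a j] whether it joins or takes a
    server: a waiting server of type [i] counts [- c i], which is [- a j] along an edge of [H]. *)
Lemma generator_price x :
  A (fun q => \sum_j a j * (customers q j)%:R + \sum_i - c i * (servers q i)%:R) x
  = \sum_j a j * customer_rate p x j - \sum_i c i * server_rate p x i.
Proof.
rewrite (generator_separable p M (fun j k => a j * k%:R) (fun i k => - c i * k%:R)).
have [S C] := regime_greedy regime x.
rewrite -sumrN; congr (_ + _); apply: eq_bigr => k _.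
  rewrite [RHS]mulrC; congr (_ * _).
  rewrite -natr1 (eq_bigr (fun i => customer_match M x i k * a k)).
    by rewrite -mulr_suml; ring.
  move=> i _; have [->|wi] := eqVneq (customer_match M x i k) 0; first by rewrite !mul0r.
  have [_ wc _] := C k; have [Hik zi] := wc _ wi.
  by rewrite (tight Hik) -[in X in _ - X](prednK zi) -natr1; ring.
rewrite (_ : - (c k * server_rate p x k) = server_rate p x k * - c k); last by rewrite mulrN mulrC.
congr (_ * _).
rewrite -natr1 (eq_bigr (fun j => server_match M x k j * - c k)).
  by rewrite -mulr_suml; ring.
move=> j _; have [->|wj] := eqVneq (server_match M x k j) 0; first by rewrite !mul0r.
have [_ wc _] := S k; have [Hkj yj] := wc _ wj.
by rewrite -(tight Hkj) -[in X in _ - X](prednK yj) -natr1; ring.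
Qed.

(** The potential may be unbounded but its jumps are not, as [mean_generator_lipschitz] asks. *)
Lemma mean_price :
  mean P (fun x => \sum_j a j * customer_rate p x j - \sum_i c i * server_rate p x i) = 0.
Proof.
pose W (q : T) := \sum_j a j * (customers q j)%:R + \sum_i - c i * (servers q i)%:R.
rewrite -[RHS](@mean_generator_lipschitz R n _ _ (@event_target n)
  (regime_intensity_ge0 regime) (regime_intensity_bounded regime) P statP' W
  (\sum_j `|a j| + \sum_i `|c i|)).
  by congr mean; apply/funext => x; rewrite generator_price.
have sa j : `|a j| <= \sum_j `|a j| + \sum_i `|c i|.
  by rewrite (bigD1 j)//= -addrA lerDl addr_ge0// sumr_ge0.
have sc i : `|c i| <= \sum_j `|a j| + \sum_i `|c i|.
  by rewrite [X in _ + X](bigD1 i)//= addrCA lerDl addr_ge0// sumr_ge0.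
have dn (b : R) (k : nat) : `|b * k.-1%:R - b * k%:R| <= `|b|.
  case: k => [|k]; first by rewrite subrr normr0.
  by rewrite /= -natr1 -mulrBr normrM opprD addrA subrr sub0r normrN normr1 mulr1.
have up (b : R) (k : nat) : `|b * k.+1%:R - b * k%:R| <= `|b|.
  by rewrite -natr1 -mulrBr normrM [k%:R + 1]addrC addrK normr1 mulr1.
move=> e x; rewrite /W; case: e => -[[i j]|k] /=; rewrite opprD addrACA subrr ?addr0 ?add0r.
- rewrite (sum_decrease (fun i k => - c i * k%:R)) (le_trans (dn _ _))// normrN; exact: sc.
- by rewrite (sum_increase (fun j k => a j * k%:R)) (le_trans (up _ _)).
- by rewrite (sum_decrease (fun j k => a j * k%:R)) (le_trans (dn _ _)).
- rewrite (sum_increase (fun i k => - c i * k%:R)) (le_trans (up _ _))// normrN; exact: sc.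
Qed.

Let gap_c j := secant_gap (fun z => z * demand m j z) (a j) (lam j) (theta j * sigma / eta%:R).
Let gap_s i := - secant_gap (fun z => z * supply m i z) (c i) (mu i) (phi i * sigma / eta%:R).

(** In each state the profit rate is the scaled fluid profit, minus one gap for each type whose rate
    is lowered, plus the first-order term [w]. The balance of [a] and [c] cancels the constants of
    order [eta], and [w] has mean 0; nothing is asymptotic here. *)
Lemma profit_loss_formula : fluid_value m = fluid_profit m lam mu ->
  profit_loss m eta p P =
  (\sum_j eta%:R * gap_c j * mean P (fun x => (tau < (customers x j)%:R)%R%:R)
   + \sum_i eta%:R * gap_s i * mean P (fun x => (tau < (servers x i)%:R)%R%:R)
   + (\sum_j customer_cost m j * mean P (fun x => (customers x j)%:R)
      + \sum_i server_cost m i * mean P (fun x => (servers x i)%:R)))%:E.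
Proof.
move=> fv.
have [k [k0 kt kp]] := regime_lower_price.
have [Ey Ez _] := total_mean (total_expectation k0 kt kp).
have by_ j : bounded_observable (fun x : T => (tau < (customers x j)%:R)%R%:R : R).
  exact: (@bounded_observable_indicator R T (fun x => (tau < (customers x j)%:R)%R)).
have bz i : bounded_observable (fun x : T => (tau < (servers x i)%:R)%R%:R : R).
  exact: (@bounded_observable_indicator R T (fun x => (tau < (servers x i)%:R)%R)).
have bcst (b : R) : bounded_observable (fun _ : T => b) by exact: bounded_observable_cst.
pose gy x := \sum_j eta%:R * gap_c j * (tau < (customers x j)%:R)%R%:R.
pose gz x := \sum_i eta%:R * gap_s i * (tau < (servers x i)%:R)%R%:R.
pose w x := \sum_j a j * customer_rate p x j - \sum_i c i * server_rate p x i.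
have bgy : bounded_observable gy.
  by apply: bounded_observable_sum => j; exact: bounded_observable_mul.
have bgz : bounded_observable gz.
  by apply: bounded_observable_sum => j; exact: bounded_observable_mul.
have bw : bounded_observable w.
  apply: bounded_observable_sub; apply: bounded_observable_sum => j;
    apply: bounded_observable_mul => //=; apply: bounded_observable_sub => //;
    exact: bounded_observable_mul.
have e0 : eta%:R != 0 :> R by rewrite pnatr_eq0 -lt0n.
have revE : (fun q : T =>
          (\sum_(j < n) customer_rate p q j *
             scaled_curve eta (demand m j) (customer_rate p q j)
           - \sum_(i < n) server_rate p q i *
             scaled_curve eta (supply m i) (server_rate p q i))%R) =
   (fun q => eta%:R * fluid_profit m lam mu - (gy q + gz q) + w q).
  apply/funext => q.
  have Ec j : customer_rate p q j * scaled_curve eta (demand m j) (customer_rate p q j) =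
      eta%:R * (lam j * demand m j (lam j))
      - eta%:R * gap_c j * (tau < (customers q j)%:R)%R%:R
      - a j * (eta%:R * lam j) + a j * customer_rate p q j.
    rewrite /scaled_curve /gap_c /secant_gap /=; case: (_ < _)%R; last first.
      by rewrite !mulr0 !subr0 [_ * lam j / _]mulrC mulKf//; ring.
    have -> : true%:R = 1 :> R by [].
    have -> : (eta%:R * lam j - theta j * sigma * 1) / eta%:R = lam j - theta j * sigma / eta%:R.
      by field.
    move: (demand m j (lam j)) => d1; move: (demand m j _) => d2; field.
    exact: e0.
  have Es i : server_rate p q i * scaled_curve eta (supply m i) (server_rate p q i) =
      eta%:R * (mu i * supply m i (mu i))
      + eta%:R * gap_s i * (tau < (servers q i)%:R)%R%:R
      - c i * (eta%:R * mu i) + c i * server_rate p q i.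
    rewrite /scaled_curve /gap_s /secant_gap /=; case: (_ < _)%R; last first.
      by rewrite !mulr0 !subr0 [_ * mu i / _]mulrC mulKf//; ring.
    have -> : true%:R = 1 :> R by [].
    have -> : (eta%:R * mu i - phi i * sigma * 1) / eta%:R = mu i - phi i * sigma / eta%:R.
      by field.
    move: (supply m i (mu i)) => d1; move: (supply m i _) => d2; field.
    exact: e0.
  rewrite (eq_bigr _ (fun j _ => Ec j)) (eq_bigr _ (fun i _ => Es i)).
  rewrite !(big_split, sumrB) /= !sumrN -!mulr_sumr /fluid_profit.
  have pull (b l : 'I_n -> R) : \sum_k b k * (eta%:R * l k) = eta%:R * \sum_k b k * l k.
    by rewrite mulr_sumr; apply: eq_bigr => k' _; rewrite mulrCA.
  rewrite !pull balanced /gy /gz /w; ring.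
rewrite /profit_loss revE fv.
have bg : bounded_observable (fun q => gy q + gz q) by exact: bounded_observable_add.
have brev : bounded_observable (fun q => eta%:R * fluid_profit m lam mu - (gy q + gz q) + w q).
  by apply: bounded_observable_add => //; exact: bounded_observable_sub.
rewrite (expectation_mean P brev) (eq_bigr _ (fun j _ => congr1 _ (Ey j))).
rewrite (eq_bigr _ (fun i _ => congr1 _ (Ez i))) !sumEFin -!EFinB; congr EFin.
rewrite meanD//; last exact: bounded_observable_sub.
rewrite meanB// mean_cst meanD// mean_price addr0.
rewrite mean_sum; last by move=> j; exact: bounded_observable_mul.
rewrite mean_sum; last by move=> j; exact: bounded_observable_mul.
rewrite (eq_bigr _ (fun j _ => meanZ P _ (by_ j))) (eq_bigr _ (fun j _ => meanZ P _ (bz j))).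
ring.
Qed.

End Loss.

(** * First-order conditions of the fluid problem *)

Section Expansion.
Variable R : realType.
Implicit Types f r : R -> R.

Lemma first_order f (x e : R) : derivable f x 1 -> 0 < e ->
  \forall h \near (0 : R), `|f (x + h) - f x - derive1 f x * h| <= e * `|h|.
Proof.
move=> df e0; have := df; rewrite /derivable => /cvg_ex[l fl].
have -> : derive1 f x = l by rewrite derive1E /derive; apply/cvg_lim.
move/cvgrPdist_le : fl => /(_ e e0) /=.
rewrite near_withinE => H; near=> h.
have [->|h0] := eqVneq h 0; first by rewrite addr0 subrr mulr0 subr0 !normr0 mulr0.
have H1 : h != 0 -> `|l - h^-1 *: (f (h *: (1 : R) + x) - f x)| <= e by near: h; exact: H.
move: (H1 h0); rewrite {H1} /GRing.scale /= mulr1 [h + x]addrC distrC => H1.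
rewrite -(ler_pM2r (x := `|h|)) ?normr_gt0// in H1.
apply: le_trans H1; rewrite -normrM; rewrite le_eqVlt; apply/orP; left; apply/eqP; congr `|_|.
by rewrite mulrBl mulrAC mulVf// mul1r.
Unshelve. all: by end_near. Qed.

(** Taylor's formula in Peano form, from the left. The mean value theorem is applied to the
    remainder [psi], whose derivative is the first-order remainder of [derive1 r], so the second
    derivative is needed at [x] alone. *)
Lemma second_order r (x e : R) : (\forall y \near x, derivable r y 1) ->
  derivable (derive1 r) x 1 -> 0 < e ->
  \forall d \near 0^'+,
    `|secant_gap r (derive1 r x) x d + derive1 (derive1 r) x / 2 * d ^+ 2| <= e * d ^+ 2.
Proof.
move=> dr ddr e0; set a := derive1 r x; set D := derive1 (derive1 r) x.
have [d1 /= d10 Hd1] := dr.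
have [d2 /= d20 Hd2] := first_order ddr e0.
near=> d.
have d0 : 0 < d by near: d; exact: nbhs_right_gt.
have dd1 : d < d1 by near: d; exact: nbhs_right_lt.
have dd2 : d < d2 by near: d; exact: nbhs_right_lt.
pose psi y := r y - a * (y - x) - D / 2 * (y - x) ^+ 2.
have dpsi y : x - d <= y <= x -> is_derive y 1 psi (derive1 r y - a - D * (y - x)).
  move=> /andP[y1 y2].
  have dry : is_derive y 1 r (derive1 r y).
    have H : derivable r y 1.
      apply: Hd1; rewrite /ball /= ger0_norm ?subr_ge0//; lra.
    by rewrite derive1E; exact/derivableP.
  rewrite /psi; apply: is_derive_eq.
  by rewrite /GRing.scale /= !subr0 !mulr1; field.
have [c /[!in_itv]/=/andP[c1 c2] E] := @MVT _ psi (fun y => derive1 r y - a - D * (y - x))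
    (x - d) x ltac:(by rewrite ltrBlDr ltrDl)
    (fun y (hy : y \in `]x - d, x[%R) =>
      dpsi y ltac:(by move: hy; rewrite in_itv/= => /andP[? ?]; rewrite !ltW))
    ltac:(by apply: derivable_within_continuous => y; rewrite in_itv/= => /dpsi[]).
have -> : secant_gap r a x d + D / 2 * d ^+ 2 = psi x - psi (x - d).
  by rewrite /psi /secant_gap; field.
rewrite E opprB addrCA subrr addr0 normrM (ger0_norm (ltW d0)) expr2 mulrA.
rewrite ler_pM2r//.
have := Hd2 (c - x); rewrite /ball_ /= sub0r normrN addrCA subrr addr0 => Hc.
have cx : `|c - x| <= d by rewrite distrC ger0_norm; lra.
apply: le_trans (Hc _) _; first by apply: le_lt_trans dd2.
by rewrite ler_wpM2l// ltW.
Unshelve. all: by end_near. Qed.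

Lemma product_derivative f (x : R) : derivable f x 1 ->
  is_derive x 1 (fun z : R => z * f z) (f x + x * derive1 f x).
Proof.
move=> df; have dfx : is_derive x 1 f (derive1 f x).
  by rewrite derive1E; exact/derivableP.
apply: is_derive_eq; rewrite /GRing.scale /= mulr1; ring.
Qed.

Lemma product_second_derivative f (x : R) :
  (\forall y \near x, derivable f y 1) -> derivable (derive1 f) x 1 ->
  is_derive x 1 (derive1 (fun z : R => z * f z)) (2 * derive1 f x + x * derive1 (derive1 f) x).
Proof.
move=> df ddf.
have dfx : is_derive x 1 f (derive1 f x).
  by rewrite derive1E; apply/derivableP; exact: nbhs_singleton df.
have d2fx : is_derive x 1 (derive1 f) (derive1 (derive1 f) x).
  by rewrite [derive1 (derive1 f) x]derive1E; exact/derivableP.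
have E : \forall y \near x, f y + y * derive1 f y = derive1 (fun z : R => z * f z) y.
  near=> y; have dfy : derivable f y 1 by near: y.
  by rewrite [RHS]derive1E (@derive_val _ _ _ _ _ _ _ (product_derivative dfy)).
have H : is_derive x 1 (fun y => f y + y * derive1 f y) (2 * derive1 f x + x * derive1 (derive1 f) x).
  by apply: is_derive_eq; rewrite /GRing.scale /= mulr1; ring.
apply: near_eq_is_derive E H.
Unshelve. all: by end_near. Qed.

End Expansion.

Section FluidOptimality.
Variables (R : realType) (n : nat) (m : market R n).
Variables (lam mu : 'I_n -> R) (chi : 'I_n -> 'I_n -> R).
Hypothesis mkt : market_assumptions m.
Hypothesis opt : positive_fluid_solution m lam mu chi.

Definition marginal_revenue j := derive1 (fun z : R => z * demand m j z) (lam j).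
Definition marginal_cost i := derive1 (fun z : R => z * supply m i z) (mu i).

Lemma fluid_value_optimal : fluid_value m = fluid_profit m lam mu.
Proof.
have [[feas best] _ _] := opt.
apply/eqP; rewrite eq_le; apply/andP; split.
  apply: ge_sup; first by exists (fluid_profit m lam mu), lam, mu, chi.
  by move=> _ [l [u [c [fc ->]]]]; exact: best fc.
apply: sup_upper_bound; last by exists lam, mu, chi.
split; first by exists (fluid_profit m lam mu), lam, mu, chi.
exists (fluid_profit m lam mu) => _ [l [u [c [fc ->]]]]; exact: best fc.
Qed.

Lemma feasible_rate_near (b : \bar R) (x : R) : 0 < x -> feasible_rate b x ->
  \forall y \near x, feasible_rate b y.
Proof.
move=> x0 [_ xb]; case: b xb => [b|_|//].
  rewrite lte_fin => xb; near=> y; split.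
    by apply: ltW; near: y; exact: lt_nbhsr.
  by rewrite lte_fin; near: y; exact: lt_nbhsl.
near=> y; split; last exact: ltry.
by apply: ltW; near: y; exact: lt_nbhsr.
Unshelve. all: by end_near. Qed.

Lemma demand_derivable j : \forall y \near lam j, derivable (demand m j) y 1.
Proof.
have [_ lam0 _] := opt; have [[[_ _ _ fl _] _] _ _] := opt.
have [dem _ _ _] := mkt; have [_ _ C2 _] := dem j.
by apply: filterS (feasible_rate_near (lam0 j) (fl j)) => y /C2[].
Qed.

Lemma supply_derivable i : \forall y \near mu i, derivable (supply m i) y 1.
Proof.
have [_ _ mu0] := opt; have [[[_ _ _ _ fm] _] _ _] := opt.
have [_ sup _ _] := mkt; have [_ _ C2 _] := sup i.
by apply: filterS (feasible_rate_near (mu0 i) (fm i)) => y /C2[].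
Qed.

Lemma demand_derivable2 j : derivable (derive1 (demand m j)) (lam j) 1.
Proof.
have [[[_ _ _ fl _] _] _ _] := opt.
by have [dem _ _ _] := mkt; have [_ _ C2 _] := dem j; have [] := C2 _ (fl j).
Qed.

Lemma supply_derivable2 i : derivable (derive1 (supply m i)) (mu i) 1.
Proof.
have [[[_ _ _ _ fm] _] _ _] := opt.
by have [_ sup _ _] := mkt; have [_ _ C2 _] := sup i; have [] := C2 _ (fm i).
Qed.

(* Moving an amount h of flow along a compatible edge, in either direction as
   long as the edge flow stays nonnegative, cannot raise the fluid profit. *)
Lemma perturbed_profit i j h : compatible m i j -> 0 <= chi i j + h ->
  feasible_rate (demand_bound m j) (lam j + h) ->
  feasible_rate (supply_bound m i) (mu i + h) ->
  (lam j + h) * demand m j (lam j + h) - lam j * demand m j (lam j) <=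
  (mu i + h) * supply m i (mu i + h) - mu i * supply m i (mu i).
Proof.
move=> Hij chi_h fl fm.
have [[[[lamE muE] chi0 chiN fL fM] best] _ _] := opt.
pose lam' j' := lam j' + h * (j' == j)%:R.
pose mu' i' := mu i' + h * (i' == i)%:R.
pose chi' i' j' := chi i' j' + h * (i' == i)%:R * (j' == j)%:R.
have one (k : 'I_n) : \sum_k' (k' == k)%:R = 1 :> R.
  by rewrite (bigD1 k)//= eqxx big1 ?addr0// => k' /negPf ->.
have := best lam' mu' chi'.
have -> : fluid_profit m lam' mu' = fluid_profit m lam mu
   + ((lam j + h) * demand m j (lam j + h) - lam j * demand m j (lam j))
   - ((mu i + h) * supply m i (mu i + h) - mu i * supply m i (mu i)).
  rewrite /fluid_profit (bigD1 j)//= [X in _ - X](bigD1 i)//=.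
  rewrite [in RHS](bigD1 j)//= [X in _ - X + _ - _](bigD1 i)//=.
  rewrite /lam' /mu' !eqxx !mulr1.
  rewrite (eq_bigr (fun j => lam j * demand m j (lam j))); last first.
    by move=> j' /negPf ->; rewrite mulr0 addr0.
  rewrite [X in _ - (_ + X) = _](eq_bigr (fun i => mu i * supply m i (mu i))); last first.
    by move=> i' /negPf ->; rewrite mulr0 addr0.
  ring.
move=> /(_ _); suff feas : fluid_feasible m lam' mu' chi' by move=> /(_ feas); lra.
split.
- split=> k; rewrite /chi' big_split /=.
    by rewrite -lamE /lam' -mulr_suml -mulr_sumr one mulr1.
  by rewrite -muE /mu' -mulr_sumr one mulr1.
- move=> i' j'; rewrite /chi'; have [->|_] := eqVneq i' i; last first.
    by rewrite mulr0 mul0r addr0; exact: chi0.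
  have [->|_] := eqVneq j' j; last by rewrite mulr0 addr0; exact: chi0.
  by rewrite !mulr1.
- move=> i' j'; rewrite /chi'; have [->|_] := eqVneq i' i; last first.
    by rewrite mulr0 mul0r addr0; exact: chiN.
  have [->|_] := eqVneq j' j; last by rewrite mulr0 addr0; exact: chiN.
  by rewrite Hij.
- move=> j'; rewrite /lam'; have [->|_] := eqVneq j' j; first by rewrite mulr1.
  by rewrite mulr0 addr0.
- move=> i'; rewrite /mu'; have [->|_] := eqVneq i' i; first by rewrite mulr1.
  by rewrite mulr0 addr0.
Qed.

(** First-order expansion of both sides of [perturbed_profit], whose two errors add up to the factor
    [2 * e]; the sign of [h] stays open because only edges that carry flow admit both. *)
Lemma marginal_near i j (e : R) : 0 < e -> compatible m i j ->
  \forall h \near (0 : R), 0 <= chi i j + h ->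
    (marginal_revenue j - marginal_cost i) * h <= 2 * e * `|h|.
Proof.
move=> e0 Hij; have [[[_ _ _ fl fm] _] lam0 mu0] := opt.
have dr : derivable (fun z : R => z * demand m j z) (lam j) 1.
  by apply: ex_derive; apply: product_derivative; exact: nbhs_singleton (demand_derivable j).
have dc : derivable (fun z : R => z * supply m i z) (mu i) 1.
  by apply: ex_derive; apply: product_derivative; exact: nbhs_singleton (supply_derivable i).
have hr := first_order dr e0; have hc := first_order dc e0.
have shift (x : R) (Q : set R) : (\forall y \near x, Q y) -> \forall h \near (0 : R), Q (x + h).
  by move=> [d /= d0 hd]; exists d => //= h; rewrite /ball_ /= sub0r normrN => hh;
     apply: hd; rewrite /ball_ /= opprD addrA subrr sub0r normrN.
have fl' := shift _ _ (feasible_rate_near (lam0 j) (fl j)).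
have fm' := shift _ _ (feasible_rate_near (mu0 i) (fm i)).
near=> h => chih.
have := @perturbed_profit i j h Hij chih.
have /[swap]/[apply] : feasible_rate (demand_bound m j) (lam j + h) by near: h.
have /[swap]/[apply] : feasible_rate (supply_bound m i) (mu i + h) by near: h.
have : `|(lam j + h) * demand m j (lam j + h) - lam j * demand m j (lam j)
         - marginal_revenue j * h| <= e * `|h| by near: h.
have : `|(mu i + h) * supply m i (mu i + h) - mu i * supply m i (mu i)
         - marginal_cost i * h| <= e * `|h| by near: h.
rewrite !ler_norml => /andP[? ?] /andP[? ?] ?; lra.
Unshelve. all: by end_near. Qed.

(** A small amount of flow can always be added to a compatible edge: [h = d / 2]. *)
Lemma marginal_le i j : compatible m i j -> marginal_revenue j <= marginal_cost i.
Proof.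
move=> Hij; apply/ler_addgt0Pr => e e0.
have e2 : 0 < e / 2 by rewrite divr_gt0.
have [d /= d0 hd] := marginal_near e2 Hij.
have [[[_ chi0 _ _ _] _] _ _] := opt.
have := hd (d / 2); rewrite /ball_ /= sub0r normrN ger0_norm; last lra.
have d2 : 0 < d / 2 by rewrite divr_gt0.
have dd : d / 2 < d by lra.
have cc : 0 <= chi i j + d / 2 by rewrite addr_ge0 ?chi0// ltW.
by move=> /(_ dd cc); rewrite ler_pM2r//; lra.
Qed.

(** An edge that carries flow also admits [h < 0], down to [- chi i j]. *)
Lemma marginal_tight i j : compatible m i j -> chi i j != 0 ->
  marginal_revenue j = marginal_cost i.
Proof.
move=> Hij chi_ij; apply/eqP; rewrite eq_le marginal_le//=.
apply/ler_addgt0Pr => e e0.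
have e2 : 0 < e / 2 by rewrite divr_gt0.
have [d /= d0 hd] := marginal_near e2 Hij.
have [[[_ chi0 _ _ _] _] _ _] := opt.
have chi_gt0 : 0 < chi i j by rewrite lt_neqAle eq_sym chi_ij chi0.
pose k := Num.min (d / 2) (chi i j).
have k0 : 0 < k by rewrite lt_min chi_gt0 divr_gt0.
have kd : k < d by rewrite gt_min; apply/orP; left; lra.
have kc : 0 <= chi i j + - k by rewrite subr_ge0 ge_min lexx orbT.
have := hd (- k); rewrite /ball_ /= sub0r opprK normrN (gtr0_norm k0).
move=> /(_ kd kc); rewrite mulrN -mulNr ler_pM2r//; lra.
Qed.

Lemma chi_compatible i j : chi i j != 0 -> compatible m i j.
Proof.
have [[[_ _ chiN _ _] _] _ _] := opt.
by apply: contraNT => /chiN ->.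
Qed.

(** Both sums are rewritten over edges with weight [chi i j]; where this weight is nonzero the two
    prices agree. *)
Lemma marginal_balanced :
  \sum_j marginal_revenue j * lam j = \sum_i marginal_cost i * mu i.
Proof.
have [[[[lamE muE] _ _ _ _] _] _ _] := opt.
under eq_bigr => j _ do rewrite lamE mulr_sumr.
under [RHS]eq_bigr => i _ do rewrite muE mulr_sumr.
rewrite exchange_big /=; apply: eq_bigr => i _; apply: eq_bigr => j _.
have [->|chi_ij] := eqVneq (chi i j) 0; first by rewrite !mulr0.
by rewrite (marginal_tight (chi_compatible chi_ij) chi_ij).
Qed.

(* The customer types of largest marginal revenue are served exclusively by
   server types that serve no other customer type; resource pooling forbids
   this unless they are all the customer types. *)
Lemma pooled_marginals : complete_resource_pooling (compatible m) lam mu ->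
  forall i j, marginal_revenue j = marginal_cost i.
Proof.
move=> [crp _] i0 j0.
have [[[[lamE muE] chi0 _ _ _] _] lam0 mu0] := opt.
pose jm := [arg max_(j > j0) marginal_revenue j]%O.
have jmP j : marginal_revenue j <= marginal_revenue jm.
  by rewrite /jm; case: arg_maxP => // k _; exact.
pose J := [set j | marginal_revenue j == marginal_revenue jm]%SET.
(* A server type adjacent to [J] has marginal cost at least the largest revenue, and every type it
   serves has revenue equal to that cost; so it serves only [J]. *)
have tight i j k : compatible m i j -> j \in J -> chi i k != 0 -> k \in J.
  move=> Hij; rewrite !inE => /eqP jJ chi_ik; rewrite eq_le jmP /=.
  rewrite (marginal_tight (chi_compatible chi_ik) chi_ik) -jJ.
  exact: marginal_le.
have chi_ge0 i j : 0 <= chi i j.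
  have [->//|c] := eqVneq (chi i j) 0; exact: chi0 (chi_compatible c).
have all j : marginal_revenue j = marginal_revenue jm.
  apply/eqP; have : j \in J; last by rewrite inE.
  have J0 : (0 < #|J|)%N by apply/card_gt0P; exists jm; rewrite inE.
  have := crp J; rewrite J0 /=; case: (ltnP #|J| n) => [_ /(_ isT)|nJ _]; last first.
    have /setP -> : J = [set: 'I_n]%SET; last by rewrite inE.
    by apply/eqP; rewrite eqEcard finset.subsetT cardsT card_ord.
  (* Hence the neighbours of [J] have total rate at most that of [J], against pooling. *)
  rewrite ltNge => /negP[]; rewrite (eq_bigr _ (fun j _ => lamE j)) exchange_big /=.
  rewrite [leRHS](bigID (fun i => [exists j in J, compatible m i j])) /= -[leLHS]addr0.
  apply: lerD; last by rewrite sumr_ge0// => i _; rewrite sumr_ge0.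
  apply: ler_sum => i /existsP[j' /andP[j'J Hij']]; rewrite muE.
  rewrite (bigID (fun j => j \in J)) /= [X in _ + X]big1 ?addr0// => k kJ.
  by apply/eqP; apply: contraNT kJ; exact: tight Hij' j'J.
rewrite all.
have [k chi_k] : exists k, chi i0 k != 0.
  apply/existsP; apply: contraT; rewrite negb_exists => /forallP h.
  have := mu0 i0; rewrite muE big1 ?ltxx// => k _.
  by have := h k; rewrite negbK => /eqP.
by rewrite -(all k); exact: marginal_tight (chi_compatible chi_k) chi_k.
Qed.

(** Minus half the second derivative of revenue, in the form that enters [max_weight_bound]. *)
Definition demand_curvature j :=
  - (lam j * derive1n 2 (demand m j) (lam j) / 2 + derive1 (demand m j) (lam j)).
Definition supply_curvature i :=
  mu i * derive1n 2 (supply m i) (mu i) / 2 + derive1 (supply m i) (mu i).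

Lemma demand_curvatureE j : demand_curvature j =
  - (derive1 (derive1 (fun z : R => z * demand m j z)) (lam j) / 2).
Proof.
rewrite [derive1 (derive1 _) _]derive1E (@derive_val _ _ _ _ _ _ _
  (product_second_derivative (demand_derivable j) (@demand_derivable2 j))).
by rewrite /demand_curvature /=; field.
Qed.

Lemma supply_curvatureE i : supply_curvature i =
  derive1 (derive1 (fun z : R => z * supply m i z)) (mu i) / 2.
Proof.
rewrite [derive1 (derive1 _) _]derive1E (@derive_val _ _ _ _ _ _ _
  (product_second_derivative (supply_derivable i) (@supply_derivable2 i))).
by rewrite /supply_curvature /=; field.
Qed.

Lemma demand_curvature_gt0 j : 0 < demand_curvature j.
Proof.
rewrite demand_curvatureE oppr_gt0 pmulr_llt0 ?invr_gt0//.
have [[[_ _ _ fl _] _] _ _] := opt; have [dem _ _ _] := mkt.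
by have [_ _ _ neg] := dem j; exact: neg (fl j).
Qed.

Lemma supply_curvature_gt0 i : 0 < supply_curvature i.
Proof.
rewrite supply_curvatureE divr_gt0//.
have [[[_ _ _ _ fm] _] _ _] := opt; have [_ sup _ _] := mkt.
by have [_ _ _ pos] := sup i; exact: pos (fm i).
Qed.

Lemma demand_gap j (e : R) : 0 < e -> \forall d \near 0^'+,
  `|secant_gap (fun z : R => z * demand m j z) (marginal_revenue j) (lam j) d
    - demand_curvature j * d ^+ 2| <= e * d ^+ 2.
Proof.
move=> e0; rewrite demand_curvatureE.
have d1 : \forall y \near lam j, derivable (fun z : R => z * demand m j z) y 1.
  by apply: filterS (demand_derivable j) => y dy; have [] := product_derivative dy.
have d2 : derivable (derive1 (fun z : R => z * demand m j z)) (lam j) 1.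
  by have [] := product_second_derivative (demand_derivable j) (@demand_derivable2 j).
by apply: filterS (second_order d1 d2 e0) => d; rewrite mulNr opprK.
Qed.

Lemma supply_gap i (e : R) : 0 < e -> \forall d \near 0^'+,
  `|- secant_gap (fun z : R => z * supply m i z) (marginal_cost i) (mu i) d
    - supply_curvature i * d ^+ 2| <= e * d ^+ 2.
Proof.
move=> e0; rewrite supply_curvatureE.
have d1 : \forall y \near mu i, derivable (fun z : R => z * supply m i z) y 1.
  by apply: filterS (supply_derivable i) => y dy; have [] := product_derivative dy.
have d2 : derivable (derive1 (fun z : R => z * supply m i z)) (mu i) 1.
  by have [] := product_second_derivative (supply_derivable i) (@supply_derivable2 i).
by apply: filterS (second_order d1 d2 e0) => d; rewrite -opprD normrN.
Qed.

End FluidOptimality.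

(** * Asymptotics of the two-price policy *)

Section LimitBounds.
Variable R : realType.

Lemma limn_esup_le_near (u : nat -> \bar R) (B : \bar R) :
  (\forall k \near \oo, (u k <= B)%E) -> (limn_esup u <= B)%E.
Proof.
move=> uB; apply: (@le_trans _ _ (ereal_sup (u @` [set k | (u k <= B)%E]))).
  by apply: ereal_inf_lbound; exists [set k | (u k <= B)%E].
by apply: ge_ereal_sup => _ [k kB <-].
Qed.

Lemma limn_einf_ge_near (u : nat -> \bar R) (B : \bar R) :
  (\forall k \near \oo, (B <= u k)%E) -> (B <= limn_einf u)%E.
Proof.
move=> Bu; rewrite /limn_einf leeNr; apply: limn_esup_le_near.
by apply: filterS Bu => k; rewrite leeN2.
Qed.

(** With [s] the cube root of [eta], every power of [eta] in the scaling is a power of [s], so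
    identities between them are left to [field]. *)
Definition cube_root (k : nat) : R := k%:R `^ (1 / 3).

Lemma cube_rootK k : cube_root k ^+ 3 = k%:R.
Proof. by rewrite /cube_root -powR_mulrn ?powR_ge0// -powRrM divfK// powRr1. Qed.

Lemma cube_root_sqr k : k%:R `^ (2 / 3) = cube_root k ^+ 2.
Proof. by rewrite /cube_root -powR_mulrn ?powR_ge0// -powRrM mul1r mulrC. Qed.

Lemma cube_root_gt0 k : (0 < k)%N -> 0 < cube_root k.
Proof. by move=> k0; rewrite powR_gt0// ltr0n. Qed.

Lemma cube_root_near (B : R) : \forall k \near \oo, B < cube_root k.
Proof.
near=> k; rewrite ltNge; apply/negP => kB.
have k0 : 0 <= cube_root k by exact: powR_ge0.
have : cube_root k ^+ 3 <= B ^+ 3 by rewrite ler_pXn2r ?nnegrE// (le_trans k0).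
rewrite cube_rootK leNgt => /negP; apply; near: k; exact: nbhs_infty_gtr.
Unshelve. all: by end_near. Qed.

Lemma near_right_cube_root (Q : R -> Prop) (a : R) : 0 < a ->
  (\forall d \near 0^'+, Q d) -> \forall k \near \oo, Q (a / cube_root k).
Proof.
move=> a0 [d /= d0 hd]; near=> k.
have k0 : 0 < cube_root k by near: k; exact: cube_root_near.
have dk : a / d < cube_root k by near: k; exact: cube_root_near.
apply: hd => /=; last by rewrite divr_gt0.
rewrite sub0r normrN gtr0_norm ?divr_gt0// ltr_pdivrMr// mulrC -ltr_pdivrMr//.
Unshelve. all: by end_near. Qed.

End LimitBounds.

Section Weights.
Variables (R : realType) (n : nat).

(** Renormalizing over the nonempty queues divides by [S], the part of [\sum_k c k] that meets a
    nonempty queue. As [S] is at most the full sum, the mean served length can only grow; if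
    [S = 0], all queues with positive [c] are empty. *)
Lemma randomized_service_rule (c : 'I_n -> R) (q : 'I_n -> nat) :
  (forall k, 0 <= c k) ->
  let w k := c k * (0 < q k)%N%:R / (\sum_(k' < n) c k' * (0 < q k')%N%:R) in
  service_rule (fun k => c k != 0) q w /\
  \sum_k c k * (q k)%:R <= (\sum_k c k) * \sum_k w k * (q k)%:R.
Proof.
move=> c0 w; pose S := \sum_(k' < n) c k' * (0 < q k')%N%:R.
have S0 : 0 <= S by rewrite sumr_ge0// => k _; rewrite mulr_ge0.
split.
  split=> [k|k|[k ck qk]]; first by rewrite divr_ge0// mulr_ge0.
    rewrite /w !mulf_eq0 !negb_or -andbA => /and3P[-> + _].
    by case: (0 < q k)%N => //; rewrite eqxx.
  rewrite /w -mulr_suml -/S divff// gt_eqF// lt_neqAle S0 andbT eq_sym.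
  rewrite psumr_neq0; last by move=> l _; rewrite mulr_ge0.
  by apply/hasP; exists k; rewrite ?mem_index_enum//= qk mulr1 lt_neqAle eq_sym ck c0.
have [S_eq0|S_neq0] := eqVneq S 0.
  have cq k : c k * (q k)%:R = 0.
    have /eqP := S_eq0; rewrite psumr_eq0; last by move=> l _; rewrite mulr_ge0.
    move=> /allP /(_ k (mem_index_enum _)) /= /eqP.
    by case: (posnP (q k)) => [->|_]; rewrite ?mulr0// mulr1 => ->; rewrite mul0r.
  rewrite big1 => [|k _]; last exact: cq.
  rewrite mulr_ge0 ?sumr_ge0// => k _.
  by rewrite mulr_ge0// divr_ge0// mulr_ge0.
have S_gt0 : 0 < S by rewrite lt_neqAle eq_sym S_neq0.
have -> : \sum_k w k * (q k)%:R = (\sum_k c k * (q k)%:R) / S.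
  rewrite mulr_suml; apply: eq_bigr => k _; rewrite /w -/S.
  by case: (posnP (q k)) => [->|_]; rewrite ?mulr0 ?mul0r ?mulr1//; rewrite mulrAC.
rewrite mulrCA ler_peMr//; first by rewrite sumr_ge0// => k _; rewrite mulr_ge0.
rewrite ler_pdivlMr// mul1r; apply: ler_sum => k _.
by case: (0 < q k)%N; rewrite ?mulr1// mulr0.
Qed.

Lemma longest_queue_max (c : pred 'I_n) (q : 'I_n -> nat) (w : 'I_n -> R) k :
  longest_queue_rule c q w -> c k -> (q k)%:R <= \sum_l w l * (q l)%:R.
Proof.
move=> [w0 wc w1] ck; have [->|qk] := posnP (q k).
  by rewrite sumr_ge0// => l _; rewrite mulr_ge0.
apply: (@le_trans _ _ ((\sum_l w l) * (q k)%:R)).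
  by rewrite (w1 (ex_intro2 _ _ k ck qk)) mul1r.
rewrite mulr_suml; apply: ler_sum => l _.
have [->|/wc[_ _ qmax]] := eqVneq (w l) 0; first by rewrite !mul0r.
by rewrite ler_wpM2l// ler_nat qmax.
Qed.

Lemma longest_queue_service_rule (c : pred 'I_n) (q : 'I_n -> nat) (w : 'I_n -> R) :
  longest_queue_rule c q w -> service_rule c q w.
Proof. by move=> [w0 wc w1]; split=> // k /wc[]. Qed.

Lemma longest_queue_weight (c : pred 'I_n) (q : 'I_n -> nat) (w b : 'I_n -> R) :
  longest_queue_rule c q w -> (forall k, 0 <= b k) -> (forall k, b k != 0 -> c k) ->
  \sum_k b k * (q k)%:R <= (\sum_k b k) * \sum_k w k * (q k)%:R.
Proof.
move=> lq b0 bc; rewrite mulr_suml; apply: ler_sum => k _.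
have [->|/bc ck] := eqVneq (b k) 0; first by rewrite !mul0r.
by rewrite ler_wpM2l//; exact: longest_queue_max lq ck.
Qed.

End Weights.

Section Regime.
Variables (R : realType) (n : nat) (m : market R n).
Variables (lam mu : 'I_n -> R) (chi : 'I_n -> 'I_n -> R).
Hypothesis opt : positive_fluid_solution m lam mu chi.

Lemma chi_ge0 i j : 0 <= chi i j.
Proof.
have [[[_ chi0 _ _ _] _] _ _] := opt.
have [->//|c] := eqVneq (chi i j) 0; exact: chi0 (chi_compatible opt c).
Qed.

Variables (theta phi : 'I_n -> R) (nu : R) (sigma tau : nat -> R).
Hypothesis theta_gt0 : forall j, 0 < theta j.
Hypothesis phi_gt0 : forall i, 0 < phi i.
Hypothesis nu_gt0 : 0 < nu.
Hypothesis sigmaE : forall eta, sigma eta = nu * cube_root R eta ^+ 2.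
Hypothesis tau_ge0 : forall eta, 0 <= tau eta.

Lemma sigma_eta eta : (0 < eta)%N -> sigma eta / eta%:R = nu / cube_root R eta.
Proof.
move=> /(cube_root_gt0 R) s0; rewrite sigmaE -cube_rootK.
have sn : cube_root R eta != 0 by rewrite gt_eqF.
by field.
Qed.

Lemma near_regime (H : rel 'I_n) (M : nat -> matching R n) :
  (forall eta, greedy_matching H (M eta)) ->
  (forall eta x i, \sum_(j < n) chi i j * (customers x j)%:R <=
     mu i * \sum_(j < n) server_match (M eta) x i j * (customers x j)%:R) ->
  (forall eta x j, \sum_(i < n) chi i j * (servers x i)%:R <=
     lam j * \sum_(i < n) customer_match (M eta) x i j * (servers x i)%:R) ->
  \forall eta \near \oo,
    two_price_regime H chi (M eta) eta lam mu theta phi (sigma eta) (tau eta).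
Proof.
move=> HM hs hc; have [[[[lamE muE] _ _ _ _] _] lam0 mu0] := opt.
have small (a b : 'I_n -> R) : (forall k, 0 < b k) -> (forall k, 0 < a k) ->
    \forall eta \near \oo, forall k, a k * sigma eta < eta%:R * b k.
  move=> b0 a0; apply: filter_forall => k; near=> eta.
  have s0 : 0 < cube_root R eta by near: eta; exact: cube_root_near.
  have sk : a k * nu / b k < cube_root R eta by near: eta; exact: cube_root_near.
  rewrite sigmaE -cube_rootK mulrA.
  rewrite (_ : _ ^+ 3 * b k = cube_root R eta * b k * cube_root R eta ^+ 2); last by ring.
  rewrite ltr_pM2r ?exprn_gt0//.
  by rewrite -ltr_pdivrMr.
near=> eta; split => //.
- have s0 : 0 < cube_root R eta by near: eta; exact: cube_root_near.
  by rewrite sigmaE mulr_gt0// exprn_gt0.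
- by near: eta; exact: small.
- by near: eta; exact: small.
Unshelve. all: by end_near. Qed.

Hypothesis mkt : market_assumptions m.

(** For a price parameter [a] the rate step is [d = a * nu / s] with [eta = s ^ 3], so
    [eta * d ^ 2 = (a * nu) ^ 2 * s], the size of the second-order terms. *)
Definition close_gaps (e : R) (eta : nat) : Prop :=
  (forall j, `|eta%:R * secant_gap (fun z : R => z * demand m j z)
       (marginal_revenue m lam j) (lam j) (theta j * sigma eta / eta%:R)
     - (theta j * nu) ^+ 2 * demand_curvature m lam j * cube_root R eta|
     <= e * (theta j * nu) ^+ 2 * cube_root R eta) /\
  (forall i, `|eta%:R * - secant_gap (fun z : R => z * supply m i z)
       (marginal_cost m mu i) (mu i) (phi i * sigma eta / eta%:R)
     - (phi i * nu) ^+ 2 * supply_curvature m mu i * cube_root R eta|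
     <= e * (phi i * nu) ^+ 2 * cube_root R eta).

Lemma near_gaps (e : R) : 0 < e -> \forall eta \near \oo, close_gaps e eta.
Proof.
move=> e0.
have one (a K : R) (G : R -> R) : 0 < a ->
    (\forall d \near 0^'+, `|G d - K * d ^+ 2| <= e * d ^+ 2) ->
    \forall eta \near \oo, `|eta%:R * G (a * sigma eta / eta%:R)
      - (a * nu) ^+ 2 * K * cube_root R eta| <= e * (a * nu) ^+ 2 * cube_root R eta.
  move=> a0 HG; near=> eta.
  have s0 : 0 < cube_root R eta by near: eta; exact: cube_root_near.
  have eta0 : (0 < eta)%N by near: eta; exact: nbhs_infty_gt.
  rewrite -mulrA sigma_eta// mulrA.
  have : `|G (a * nu / cube_root R eta) - K * (a * nu / cube_root R eta) ^+ 2|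
      <= e * (a * nu / cube_root R eta) ^+ 2.
    by near: eta; apply: near_right_cube_root HG; rewrite mulr_gt0.
  rewrite -(ler_pM2l (x := eta%:R)) ?ltr0n// -[X in X * `|_|](ger0_norm (ler0n R eta)).
  rewrite -normrM mulrBr -cube_rootK.
  have sn : cube_root R eta != 0 by rewrite gt_eqF.
  set g := G _.
  have -> : cube_root R eta ^+ 3 * (K * (a * nu / cube_root R eta) ^+ 2) =
     (a * nu) ^+ 2 * K * cube_root R eta by field.
  by have -> : cube_root R eta ^+ 3 * (e * (a * nu / cube_root R eta) ^+ 2) =
     e * (a * nu) ^+ 2 * cube_root R eta by field.
near=> eta; split; near: eta; apply: filter_forall => k.
  by apply: one => //; exact: (demand_gap mkt opt).
apply: (one _ _ (fun d => - secant_gap (fun z : R => z * supply m k z) _ _ d)) => //.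
exact: (supply_gap mkt opt).
Unshelve. all: by end_near. Qed.

End Regime.

(** * Upper bound for randomized matching *)

Section RandomizedUpperBound.
Variables (R : realType) (n : nat) (m : market R n).
Variables (lam mu : 'I_n -> R) (chi : 'I_n -> 'I_n -> R).
Variables (theta phi : 'I_n -> R) (gamma : R).
Hypothesis mkt : market_assumptions m.
Hypothesis opt : positive_fluid_solution m lam mu chi.
Hypothesis theta_gt0 : forall j, 0 < theta j.
Hypothesis phi_gt0 : forall i, 0 < phi i.
Hypothesis gamma_gt0 : 0 < gamma.

Let used : rel 'I_n := fun i j => chi i j != 0.
Let sigma (eta : nat) : R := eta%:R `^ (2 / 3).
Let tau (eta : nat) : R := gamma * eta%:R `^ (1 / 3).

Let sigmaE eta : sigma eta = 1 * cube_root R eta ^+ 2.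
Proof. by rewrite mul1r /sigma cube_root_sqr. Qed.

Lemma randomized_greedy : greedy_matching used (randomized_matching chi).
Proof.
move=> q; split=> k.
  exact: (randomized_service_rule (customers q) (fun j => chi_ge0 opt k j)).1.
exact: (randomized_service_rule (servers q) (fun i => chi_ge0 opt i k)).1.
Qed.

Lemma near_randomized_regime : \forall eta \near \oo,
  two_price_regime used chi (randomized_matching chi) eta lam mu theta phi
    (sigma eta) (tau eta).
Proof.
have [[[[lamE muE] _ _ _ _] _] lam0 mu0] := opt.
have tau_ge0 eta : 0 <= tau eta by rewrite mulr_ge0 ?powR_ge0// ltW.
apply: (@near_regime R n m lam mu chi opt theta phi 1 sigma tau
  theta_gt0 phi_gt0 ltr01 sigmaE tau_ge0 used (fun=> randomized_matching chi)).
- by move=> _; exact: randomized_greedy.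
- move=> _ x i; rewrite muE.
  exact: (randomized_service_rule (customers x) (fun j => chi_ge0 opt i j)).2.
- move=> _ x j; rewrite lamE.
  exact: (randomized_service_rule (servers x) (fun i => chi_ge0 opt i j)).2.
Qed.

Lemma randomized_stationary_exists : \forall eta \near \oo,
  exists P : probability (state n) R,
  stationary (transition_rate (two_price_policy eta lam mu theta phi (sigma eta) (tau eta))
    (randomized_matching chi)) P.
Proof.
by apply: filterS near_randomized_regime => eta reg; exact: regime_stationary_exists reg.
Qed.

Lemma randomized_loss_bound (P : nat -> probability (state n) R) :
  (\forall eta \near \oo,
    stationary (transition_rate (two_price_policy eta lam mu theta phi (sigma eta) (tau eta))
    (randomized_matching chi)) (P eta)) ->
  exists C : R, \forall eta \near \oo,
    (`|profit_loss m eta (two_price_policy eta lam mu theta phi (sigma eta) (tau eta)) (P eta)|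
       <= (C * eta%:R `^ (1 / 3))%:E)%E.
Proof.
move=> statP; have [_ _ sc0 ss0] := mkt; have [_ lam0 mu0] := opt.
have [k k0 hk] : exists2 c, 0 < c & forall l : 'I_n, true -> c <= Num.min (theta l) (phi l).
  by apply: finite_positive_bound => l _; rewrite lt_min theta_gt0 phi_gt0.
have kt l : k <= theta l by have := hk l isT; rewrite le_min => /andP[].
have kp l : k <= phi l by have := hk l isT; rewrite le_min => /andP[].
pose Lam := \sum_j lam j + \sum_i mu i.
pose Th := \sum_j theta j + \sum_i phi i.
pose cost := \sum_j customer_cost m j + \sum_i server_cost m i.
(* With [eta = s ^ 3], [sigma = s ^ 2] and [tau = gamma * s], the bound of [total_expectation] is
   exactly [B * s]. *)
pose B := (Lam + 2 * gamma * Th) / (2 * k).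
(* The added 1 is the tolerance with which [near_gaps] is used. *)
pose C1 := \sum_j (theta j) ^+ 2 * (demand_curvature m lam j + 1).
pose C2 := \sum_i (phi i) ^+ 2 * (supply_curvature m mu i + 1).
exists (C1 + C2 + cost * B).
have gaps := near_gaps opt theta_gt0 phi_gt0 ltr01 sigmaE mkt ltr01.
near=> eta; set s := eta%:R `^ (1 / 3).
have eta0 : (0 < eta)%N by near: eta; exact: nbhs_infty_gt.
have s0 : 0 < s by exact: cube_root_gt0.
have reg : two_price_regime used chi (randomized_matching chi) eta lam mu theta phi
    (sigma eta) (tau eta) by near: eta; exact: near_randomized_regime.
have sP : stationary (transition_rate (two_price_policy eta lam mu theta phi (sigma eta) (tau eta))
    (randomized_matching chi)) (P eta) by near: eta.
have [gc gs] : close_gaps m lam mu theta phi 1 sigma 1 eta by near: eta.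
have tight i j : used i j -> marginal_revenue m lam j = marginal_cost m mu i.
  by move=> u; apply: (marginal_tight mkt opt) => //; exact: (chi_compatible opt).
rewrite (profit_loss_formula reg sP eta0 tight (marginal_balanced mkt opt)
  (fluid_value_optimal opt)).
have [Ey Ez tot] := total_mean (total_expectation reg sP k0 kt kp).
have my j : 0 <= mean (P eta) (fun x => (customers x j)%:R).
  by rewrite -lee_fin -Ey; apply: expectation_ge0.
have mz i : 0 <= mean (P eta) (fun x => (servers x i)%:R).
  by rewrite -lee_fin -Ez; apply: expectation_ge0.
have ind (p : state n -> bool) : 0 <= mean (P eta) (fun x => (p x)%:R) <= 1.
  have bi : bounded_observable (fun x : state n => (p x)%:R : R) by exact: bounded_observable_indicator.
  rewrite mean_ge0//= -[leRHS](mean_cst (P eta) 1); apply: le_mean => //.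
    exact: bounded_observable_cst.
  by move=> x; case: (p x).
have totB : \sum_j mean (P eta) (fun x => (customers x j)%:R)
      + \sum_i mean (P eta) (fun x => (servers x i)%:R) <= B * s.
  apply: le_trans tot _; rewrite /sigma /tau cube_root_sqr -/s -[eta%:R]cube_rootK -/(cube_root R eta) -/s.
  rewrite le_eqVlt; apply/orP; left; apply/eqP; rewrite /B /Lam /Th.
  have k1 : k != 0 by rewrite gt_eqF.
  have s1 : s != 0 by rewrite gt_eqF.
  by rewrite /cube_root -/s; field; rewrite k1 s1.
have term (a K g M : R) : 0 < K -> `|g - (a * 1) ^+ 2 * K * s| <= 1 * (a * 1) ^+ 2 * s ->
    0 <= M <= 1 -> `|g * M| <= a ^+ 2 * (K + 1) * s.
  move=> K0; rewrite !mulr1 mul1r => hg /andP[M0 M1].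
  rewrite normrM (ger0_norm M0) (le_trans (ler_piMr _ M1))//.
  have h0 : 0 <= a ^+ 2 * K * s by rewrite mulr_ge0 ?(ltW s0)// mulr_ge0 ?sqr_ge0 ?(ltW K0).
  have := ler_normD (g - a ^+ 2 * K * s) (a ^+ 2 * K * s).
  rewrite subrK (ger0_norm h0) => h; apply: le_trans h _; lra.
rewrite /= lee_fin.
have sum_norm (a g M : 'I_n -> R) (K : 'I_n -> R) : (forall l, 0 < K l) ->
    (forall l, `|g l - (a l * 1) ^+ 2 * K l * s| <= 1 * (a l * 1) ^+ 2 * s) ->
    (forall l, 0 <= M l <= 1) ->
    `|\sum_l g l * M l| <= (\sum_l a l ^+ 2 * (K l + 1)) * s.
  move=> K0 hg hM; apply: le_trans (ler_norm_sum _ _ _) _.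
  by rewrite mulr_suml; apply: ler_sum => l _; exact: term.
have n1 := sum_norm theta _ _ _ (demand_curvature_gt0 mkt opt) gc
  (fun j => ind (fun x => (tau eta < (customers x j)%:R)%R)).
have n2 := sum_norm phi _ _ _ (supply_curvature_gt0 mkt opt) gs
  (fun i => ind (fun x => (tau eta < (servers x i)%:R)%R)).
rewrite (le_trans (ler_normD _ _))// [X in _ <= X]mulrDl lerD//.
  by rewrite (le_trans (ler_normD _ _))// [X in _ <= X]mulrDl lerD.
have cy : \sum_j customer_cost m j * mean (P eta) (fun x => (customers x j)%:R) <=
    cost * \sum_j mean (P eta) (fun x => (customers x j)%:R).
  rewrite mulr_sumr; apply: ler_sum => j _; rewrite ler_wpM2r//.
  rewrite /cost (bigD1 j)//= -addrA lerDl addr_ge0// sumr_ge0// => l _; exact: ltW.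
have cz : \sum_i server_cost m i * mean (P eta) (fun x => (servers x i)%:R) <=
    cost * \sum_i mean (P eta) (fun x => (servers x i)%:R).
  rewrite mulr_sumr; apply: ler_sum => i _; rewrite ler_wpM2r//.
  rewrite /cost [X in _ + X](bigD1 i)//= addrCA lerDl addr_ge0// sumr_ge0// => l _; exact: ltW.
have cost0 : 0 <= cost by rewrite addr_ge0// sumr_ge0// => l _; exact: ltW.
rewrite ger0_norm; last first.
  by rewrite addr_ge0// sumr_ge0// => l _; rewrite mulr_ge0// ltW.
apply: le_trans (lerD cy cz) _; rewrite -mulrDr -mulrA; exact: ler_wpM2l.
Unshelve. all: by end_near. Qed.

End RandomizedUpperBound.

(** * A test function for a single link *)

Section TestFunction.
Variable R : realType.

(* Below L its second difference is 12 a - 6 L, so stationarity of the walk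
   bounds the mean distance from 0 from below by about L / 2. *)
Definition bump (L a : nat) : R := ((L - a) ^ 2 * (L + 2 * a))%N%:R.

Lemma bumpE L a : (a <= L)%N -> bump L a = (L%:R - a%:R) ^+ 2 * (L%:R + 2 * a%:R).
Proof. by move=> aL; rewrite /bump natrM natrX natrD natrM natrB. Qed.

Lemma bump0 L a : (L <= a)%N -> bump L a = 0.
Proof. by move=> La; rewrite /bump (eqP La). Qed.

(** On an empty link either arrival opens a queue of length one, whence the factor 2. *)
Lemma bump_origin L : 2 * (bump L 1 - bump L 0) <= 4 - 6 * L%:R.
Proof.
have [->|L0] := posnP L; first by rewrite !bump0// subrr mulr0 mulr0 subr0.
by rewrite !bumpE//= !mulr0 subr0 addr0; rewrite le_eqVlt; apply/orP; left; apply/eqP; ring.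
Qed.

(** Up to [L] the function is [L ^ 3 - 3 * L * a ^ 2 + 2 * a ^ 3], whose second difference at [a.+1]
    is exactly [12 * a.+1 - 6 * L]. The slack 4 is the one the origin forces; at and beyond [L],
    where [bump] is cut to 0, the inequality survives. *)
Lemma bump_laplacian L a :
  bump L a.+2 + bump L a - 2 * bump L a.+1 <= 12 * a.+1%:R + 4 - 6 * L%:R.
Proof.
have [La|La] := leqP L a.
  rewrite !bump0 ?(leq_trans La)// ?leqW// addr0 mulr0 subr0.
  have : L%:R <= a%:R :> R by rewrite ler_nat.
  rewrite -natr1; have : 0 <= a%:R :> R by [].
  by move=> ? ?; lra.
rewrite [bump L a]bumpE ?(ltnW La)// [bump L a.+1]bumpE//.
have [La2|La2] := leqP L a.+1.
  have -> : L = a.+1 by apply/eqP; rewrite eqn_leq La2.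
  rewrite bump0// -natr1 add0r; have : 0 <= a%:R :> R by [].
  by move=> ?; nra.
by rewrite bumpE// -[a.+2%:R]natr1 -natr1; nra.
Qed.

End TestFunction.

Section SingleLinks.
Variables (R : realType) (n : nat) (M : matching R n) (eta : nat).
Variables (theta phi : 'I_n -> R) (l sigma tau : R).
Variable chi : 'I_n -> 'I_n -> R.
Let lam : 'I_n -> R := fun=> l.
Hypothesis regime : two_price_regime (fun i j => i == j) chi M eta lam lam theta phi sigma tau.
Local Notation T := (state n).
Let p := two_price_policy eta lam lam theta phi sigma tau.
Local Notation A := (generator (event_intensity p M) (@event_target n)).

(** A good state leaves at most one side of link [k] waiting, and below [L] both sides arrive at
    rate [eta * l]: the link is a symmetric walk folded at 0. *)
Lemma single_link_drift (L : nat) (k : 'I_n) (x : T) : L%:R <= tau ->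
  good (fun i j => i == j) x ->
  A (fun q => bump R L (customers q k) + bump R L (servers q k)) x <=
  eta%:R * l * (12 * (customers x k + servers x k)%:R - (6 * L%:R - 4)).
Proof.
move=> Ltau gx; have [S C] := regime_greedy regime x.
have l0 : 0 <= eta%:R * l.
  apply: le_trans (ltW (regime_lam regime k)).
  by rewrite mulr_ge0// ltW ?(regime_theta regime) ?(regime_sigma regime).
have pick (F : 'I_n -> R) : \sum_j (j == k)%:R * F j = F k.
  by rewrite (bigD1 k)//= eqxx mul1r big1 ?addr0// => j /negPf ->; rewrite mul0r.
have -> : (fun q => bump R L (customers q k) + bump R L (servers q k)) =
  (fun q => \sum_j (j == k)%:R * bump R L (customers q j)
            + \sum_i (i == k)%:R * bump R L (servers q i)).
  by apply/funext => q; rewrite !pick.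
rewrite (generator_separable p M (fun j a => (j == k)%:R * bump R L a)
  (fun i a => (i == k)%:R * bump R L a)) /=.
(* Type [j] is matched only within its own link, so every term but that of [k] vanishes. *)
have half (r : R) (w : 'I_n -> R) (c : pred 'I_n) (q : 'I_n -> nat) j (d : R) :
    service_rule c q w -> (forall i, c i -> i = j) ->
    r * (\sum_i w i * ((i == k)%:R * bump R L (q i).-1 - (i == k)%:R * bump R L (q i))
         + (1 - \sum_i w i) * ((j == k)%:R * d)) =
    (j == k)%:R * (r * ((\sum_i w i) * (bump R L (q j).-1 - bump R L (q j))
                        + (1 - \sum_i w i) * d)).
  move=> [_ wc _] cj.
  have -> : \sum_i w i * ((i == k)%:R * bump R L (q i).-1 - (i == k)%:R * bump R L (q i)) =
      (j == k)%:R * ((\sum_i w i) * (bump R L (q j).-1 - bump R L (q j))).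
    rewrite mulr_suml mulr_sumr; apply: eq_bigr => i _.
    have [->|/wc[ci _]] := eqVneq (w i) 0; first by rewrite !mul0r mulr0.
    by rewrite (cj i ci); ring.
  by ring.
under eq_bigr => j _ do rewrite -mulrBr
  (half _ _ _ _ j _ (C j) ltac:(by move=> i /eqP)).
rewrite pick.
under eq_bigr => i _ do rewrite -mulrBr
  (half _ _ _ _ i _ (S i) ltac:(by move=> j /eqP)).
rewrite pick.
have /= ry : ~~ (tau < (customers x k)%:R) -> customer_rate p x k = eta%:R * l.
  by move=> /negPf h; rewrite /= h mulr0 subr0.
have /= rz : ~~ (tau < (servers x k)%:R) -> server_rate p x k = eta%:R * l.
  by move=> /negPf h; rewrite /= h mulr0 subr0.
have tau0 := regime_tau regime.
have sum0 (c : pred 'I_n) q (w : 'I_n -> R) : service_rule c q w ->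
    (forall i, c i -> i = k) -> q k = 0%N -> \sum_i w i = 0.
  by move=> sr ck qk; rewrite big1// => i _; apply: (service_rule_idle sr) => i' /ck ->.
have sum1 (c : pred 'I_n) q (w : 'I_n -> R) : service_rule c q w ->
    c k -> (0 < q k)%N -> \sum_i w i = 1.
  by move=> [_ _ s1] ck qk; apply: s1; exists k.
(* The lowered rate applies only above [tau], hence at levels from [L] on, where upward steps of
   [bump] vanish: the full rate may be written instead. *)
have rate_bump a (r : R) : (~~ (tau < a.+1%:R) -> r = eta%:R * l) ->
    r * (bump R L a.+2 - bump R L a.+1) = eta%:R * l * (bump R L a.+2 - bump R L a.+1).
  move=> hr; have [ta|/negbTE ta] := boolP (tau < a.+1%:R); last by rewrite hr ?ta.
  have La : (L <= a.+1)%N by rewrite -(ler_nat R) (le_trans Ltau)// ltW.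
  by rewrite (bump0 R (leqW La)) (bump0 R La) subrr !mulr0.
have [y0|y0] := posnP (customers x k); have [z0|z0] := posnP (servers x k).
- rewrite (sum0 _ _ _ (C k))//; last by move=> i /eqP.
  rewrite (sum0 _ _ _ (S k))//; last by move=> i /eqP.
  rewrite ry ?rz ?y0 ?z0 -?leNgt// !mul0r subr0 !mul1r !add0r addn0 mulr0 sub0r.
  by rewrite -mulrDr ler_wpM2l//; have := bump_origin R L; lra.
- rewrite (sum1 _ _ _ (C k))//= (sum0 _ _ _ (S k))//; last by move=> i /eqP.
  rewrite ry ?y0 -?leNgt// add0n subrr mul0r addr0 mul1r mul0r add0r subr0 mul1r.
  case: (servers x k) z0 rz => // a _ rz; rewrite rate_bump// -mulrDr ler_wpM2l//=.
  by have := bump_laplacian R L a; lra.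
- rewrite (sum0 _ _ _ (C k))//; last by move=> i /eqP.
  rewrite (sum1 _ _ _ (S k))//=.
  rewrite rz ?z0 -?leNgt// addn0 !subrr !mul0r addr0 add0r subr0 !mul1r.
  case: (customers x k) y0 ry => // a _ ry; rewrite rate_bump// -mulrDr ler_wpM2l//=.
  by have := bump_laplacian R L a; lra.
- by move: z0; rewrite (goodP _ _ gx k k).
Qed.

(** The constant is [(6 * L - 4) / 12]; [0 < L] makes it nonnegative, as [regime_drift] asks of
    [g]. *)
Lemma single_link_mean (P : probability T R) (L : nat) (k : 'I_n) :
  stationary (transition_rate p M) P -> 0 < l -> (0 < eta)%N -> (0 < L)%N -> L%:R <= tau ->
  ((L%:R / 2 - 1 / 3)%:E <=
   'E_P[(fun x => (customers x k)%:R)%R] + 'E_P[(fun x => (servers x k)%:R)%R])%E.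
Proof.
move=> sP l0 eta0 L0 Lt.
have el : 0 < eta%:R * l by rewrite mulr_gt0// ltr0n.
have L1 : 1 <= L%:R :> R by rewrite ler1n.
pose g : T -> R := fun=> eta%:R * l * (6 * L%:R - 4).
pose h : T -> R := fun x => eta%:R * l * 12 * ((customers x k)%:R + (servers x k)%:R).
have g0 x : 0 <= g x by rewrite mulr_ge0 ?(ltW el)//; lra.
have c12 : 0 < eta%:R * l * 12 by rewrite mulr_gt0.
have h0 x : 0 <= h x by rewrite mulr_ge0 ?(ltW c12)// addr_ge0.
have V0 (x : T) : 0 <= bump R L (customers x k) + bump R L (servers x k).
  by rewrite addr_ge0.
have := regime_drift regime sP V0 g0 h0.
have drift x : good (fun i j => i == j) x ->
  A (fun q => bump R L (customers q k) + bump R L (servers q k)) x <= h x - g x.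
  move=> gx; apply: le_trans (single_link_drift k Lt gx) _.
  by rewrite /h /g natrD; lra.
move=> /(_ drift).
rewrite (expectation_mean P (bounded_observable_cst T _)) mean_cst.
rewrite /h (expectation_ge0Z P (ltW c12)); last by move=> x; rewrite addr_ge0.
rewrite expectation_ge0D// -lee_pdivrMl// -EFinM; apply: le_trans.
rewrite lee_fin; rewrite le_eqVlt; apply/orP; left; apply/eqP.
have e1 : eta%:R != 0 :> R by rewrite pnatr_eq0 -lt0n.
have l1 : l != 0 by rewrite gt_eqF.
by field; rewrite e1 l1.
Qed.

End SingleLinks.

(** * Lower bound for randomized matching *)

Section LinearMarket.
Variables (R : realType) (n : nat).
Variables (theta phi sc ss : 'I_n -> R) (gamma s0 : R).
Hypothesis theta_gt0 : forall j, 0 < theta j.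
Hypothesis phi_gt0 : forall i, 0 < phi i.
Hypothesis gamma_gt0 : 0 < gamma.
Hypothesis s0_gt0 : 0 < s0.
Hypothesis sc_ge : forall j, s0 <= sc j.
Hypothesis ss_ge : forall i, s0 <= ss i.

(** Marginal revenue [1 - 2 * x] and marginal cost [2 * x] meet at the rate [1 / 4]. The complete
    graph makes pooling immediate, while the diagonal optimal flow makes randomized matching ignore
    all edges between different links. *)
Definition linear_market : market R n :=
  Market (fun _ _ => true) (fun _ x => 1 - x) (fun _ x => x)
    (fun=> 1%:E) (fun=> +oo%E) sc ss.

Local Notation rate := (fun _ : 'I_n => 1 / 4 : R).
Definition diagonal_flow (i j : 'I_n) : R := (i == j)%:R / 4.

Lemma linear_demand : inverse_demand_curve 1%:E (fun x : R => 1 - x).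
Proof.
have d1 (x : R) : is_derive x 1 (fun x : R => 1 - x) (-1).
  by apply: is_derive_eq; ring.
have E1 : derive1 (fun x : R => 1 - x) = fun=> -1.
  by apply/funext => x; rewrite derive1E (@derive_val _ _ _ _ _ _ _ (d1 x)).
have E2 : derive1 (fun _ : R => -1 : R) = fun=> 0.
  by apply/funext => x; rewrite derive1_cst.
have df (x : R) : derivable (fun x : R => 1 - x) x 1 by have [] := d1 x.
have ddf (x : R) : derivable (derive1 (fun x : R => 1 - x)) x 1.
  by rewrite E1; exact: derivable_cst.
split.
- by move=> x y _ _ xy; rewrite ltrD2l ltrN2.
- by move=> x [_]; rewrite lte_fin subr_ge0 => /ltW.
- move=> x _; split => //.
  by rewrite /= E1 E2; exact: cst_continuous.
- move=> x _ /=.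
  have nd : \forall y \near x, derivable (fun x : R => 1 - x) y 1.
    by exists 1 => //= y _; exact: df.
  rewrite derive1E (@derive_val _ _ _ _ _ _ _ (product_second_derivative nd (ddf x))) E1 E2.
  by rewrite mulr0 addr0 mulrN1 oppr_lt0.
Qed.

Lemma linear_supply : inverse_supply_curve +oo%E (fun x : R => x).
Proof.
have E1 : derive1 (fun x : R => x) = fun=> 1.
  by apply/funext => x; rewrite derive1E derive_id.
have E2 : derive1 (fun _ : R => 1 : R) = fun=> 0.
  by apply/funext => x; rewrite derive1_cst.
have df (x : R) : derivable (fun x : R => x) x 1 by exact: derivable_id.
have ddf (x : R) : derivable (derive1 (fun x : R => x)) x 1.
  by rewrite E1; exact: derivable_cst.
split => //.
- by move=> x [].
- move=> x _; split => //.
  by rewrite /= E1 E2; exact: cst_continuous.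
- move=> x _ /=.
  have nd : \forall y \near x, derivable (fun x : R => x) y 1.
    by exists 1 => //= y _; exact: df.
  rewrite derive1E (@derive_val _ _ _ _ _ _ _ (product_second_derivative nd (ddf x))) E1 E2.
  by rewrite mulr0 addr0 mulr1.
Qed.

Lemma linear_market_assumptions : market_assumptions linear_market.
Proof.
split=> k /=; [exact: linear_demand|exact: linear_supply| |];
  by apply: lt_le_trans s0_gt0 _.
Qed.

Lemma sum_diagonal (k : 'I_n) : \sum_(i < n) (i == k)%:R / 4 = 1 / 4 :> R.
Proof. by rewrite (bigD1 k)//= eqxx big1 ?addr0// => i /negPf ->; rewrite mul0r. Qed.

Lemma linear_market_optimal :
  positive_fluid_solution linear_market rate rate diagonal_flow.
Proof.
split; last 2 first.
- by move=> _; lra.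
- by move=> _; lra.
split.
  split => //=.
  - split=> k; first by rewrite sum_diagonal.
    by rewrite -(sum_diagonal k); apply: eq_bigr => j _; rewrite /diagonal_flow eq_sym.
  - by move=> i j _; rewrite divr_ge0.
  - by move=> _; split; [lra|rewrite lte_fin; lra].
  - by move=> _; split; [lra|exact: ltry].
move=> lam mu chi [[lamE muE] _ _ _ _]; rewrite /fluid_profit /=.
have -> : \sum_(j < n) 1 / 4 * (1 - 1 / 4) = 3 * \sum_(j < n) 1 / 16 :> R.
  by rewrite mulr_sumr; apply: eq_bigr => j _; field.
have -> : \sum_(i < n) 1 / 4 * (1 / 4) = \sum_(i < n) 1 / 16 :> R.
  by apply: eq_bigr => i _; field.
have total : \sum_j lam j = \sum_i mu i.
  by rewrite (eq_bigr _ (fun j _ => lamE j)) exchange_big; apply: eq_bigr => i _; rewrite muE.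
(* Tangents at [1 / 4] with common slope [1 / 2]: the linear terms cancel because the total rates of
   the two sides agree. *)
have hl : \sum_j lam j * (1 - lam j) <= \sum_(j < n) (lam j / 2 + 1 / 16).
  by apply: ler_sum => j _; have := sqr_ge0 (lam j - 1 / 4); nra.
have hm : \sum_(i < n) (mu i / 2 - 1 / 16) <= \sum_i mu i * mu i.
  by apply: ler_sum => i _; have := sqr_ge0 (mu i - 1 / 4); nra.
move: hl hm; rewrite big_split sumrB /= -!mulr_suml total.
lra.
Qed.

Lemma linear_market_pooling : complete_resource_pooling (fun _ _ : 'I_n => true) rate rate.
Proof.
have h (J : {set 'I_n}) (Q : pred 'I_n) : (0 < #|J| < n)%N -> (forall i, Q i) ->
    \sum_(j in J) (1 / 4 : R) < \sum_(i < n | Q i) (1 / 4 : R).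
  move=> /andP[_ Jn] Qt; rewrite sumr_const (eq_bigl xpredT)// sumr_const card_ord.
  by rewrite -[_ *+ #|J|]mulr_natr -[_ *+ n]mulr_natr ltr_pM2l ?ltr_nat//; lra.
by split=> J /[dup] hJ /andP[/card_gt0P[j jJ] _]; apply: h => // i;
  apply/existsP; exists j; rewrite jJ.
Qed.

Let m := linear_market.
Let policy (eta : nat) := two_price_policy eta rate rate theta phi
      (eta%:R `^ (2 / 3)) (gamma * eta%:R `^ (1 / 3)).

Lemma linear_market_stationary_exists : \forall eta \near \oo,
  exists P : probability (state n) R,
  stationary (transition_rate (policy eta) (randomized_matching diagonal_flow)) P.
Proof.
exact: (randomized_stationary_exists linear_market_optimal theta_gt0 phi_gt0 gamma_gt0).
Qed.

(** Price terms are only shown to be nonnegative; the bound comes from holding costs, at least [s0]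
    per unit on each of the [n] links. *)
Lemma linear_market_loss (P : nat -> probability (state n) R) :
  (\forall eta \near \oo,
    stationary (transition_rate (policy eta) (randomized_matching diagonal_flow)) (P eta)) ->
  ((s0 * gamma / 4 * n%:R)%:E <=
    limn_einf (fun eta : nat =>
      profit_loss m eta (policy eta) (P eta) * (eta%:R `^ (1 / 3))^-1%:E))%E.
Proof.
move=> statP; apply: limn_einf_ge_near.
have opt := linear_market_optimal; have mkt := linear_market_assumptions.
have sigmaE (eta : nat) : eta%:R `^ (2 / 3) = 1 * cube_root R eta ^+ 2.
  by rewrite mul1r cube_root_sqr.
(* A tolerance below every curvature keeps the gaps nonnegative. *)
have [e e0 he] : exists2 e : R, 0 < e & forall k : 'I_n, true ->
    e <= Num.min (demand_curvature m rate k) (supply_curvature m rate k).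
  apply: finite_positive_bound => k _; rewrite lt_min.
  by rewrite (demand_curvature_gt0 mkt opt) (supply_curvature_gt0 mkt opt).
have gaps := near_gaps opt theta_gt0 phi_gt0 ltr01 sigmaE mkt e0.
have regs := near_randomized_regime opt theta_gt0 phi_gt0 gamma_gt0.
near=> eta; set s := eta%:R `^ (1 / 3).
have eta0 : (0 < eta)%N by near: eta; exact: nbhs_infty_gt.
have s_gt0 : 0 < s by exact: cube_root_gt0.
(* As [L > gamma * s - 1], the link bound is at least [gamma * s / 2 - 5 / 6], hence at least
   [gamma * s / 4] once [gamma * s >= 10 / 3]; [L > 0] follows as well. *)
have s_large : (1 + 10 / 3) / gamma < s.
  by rewrite /s -/(cube_root R eta); near: eta; exact: cube_root_near.
have used_diag : (fun i j => diagonal_flow i j != 0) = (fun i j => i == j).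
  apply/funext => i; apply/funext => j; rewrite /diagonal_flow mulf_eq0 negb_or.
  by rewrite invr_eq0 !pnatr_eq0 andbT; case: (i == j).
have reg : two_price_regime (fun i j => diagonal_flow i j != 0) diagonal_flow
    (randomized_matching diagonal_flow) eta rate rate theta phi
    (eta%:R `^ (2 / 3)) (gamma * s) by rewrite /s; near: eta.
have sP : stationary (transition_rate (policy eta) (randomized_matching diagonal_flow)) (P eta)
  by near: eta.
have [gc gs] : close_gaps m rate rate theta phi 1 (fun eta => eta%:R `^ (2 / 3)) e eta by near: eta.
have tight i j : diagonal_flow i j != 0 -> marginal_revenue m rate j = marginal_cost m rate i.
  by move=> u; apply: (marginal_tight mkt opt).
rewrite (profit_loss_formula reg sP eta0 tight (marginal_balanced mkt opt)
  (fluid_value_optimal opt)).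
have [c [c0 ct cp]] := regime_lower_price reg.
have [Ey Ez _] := total_mean (total_expectation reg sP c0 ct cp).
have ind (p : state n -> bool) : 0 <= mean (P eta) (fun x => (p x)%:R).
  by apply: mean_ge0 => //; exact: bounded_observable_indicator.
have [L [Ltau tauL]] : exists L : nat, L%:R <= gamma * s /\ gamma * s < L%:R + 1.
  exists (Num.truncn (gamma * s)); have := truncn_itv (ltW (mulr_gt0 gamma_gt0 s_gt0)).
  by rewrite natr1 => /andP[].
have gs_large : 1 + 10 / 3 < gamma * s by rewrite [gamma * s]mulrC -ltr_pdivrMr.
have L0 : (0 < L)%N by rewrite -(ltr_nat R); lra.
have link k : L%:R / 2 - 1 / 3 <= mean (P eta) (fun x => (customers x k)%:R)
                               + mean (P eta) (fun x => (servers x k)%:R).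
  rewrite used_diag in reg.
  have := @single_link_mean R n _ eta theta phi (1 / 4) _ _ diagonal_flow reg (P eta) L k sP _ eta0 L0 Ltau.
  by rewrite Ey Ez -EFinD lee_fin; apply; lra.
rewrite -EFinM lee_fin ler_pdivlMr//.
have gap_ge0 (a K g : R) : e <= K ->
    `|g - (a * 1) ^+ 2 * K * s| <= e * (a * 1) ^+ 2 * s -> 0 <= g.
  move=> eK; rewrite ler_norml => /andP[h _].
  have : e * ((a * 1) ^+ 2 * s) <= K * ((a * 1) ^+ 2 * s).
    by rewrite ler_wpM2r// mulr_ge0 ?sqr_ge0// ltW.
  lra.
have he' k : e <= demand_curvature m rate k /\ e <= supply_curvature m rate k.
  by have := he k isT; rewrite le_min => /andP.
apply: (@le_trans _ _ (s0 * \sum_(k < n) (L%:R / 2 - 1 / 3))).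
  have -> : \sum_(k < n) (L%:R / 2 - 1 / 3) = (L%:R / 2 - 1 / 3) * n%:R :> R.
    by rewrite sumr_const card_ord mulr_natr.
  have hL : gamma / 4 * s <= L%:R / 2 - 1 / 3 by lra.
  rewrite (_ : s0 * gamma / 4 * n%:R * s = s0 * (gamma / 4 * s * n%:R)); last by ring.
  by rewrite ler_wpM2l ?(ltW s0_gt0)// ler_wpM2r.
apply: (@le_trans _ _ (\sum_k sc k * mean (P eta) (fun x => (customers x k)%:R)
                     + \sum_k ss k * mean (P eta) (fun x => (servers x k)%:R))).
  rewrite mulr_sumr -big_split /=; apply: ler_sum => k _.
  have my : 0 <= mean (P eta) (fun x => (customers x k)%:R).
    by rewrite -lee_fin -Ey; apply: expectation_ge0.
  have mz : 0 <= mean (P eta) (fun x => (servers x k)%:R).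
    by rewrite -lee_fin -Ez; apply: expectation_ge0.
  apply: (@le_trans _ _ (s0 * (mean (P eta) (fun x => (customers x k)%:R)
                               + mean (P eta) (fun x => (servers x k)%:R)))).
    by rewrite ler_wpM2l ?(ltW s0_gt0).
  by rewrite mulrDr lerD// ler_wpM2r.
rewrite lerDr addr_ge0// sumr_ge0// => k _; rewrite mulr_ge0//.
  by have [h _] := he' k; exact: gap_ge0 h (gc k).
by have [_ h] := he' k; exact: gap_ge0 h (gs k).
Unshelve. all: by end_near. Qed.

End LinearMarket.

(** * Balance of the queues under max-weight *)

Section Spread.
Variables (R : realType) (n : nat).
Implicit Types y z : 'I_n -> nat.

Lemma sum_below T a : (\sum_(t < T) (t < a) = minn a T)%N.
Proof.
elim: T => [|T IH]; first by rewrite big_ord0 minn0.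
rewrite big_ord_recr /= IH; case: ltnP => aT.
  by rewrite (minn_idPr aT) addn1.
by rewrite (minn_idPl (leqW aT)) addn0.
Qed.

Definition spread y : nat := \max_(p : 'I_n * 'I_n) (y p.1 - y p.2)%N.

Lemma le_spread y j k : (y j <= y k + spread y)%N.
Proof. by rewrite -leq_subLR; exact: (@bigop.leq_bigmax _ (fun p => y p.1 - y p.2)%N (j, k)). Qed.

Lemma spread_attained y : (0 < n)%N -> exists j k, spread y = (y j - y k)%N.
Proof.
move=> n0; pose i0 := Ordinal n0.
have [|p hp] := @bigop.eq_bigmax ('I_n * 'I_n)%type (fun p => y p.1 - y p.2)%N.
  by apply/card_gt0P; exists (i0, i0).
by exists p.1, p.2.
Qed.

(* Layer cake: level by level in t, the types with more than t waiting are
   strictly dominated by their neighbourhood as long as they are neither none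
   nor all of the types. *)
Lemma pooling_slack (E : rel 'I_n) (lam mu : 'I_n -> R) (kmax : 'I_n -> R) (c : R) y :
  (0 < n)%N -> 0 <= c ->
  (forall i, 0 <= mu i) ->
  (forall J : {set 'I_n}, (0 < #|J| < n)%N ->
    \sum_(j in J) lam j + c <= \sum_(i < n | [exists j in J, E i j]) mu i) ->
  \sum_j lam j = \sum_i mu i -> (forall i, exists j, E i j) ->
  (forall i j, E i j -> (y j)%:R <= kmax i) ->
  c * (spread y)%:R <= \sum_i mu i * kmax i - \sum_j lam j * (y j)%:R.
Proof.
move=> n0 c0 mu0 crp bal deg hk.
have [jm [km spE]] := spread_attained y n0.
pose T := \max_j y j.
pose J t := [set j | (t < y j)%N]%SET.
pose nb t := [pred i | [exists j in J t, E i j]].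
have layer (a : nat) : (a <= T)%N -> a%:R = \sum_(t < T) (t < a)%N%:R :> R.
  by move=> aT; rewrite -natr_sum sum_below (minn_idPl aT).
have yT j : (y j <= T)%N by exact: bigop.leq_bigmax.
(* The longest queue next to [i] is at least as long as the number of levels at which [i] has a
   neighbour in [J t]. *)
have kmax_layer i : \sum_(t < T) (nb t i)%:R <= kmax i.
  have [j0 Ej0] := deg i.
  pose jx := [arg max_(j > j0 | E i j) y j].
  have [Ejx jxP] : E i jx /\ forall j, E i j -> (y j <= y jx)%N.
    by rewrite /jx; case: arg_maxnP.
  apply: le_trans (hk i jx Ejx); rewrite (layer _ (yT jx)); apply: ler_sum => t _.
  rewrite ler_nat; have [tj|tj] := ltnP t (y jx); first exact: leq_b1.
  rewrite leqn0 eqb0; apply/existsP => -[j /andP[]]; rewrite inE => tyj /jxP yj.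
  by move: (leq_trans tyj yj); rewrite ltnNge tj.
apply: (@le_trans _ _ (\sum_(t < T) (\sum_(i < n | nb t i) mu i - \sum_(j in J t) lam j))).
  have mono t : \sum_(j in J t) lam j <= \sum_(i < n | nb t i) mu i.
    have [J0|J0] := posnP #|J t|.
      by rewrite (cards0_eq J0) big_set0 sumr_ge0.
    have [Jn|nJ] := ltnP #|J t| n; first by have := crp (J t); rewrite J0 Jn => /(_ isT); lra.
    have JT : J t = [set: 'I_n]%SET.
      by apply/eqP; rewrite eqEcard finset.subsetT cardsT card_ord.
    rewrite JT (eq_bigl xpredT) => [|j]; last by rewrite inE.
    rewrite bal le_eqVlt; apply/orP; left; apply/eqP; apply: eq_bigl => i /=.
    by have [j Eij] := deg i; apply/esym/existsP; exists j; rewrite JT inE.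
  have [->|yjk] := posnP (spread y).
    by rewrite mulr0 sumr_ge0// => t _; rewrite subr_ge0.
  have kj : (y km < y jm)%N by rewrite -subn_gt0 -spE.
  have -> : (spread y)%:R = \sum_(t < T) ((t < y jm)%N%:R - (t < y km)%N%:R) :> R.
    by rewrite sumrB -!layer// spE natrB// ltnW.
  rewrite mulr_sumr; apply: ler_sum => t _.
  have [tj|tj] := ltnP t (y jm); last first.
    by rewrite ltnNge (leq_trans (ltnW kj))//= subrr mulr0 subr_ge0.
  have [tk|tk] := ltnP t (y km); first by rewrite subrr mulr0 subr_ge0.
  (* On the [spread y] levels from [y km] to [y jm] the set [J t] contains [jm] and misses [km], so
     pooling gains [c] on each. *)
  rewrite subr0 mulr1 lerBrDr addrC; apply: crp; apply/andP; split.
    by apply/card_gt0P; exists jm; rewrite inE.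
  rewrite -[ltnRHS]card_ord; apply: proper_card; apply/properP; split; first exact/fintype.subsetP.
  by exists km => //; rewrite inE -leqNgt.
rewrite sumrB; apply: lerB.
  have -> : \sum_(t < T) \sum_(i < n | nb t i) mu i = \sum_i mu i * \sum_(t < T) (nb t i)%:R.
    rewrite (eq_bigr (fun t : 'I_T => \sum_i mu i * (nb t i)%:R)) => [|t _].
      by rewrite exchange_big; apply: eq_bigr => i _; rewrite mulr_sumr.
    by rewrite big_mkcond; apply: eq_bigr => i _; case: (nb t i); rewrite ?mulr1 ?mulr0.
  by apply: ler_sum => i _; rewrite ler_wpM2l.
rewrite le_eqVlt; apply/orP; left; apply/eqP.
rewrite [RHS](eq_bigr (fun t : 'I_T => \sum_j lam j * (t < y j)%N%:R)) => [|t _]; last first.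
  rewrite big_mkcond; apply: eq_bigr => j _; rewrite inE.
  by case: (_ < _)%N; rewrite ?mulr1 ?mulr0.
by rewrite exchange_big; apply: eq_bigr => j _; rewrite -mulr_sumr -layer.
Qed.

End Spread.

Section Collapse.
Variables (R : realType) (n : nat).
Hypothesis n_gt0 : (0 < n)%N.
Implicit Types y z : 'I_n -> nat.

Let nR : 0 < n%:R :> R. Proof. by rewrite ltr0n. Qed.

Lemma sum_const (a : R) : \sum_(k < n) a = n%:R * a.
Proof. by rewrite sumr_const card_ord mulr_natl. Qed.

Lemma sum_le_spread y k : (\sum_j (y j)%:R : R) <= n%:R * ((y k)%:R + (spread y)%:R).
Proof.
rewrite -natrD -sum_const.
by apply: ler_sum => j _; rewrite ler_nat; exact: le_spread.
Qed.

Lemma sum_sqr_le y : (\sum_j (y j)%:R : R) ^+ 2 <= n%:R * \sum_j (y j)%:R ^+ 2.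
Proof.
have : 0 <= \sum_(j < n) \sum_(k < n) ((y j)%:R - (y k)%:R : R) ^+ 2.
  by rewrite sumr_ge0// => j _; rewrite sumr_ge0// => k _; rewrite sqr_ge0.
have -> : \sum_(j < n) \sum_(k < n) ((y j)%:R - (y k)%:R : R) ^+ 2 =
    \sum_(j < n) (n%:R * (y j)%:R ^+ 2 + \sum_k (y k)%:R ^+ 2 - 2 * (y j)%:R * \sum_k (y k)%:R).
  apply: eq_bigr => j _; rewrite mulr_sumr -sum_const.
  by rewrite -big_split -sumrB; apply: eq_bigr => k _ /=; ring.
rewrite sumrB big_split /= -mulr_sumr sum_const -mulr_suml -mulr_sumr.
nra.
Qed.

Definition above (tau : R) y : R := \sum_j (tau < (y j)%:R)%R%:R.

Lemma above_ge0 tau y : 0 <= above tau y.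
Proof. exact: sumr_ge0. Qed.

Section Half.
Variables (y z : 'I_n -> nat) (tau : R).
Hypothesis tau_ge0 : 0 <= tau.
Let X : R := \sum_j (y j)%:R - \sum_i (z i)%:R.
Hypothesis X_ge0 : 0 <= X.

Let X_le k : X <= n%:R * ((y k)%:R + (spread y)%:R).
Proof.
apply: le_trans (sum_le_spread y k); rewrite /X lerBlDr lerDl.
exact: sumr_ge0.
Qed.

(** Every customer queue is at least [X / n] minus the spread, so each one above [tau] contributes
    that much excess. *)
Lemma half_excess : X / n%:R * (above tau y - above tau z)
  <= \sum_j excess tau (y j) + \sum_i excess tau (z i) + n%:R * (spread y)%:R.
Proof.
have Xn : 0 <= X / n%:R by rewrite divr_ge0.
have h1 : X / n%:R * above tau y <= \sum_j excess tau (y j) + n%:R * (spread y)%:R.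
  rewrite mulr_sumr -sum_const -big_split /=.
  apply: ler_sum => j _; rewrite /excess; case: (_ < _)%R; last by rewrite !mulr0 add0r.
  by rewrite !mulr1 ler_pdivrMr// mulrC.
have h2 : 0 <= X / n%:R * above tau z by rewrite mulr_ge0// above_ge0.
have h3 : 0 <= \sum_i excess tau (z i).
  by rewrite sumr_ge0// => i _; rewrite mulr_ge0.
move: h1 h2 h3; rewrite mulrBr; lra.
Qed.

Hypothesis idle : forall i, (0 < z i)%N -> exists j, y j = 0%N.

(** If some customer queue is at most [tau], or some server waits and thus a customer queue is
    empty, then [X <= n * (tau + spread y)]. Otherwise all [n] customer queues exceed [tau] and no
    server queue does, which gives [- n * X]. *)
Lemma half_imbalance :
  X * (above tau z - above tau y) <= 2 * n%:R ^+ 2 * (tau + (spread y)%:R) - n%:R * X.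
Proof.
have B0 : 0 <= n%:R * (tau + (spread y)%:R) by rewrite mulr_ge0// addr_ge0.
have h1 : X * (n%:R - above tau y) <= n%:R * (n%:R * (tau + (spread y)%:R)).
  have -> : n%:R - above tau y = \sum_j (1 - (tau < (y j)%:R)%R%:R).
    by rewrite sumrB sum_const mulr1.
  rewrite mulr_sumr -sum_const.
  apply: ler_sum => j _; have [_|yt] := ltrP tau (y j)%:R; first by rewrite subrr mulr0.
  rewrite subr0 mulr1; apply: le_trans (X_le j) _.
  by rewrite ler_wpM2l// lerD2r.
have h2 : X * above tau z <= n%:R * (n%:R * (tau + (spread y)%:R)).
  rewrite mulr_sumr -sum_const.
  apply: ler_sum => i _; have [zt|_] := ltrP tau (z i)%:R; last by rewrite mulr0.
  rewrite mulr1; have [|j yj] := idle (i := i).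
    by rewrite -(ltr_nat R) (le_lt_trans tau_ge0).
  apply: le_trans (X_le j) _; rewrite yj ler_wpM2l// lerD2r//.
rewrite (_ : X * _ = X * above tau z + X * (n%:R - above tau y) - n%:R * X); last by ring.
rewrite lerD2r; apply: le_trans (lerD h2 h1) _.
by rewrite le_eqVlt; apply/orP; left; apply/eqP; ring.
Qed.

End Half.

Lemma imbalance_norm y z (tau : R) : 0 <= tau ->
  (forall i, (0 < z i)%N -> exists j, y j = 0%N) ->
  (forall j, (0 < y j)%N -> exists i, z i = 0%N) ->
  let X : R := \sum_j (y j)%:R - \sum_i (z i)%:R in
  let S : R := (spread y)%:R + (spread z)%:R in
  [/\ X / n%:R * (above tau y - above tau z)
        <= \sum_j excess tau (y j) + \sum_i excess tau (z i) + n%:R * S,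
      X * (above tau z - above tau y) <= 2 * n%:R ^+ 2 * (tau + S) - n%:R * `|X|
    & \sum_j (y j)%:R + \sum_i (z i)%:R <= `|X| + 2 * n%:R * S].
Proof.
move=> tau0 iz iy X S.
have sy : 0 <= (spread y)%:R :> R by []. have sz : 0 <= (spread z)%:R :> R by [].
have ny : n%:R * (spread y)%:R <= n%:R * S by rewrite ler_wpM2l// /S; lra.
have nz : n%:R * (spread z)%:R <= n%:R * S by rewrite ler_wpM2l// /S; lra.
have n2y : 2 * n%:R ^+ 2 * (tau + (spread y)%:R) <= 2 * n%:R ^+ 2 * (tau + S).
  by rewrite ler_wpM2l ?mulr_ge0 ?exprn_ge0// /S; lra.
have n2z : 2 * n%:R ^+ 2 * (tau + (spread z)%:R) <= 2 * n%:R ^+ 2 * (tau + S).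
  by rewrite ler_wpM2l ?mulr_ge0 ?exprn_ge0// /S; lra.
have a0 : 0 <= \sum_j (y j)%:R :> R by exact: sumr_ge0.
have b0 : 0 <= \sum_i (z i)%:R :> R by exact: sumr_ge0.
(* Either a server waits, so a customer queue is empty and the customers are few, or no server waits
   at all. *)
have small : \sum_j (y j)%:R <= n%:R * S \/ \sum_i (z i)%:R <= n%:R * S.
  have [[i zi]|noz] := pselect (exists i, (0 < z i)%N).
    have [j yj] := iz i zi; left; apply: le_trans ny.
    by apply: le_trans (sum_le_spread y j) _; rewrite yj add0r.
  right; rewrite big1 ?mulr_ge0// ?addr_ge0// => i _.
  by have [->//|zi] := posnP (z i); exfalso; apply: noz; exists i.
have [X0|X0] := lerP 0 X.
  rewrite (ger0_norm X0); split.
  - by apply: le_trans (half_excess tau X0) _; lra.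
  - by apply: le_trans (half_imbalance tau0 iz) _; rewrite lerD2r.
  - by rewrite /X; case: small; move: X0; rewrite /X; lra.
rewrite (ltr0_norm X0); have X0' : 0 <= \sum_i (z i)%:R - \sum_j (y j)%:R :> R.
  by move: X0; rewrite /X; lra.
have e : - X = \sum_i (z i)%:R - \sum_j (y j)%:R by rewrite /X opprB.
split.
- have := half_excess tau X0'; rewrite -e => h.
  rewrite (_ : X / n%:R * _ = - X / n%:R * (above tau z - above tau y)); last by ring.
  by apply: le_trans h _; lra.
- have := half_imbalance tau0 iy; rewrite -e => h.
  rewrite (_ : X * _ = - X * (above tau y - above tau z)); last by ring.
  by apply: le_trans h _; rewrite lerD2r.
- by rewrite e; case: small; move: X0'; lra.
Qed.

End Collapse.

(** * Mean total queue length under max-weight *)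

Section MaxWeight.
Variables (R : realType) (n : nat) (E : rel 'I_n) (chi : 'I_n -> 'I_n -> R).
Variables (M : matching R n) (eta : nat) (lam mu : 'I_n -> R) (sigma tau c : R).
Hypothesis n_gt0 : (0 < n)%N.
Hypothesis regime : two_price_regime E chi M eta lam mu (fun=> 1) (fun=> 1) sigma tau.
Hypothesis maxw : max_weight_matching E M.
Hypothesis lam_ge0 : forall j, 0 <= lam j.
Hypothesis mu_ge0 : forall i, 0 <= mu i.
Hypothesis c_gt0 : 0 < c.
Hypothesis pool_c : forall J : {set 'I_n}, (0 < #|J| < n)%N ->
  \sum_(j in J) lam j + c <= \sum_(i < n | [exists j in J, E i j]) mu i.
Hypothesis pool_s : forall I : {set 'I_n}, (0 < #|I| < n)%N ->
  \sum_(i in I) mu i + c <= \sum_(j < n | [exists i in I, E i j]) lam j.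
Hypothesis balanced : \sum_j lam j = \sum_i mu i.
Hypothesis deg_s : forall i, exists j, E i j.
Hypothesis deg_c : forall j, exists i, E i j.
Hypothesis small_sigma : 2 * sigma * n%:R <= eta%:R * c.
Local Notation T := (state n).
Let p := two_price_policy eta lam mu (fun=> 1) (fun=> 1) sigma tau.
Local Notation A := (generator (event_intensity p M) (@event_target n)).
Let tau0 : 0 <= tau := regime_tau regime.
Let sigma0 : 0 < sigma := regime_sigma regime.

Definition imbalance (x : T) : R := \sum_j (customers x j)%:R - \sum_i (servers x i)%:R.
Definition dispersion (x : T) : R := (spread (customers x))%:R + (spread (servers x))%:R.

(** [pooling_slack] for each side, the second time on the transposed graph. *)
Lemma dispersion_slack x :
  c * dispersion x <= customer_slack M lam mu x + server_slack M lam mu x.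
Proof.
have [S C] := maxw x; rewrite /dispersion mulrDr; apply: lerD.
  apply: (pooling_slack n_gt0 (ltW c_gt0) mu_ge0 pool_c balanced deg_s) => i j.
  exact: (longest_queue_max (S i)).
apply: (pooling_slack (E := fun j i => E i j) n_gt0 (ltW c_gt0) lam_ge0 pool_s (esym balanced) deg_c) => j i.
exact: (longest_queue_max (C j)).
Qed.

(** A customer arrival moves the imbalance up by one and a server arrival down by one, matched or
    not: the matching does not enter. *)
Lemma imbalance_generator x : A (fun q => imbalance q ^+ 2) x =
  2 * imbalance x * (\sum_j customer_rate p x j - \sum_i server_rate p x i)
  + (\sum_j customer_rate p x j + \sum_i server_rate p x i).
Proof.
rewrite generatorE; have [S C] := regime_greedy regime x.
have inc (y : {ffun 'I_n -> nat}) k : \sum_j (increase y k j)%:R = \sum_j (y j)%:R + 1 :> R.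
  have := sum_increase (fun _ a => a%:R : R) y k; rewrite -natr1; lra.
have dec (y : {ffun 'I_n -> nat}) k : (0 < y k)%N ->
    \sum_j (decrease y k j)%:R = \sum_j (y j)%:R - 1 :> R.
  move=> yk; have := sum_decrease (fun _ a => a%:R : R) y k.
  by case: (y k) yk => // a _ /=; rewrite -natr1; lra.
have ec j : \sum_(i < n) customer_match M x i j *
      (imbalance (server_leaves x i) ^+ 2 - imbalance x ^+ 2)
     + (1 - \sum_(i < n) customer_match M x i j) *
      (imbalance (customer_joins x j) ^+ 2 - imbalance x ^+ 2) = 2 * imbalance x + 1.
  rewrite (eq_bigr (fun i => customer_match M x i j * (2 * imbalance x + 1))).
    by rewrite -mulr_suml /imbalance /= inc; ring.
  move=> i _; have [_ wc _] := C j.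
  have [->|/wc[_ zi]] := eqVneq (customer_match M x i j) 0; first by rewrite !mul0r.
  by rewrite /imbalance /= dec//; ring.
have es i : \sum_(j < n) server_match M x i j *
      (imbalance (customer_leaves x j) ^+ 2 - imbalance x ^+ 2)
     + (1 - \sum_(j < n) server_match M x i j) *
      (imbalance (server_joins x i) ^+ 2 - imbalance x ^+ 2) = 1 - 2 * imbalance x.
  rewrite (eq_bigr (fun j => server_match M x i j * (1 - 2 * imbalance x))).
    by rewrite -mulr_suml /imbalance /= inc; ring.
  move=> j _; have [_ wc _] := S i.
  have [->|/wc[_ yj]] := eqVneq (server_match M x i j) 0; first by rewrite !mul0r.
  by rewrite /imbalance /= dec//; ring.
rewrite (eq_bigr _ (fun j _ => congr1 _ (ec j))) (eq_bigr _ (fun i _ => congr1 _ (es i))).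
by rewrite -!mulr_suml; ring.
Qed.

Let Lam := \sum_j lam j + \sum_i mu i.

Lemma rates_sum x :
  \sum_j customer_rate p x j = eta%:R * \sum_j lam j - sigma * above tau (customers x) /\
  \sum_i server_rate p x i = eta%:R * \sum_i mu i - sigma * above tau (servers x).
Proof.
by split; rewrite !mulr_sumr -sumrB; apply: eq_bigr => k _ /=; rewrite mul1r.
Qed.

Lemma good_idle x : good E x ->
  (forall i, (0 < servers x i)%N -> exists j, customers x j = 0%N) /\
  (forall j, (0 < customers x j)%N -> exists i, servers x i = 0%N).
Proof.
move=> gx; split=> [i zi|j yj].
  by have [j Eij] := deg_s i; exists j; exact: (good_customers gx Eij zi).
by have [i Eij] := deg_c j; exists i; exact: (goodP _ _ gx i j Eij yj).
Qed.

(* Zero exactly when one side of the market is empty and the queues of the other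
   side are all equal. *)
Let perp (x : T) : R := quadratic R x - imbalance x ^+ 2 / n%:R.

Let nR : 0 < n%:R :> R. Proof. by rewrite ltr0n. Qed.

Lemma perp_ge0 x : 0 <= perp x.
Proof.
rewrite subr_ge0 ler_pdivrMr// mulrC /quadratic mulrDr.
have hy := sum_sqr_le R (customers x); have hz := sum_sqr_le R (servers x).
apply: le_trans (lerD hy hz); rewrite /imbalance.
have : 0 <= (\sum_j (customers x j)%:R) * (\sum_i (servers x i)%:R) :> R.
  by rewrite mulr_ge0// sumr_ge0.
by move=> ?; nra.
Qed.

(** The price terms of the two drifts cancel up to [2 * sigma * n * dispersion], by the first bound
    of [imbalance_norm]. The slack supplies [- 2 * eta * c * dispersion], half of which pays for
    this by [small_sigma]. *)
Lemma perp_drift x : good E x -> A perp x <= eta%:R * Lam - eta%:R * c * dispersion x.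
Proof.
move=> gx.
have -> : A perp x = A (@quadratic R n) x - A (fun q => imbalance q ^+ 2) x / n%:R.
  rewrite /generator mulr_suml -sumrB; apply: eq_bigr => e _; rewrite /perp; field.
  by rewrite gt_eqF.
have [iz iy] := good_idle gx.
have [h1 _ _] := imbalance_norm n_gt0 tau0 iz iy.
have hq := quadratic_drift regime gx.
have hd := dispersion_slack x.
have [rc rs] := rates_sum x.
have r0 : 0 <= \sum_j customer_rate p x j + \sum_i server_rate p x i.
  by rewrite addr_ge0// sumr_ge0// => k _; rewrite ltW ?(customer_rate_gt0 regime) ?(server_rate_gt0 regime).
have hX : - (2 * sigma * (imbalance x / n%:R * (above tau (customers x) - above tau (servers x))))
    <= A (fun q => imbalance q ^+ 2) x / n%:R.
  rewrite imbalance_generator rc rs balanced ler_pdivlMr//.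
  rewrite (_ : - _ * n%:R = 2 * imbalance x *
    (eta%:R * \sum_i mu i - sigma * above tau (customers x) -
     (eta%:R * \sum_i mu i - sigma * above tau (servers x)))).
    by rewrite lerDl; move: r0; rewrite rc rs balanced.
  by field; rewrite gt_eqF.
have D0 : 0 <= dispersion x by rewrite addr_ge0.
have hs : sigma * (imbalance x / n%:R * (above tau (customers x) - above tau (servers x)))
  <= sigma * (\sum_j excess tau (customers x j) + \sum_i excess tau (servers x i) + n%:R * dispersion x).
  by rewrite ler_wpM2l ?(ltW sigma0).
have hsd : 2 * sigma * n%:R * dispersion x <= eta%:R * c * dispersion x by rewrite ler_wpM2r.
have hed : eta%:R * (c * dispersion x) <= eta%:R * (customer_slack M lam mu x + server_slack M lam mu x).
  by rewrite ler_wpM2l.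
have e1 (q : {ffun 'I_n -> nat}) : \sum_j 1 * excess tau (q j) = \sum_j excess tau (q j).
  by apply: eq_bigr => j _; rewrite mul1r.
move: hq hX hs hsd hed; rewrite !e1 -/Lam; lra.
Qed.

Lemma imbalance_drift x : good E x ->
  A (fun q => imbalance q ^+ 2) x <=
  (eta%:R * Lam + 4 * sigma * n%:R ^+ 2 * tau + 4 * sigma * n%:R ^+ 2 * dispersion x)
  - 2 * sigma * n%:R * `|imbalance x|.
Proof.
move=> gx; have [iz iy] := good_idle gx.
have [_ h2 _] := imbalance_norm n_gt0 tau0 iz iy.
have [rc rs] := rates_sum x.
rewrite imbalance_generator rc rs balanced.
have ay := above_ge0 tau (customers x); have az := above_ge0 tau (servers x).
have say : 0 <= sigma * above tau (customers x) by rewrite mulr_ge0 ?(ltW sigma0).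
have saz : 0 <= sigma * above tau (servers x) by rewrite mulr_ge0 ?(ltW sigma0).
have hs : sigma * (imbalance x * (above tau (servers x) - above tau (customers x))) <=
   sigma * (2 * n%:R ^+ 2 * (tau + dispersion x) - n%:R * `|imbalance x|).
  by rewrite ler_wpM2l ?(ltW sigma0).
rewrite /Lam balanced; move: hs; lra.
Qed.

Variable P : probability T R.
Hypothesis statP : stationary (transition_rate p M) P.

Let Lam0 : 0 <= Lam.
Proof. by rewrite addr_ge0// sumr_ge0. Qed.

(** Two drifts in a row: [perp] bounds the mean dispersion by [Lam / c], free of [eta], and this
    feeds the drift of the squared imbalance. Of [4 * n * Lam / c], one half comes from that drift
    and one half from passing from the imbalance to the total. *)
Lemma max_weight_total : (0 < eta)%N ->
  ('E_P[(fun x => (total x)%:R)%R] <=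
   (eta%:R * Lam / (2 * sigma * n%:R) + 2 * n%:R * tau + 4 * n%:R * Lam / c)%:E)%E.
Proof.
move=> eta0; have etaR : 0 < eta%:R :> R by rewrite ltr0n.
have D0 x : 0 <= dispersion x by rewrite addr_ge0.
have ED : ('E_P[dispersion] <= (Lam / c)%:E)%E.
  have ec : 0 < eta%:R * c by rewrite mulr_gt0.
  have b0 : 0 <= eta%:R * Lam by rewrite mulr_ge0.
  have g0 x : 0 <= eta%:R * c * dispersion x by rewrite mulr_ge0// ltW.
  have := regime_drift regime statP perp_ge0 g0 (fun=> b0) perp_drift.
  rewrite (expectation_mean P (bounded_observable_cst T _)) mean_cst.
  rewrite (expectation_ge0Z P (ltW ec) D0) -lee_pdivlMl// -EFinM => h.
  apply: le_trans h _; rewrite lee_fin le_eqVlt; apply/orP; left; apply/eqP.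
  by field; rewrite !gt_eqF.
have sn : 0 < 2 * sigma * n%:R by rewrite !mulr_gt0.
have k0 : 0 <= 4 * sigma * n%:R ^+ 2 by rewrite !mulr_ge0 ?exprn_ge0// ltW.
have b0 : 0 <= eta%:R * Lam + 4 * sigma * n%:R ^+ 2 * tau.
  by rewrite addr_ge0// mulr_ge0.
have EX : ('E_P[(fun x => `|imbalance x|)%R] <=
   (eta%:R * Lam / (2 * sigma * n%:R) + 2 * n%:R * tau + 2 * n%:R * Lam / c)%:E)%E.
  have h0 x : 0 <= eta%:R * Lam + 4 * sigma * n%:R ^+ 2 * tau
                   + 4 * sigma * n%:R ^+ 2 * dispersion x.
    by rewrite addr_ge0// mulr_ge0.
  have g0 x : 0 <= 2 * sigma * n%:R * `|imbalance x| by rewrite mulr_ge0// ltW.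
  have := regime_drift regime statP (fun x => sqr_ge0 (imbalance x)) g0 h0 imbalance_drift.
  have kD0 x : 0 <= 4 * sigma * n%:R ^+ 2 * dispersion x by rewrite mulr_ge0.
  rewrite (expectation_ge0D P (fun=> b0) kD0) (expectation_ge0Z P k0 D0).
  rewrite (expectation_mean P (bounded_observable_cst T _)) mean_cst.
  rewrite (expectation_ge0Z P (ltW sn) (fun x => normr_ge0 (imbalance x))).
  rewrite -lee_pdivlMl// => h; apply: le_trans h _.
  have [DE Dle] := expectation_le_mean D0 ED.
  rewrite DE -EFinM lee_fin.
  rewrite ler_pdivrMl//.
  have := ler_wpM2l k0 Dle.
  have -> : 2 * sigma * n%:R * (eta%:R * Lam / (2 * sigma * n%:R) + 2 * n%:R * tau + 2 * n%:R * Lam / c)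
    = eta%:R * Lam + 4 * sigma * n%:R ^+ 2 * tau + 4 * sigma * n%:R ^+ 2 * (Lam / c).
    by field; rewrite !gt_eqF.
  lra.
have [DE Dle] := expectation_le_mean D0 ED.
have n20 : 0 <= 2 * n%:R :> R by rewrite mulr_ge0.
apply: (@le_trans _ _ 'E_P[(fun x => `|imbalance x| + 2 * n%:R * dispersion x)%R]%E).
  apply: expectation_le => //.
    by move=> x; rewrite addr_ge0// mulr_ge0.
  exists [set x | ~~ good E x]; split => //; first exact: bad_null regime P statP.
  move=> x /= h; apply/negP => gx; apply: h.
  have [iz iy] := good_idle gx; have [_ _ h3] := imbalance_norm n_gt0 tau0 iz iy.
  by apply: le_trans h3; rewrite /total natrD !natr_sum.
have nD0 x : 0 <= 2 * n%:R * dispersion x by rewrite mulr_ge0.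
rewrite (expectation_ge0D P (fun x => normr_ge0 (imbalance x)) nD0).
rewrite (expectation_ge0Z P n20 D0) DE -EFinM.
apply: (le_trans (leeD EX (lexx _))); rewrite -EFinD lee_fin.
have := ler_wpM2l n20 Dle.
have -> : 4 * n%:R * Lam / c = 2 * n%:R * Lam / c + 2 * n%:R * (Lam / c) by field; rewrite gt_eqF.
lra.
Qed.

End MaxWeight.

Lemma customer_cost_le_max (R : realType) (n : nat) (m : market R n) j :
  customer_cost m j <= max_cost m.
Proof. by rewrite le_max (le_bigmax _ (customer_cost m) j) orbT. Qed.

Lemma server_cost_le_max (R : realType) (n : nat) (m : market R n) i :
  server_cost m i <= max_cost m.
Proof. by rewrite le_max (le_bigmax _ (server_cost m) i). Qed.

Lemma max_cost_ge0 (R : realType) (n : nat) (m : market R n) : 0 <= max_cost m.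
Proof. by rewrite le_max bigmax_ge_id. Qed.

Lemma max_weight_boundE (R : realType) (n : nat) (m : market R n) (lam mu : 'I_n -> R) :
  max_weight_bound m lam mu =
  (\sum_i supply_curvature m mu i + \sum_j demand_curvature m lam j
   + max_cost m / 2 * (\sum_j lam j + \sum_i mu i)) * n%:R `^ (- (2 / 3)).
Proof. by rewrite /max_weight_bound /demand_curvature sumrN. Qed.

(** * Asymptotic loss under max-weight *)

Section MaxWeightLoss.
Variables (R : realType) (n : nat) (m : market R n).
Variables (lam mu : 'I_n -> R) (chi : 'I_n -> 'I_n -> R).
Variables (M : nat -> matching R n) (tau : nat -> R).
Hypothesis n_gt0 : (0 < n)%N.
Hypothesis mkt : market_assumptions m.
Hypothesis opt : positive_fluid_solution m lam mu chi.
Hypothesis crp : complete_resource_pooling (compatible m) lam mu.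
Hypothesis maxw : forall eta, max_weight_matching (compatible m) (M eta).
Hypothesis tau_ge0 : forall eta, 0 <= tau eta.
Hypothesis tau_small : (fun eta : nat => tau eta / eta%:R `^ (1 / 3)) @ \oo --> (0 : R).

Let nu : R := n%:R `^ (- (1 / 3)).
Let sigma (eta : nat) : R := nu * eta%:R `^ (2 / 3).
Let policy (eta : nat) :=
  two_price_policy eta lam mu (fun=> 1) (fun=> 1) (sigma eta) (tau eta).

Let sigmaE eta : sigma eta = nu * cube_root R eta ^+ 2.
Proof. by rewrite /sigma cube_root_sqr. Qed.

Let nu_gt0 : 0 < nu. Proof. by rewrite powR_gt0// ltr0n. Qed.

Let nu_sqr : nu ^+ 2 = n%:R `^ (- (2 / 3)).
Proof. by rewrite -powR_mulrn ?powR_ge0// -powRrM; congr powR; field. Qed.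

(** This turns [eta * Lam / (2 * sigma * n)] into [s * nu ^ 2 * Lam / 2], so holding costs carry the
    same factor [nu ^ 2] as the price terms. *)
Let nu_cube : n%:R * nu ^+ 3 = 1.
Proof.
rewrite -powR_mulrn ?powR_ge0// -powRrM mulNr divfK// powR_inv1// mulfV//.
by rewrite pnatr_eq0 -lt0n.
Qed.

Lemma server_neighbour i : exists j, compatible m i j.
Proof.
have [[[[_ muE] _ _ _ _] _] _ mu0] := opt.
have [j chi_ij|h] := pickP (fun j => chi i j != 0).
  by exists j; exact: (chi_compatible opt chi_ij).
have := mu0 i; rewrite muE big1 ?ltxx// => j _.
by have /negbFE/eqP := h j.
Qed.

Lemma customer_neighbour j : exists i, compatible m i j.
Proof.
have [[[[lamE _] _ _ _ _] _] lam0 _] := opt.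
have [i chi_ij|h] := pickP (fun i => chi i j != 0).
  by exists i; exact: (chi_compatible opt chi_ij).
have := lam0 j; rewrite lamE big1 ?ltxx// => i _.
by have /negbFE/eqP := h i.
Qed.

Lemma fluid_balanced : \sum_j lam j = \sum_i mu i.
Proof.
have [[[[lamE muE] _ _ _ _] _] _ _] := opt.
by rewrite (eq_bigr _ (fun j _ => lamE j)) exchange_big; apply: eq_bigr => i _; rewrite muE.
Qed.

Lemma pooling_gap : exists c, [/\ 0 < c,
  forall J : {set 'I_n}, (0 < #|J| < n)%N ->
    \sum_(j in J) lam j + c <= \sum_(i < n | [exists j in J, compatible m i j]) mu i
  & forall I : {set 'I_n}, (0 < #|I| < n)%N ->
    \sum_(i in I) mu i + c <= \sum_(j < n | [exists i in I, compatible m i j]) lam j].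
Proof.
have [crp_c crp_s] := crp.
have [c1 c10 h1] := finite_positive_bound
  (p := fun J : {set 'I_n} => (0 < #|J| < n)%N)
  (f := fun J => \sum_(i < n | [exists j in J, compatible m i j]) mu i - \sum_(j in J) lam j)
  (fun J hJ => (eq_ind_r is_true (crp_c J hJ) (subr_gt0 _ _))).
have [c2 c20 h2] := finite_positive_bound
  (p := fun I : {set 'I_n} => (0 < #|I| < n)%N)
  (f := fun I => \sum_(j < n | [exists i in I, compatible m i j]) lam j - \sum_(i in I) mu i)
  (fun I hI => (eq_ind_r is_true (crp_s I hI) (subr_gt0 _ _))).
exists (Num.min c1 c2); split=> [|J hJ|I hI]; first by rewrite lt_min c10.
  by rewrite -lerBrDl; apply: le_trans (h1 J hJ); rewrite ge_min lexx.
by rewrite -lerBrDl; apply: le_trans (h2 I hI); rewrite ge_min lexx orbT.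
Qed.

Lemma near_max_weight_regime : \forall eta \near \oo,
  two_price_regime (compatible m) chi (M eta) eta lam mu (fun=> 1) (fun=> 1)
    (sigma eta) (tau eta).
Proof.
have [[[[lamE muE] _ _ _ _] _] lam0 mu0] := opt.
apply: (@near_regime R n m lam mu chi opt (fun=> 1) (fun=> 1) nu sigma tau
  (fun=> ltr01) (fun=> ltr01) nu_gt0 sigmaE tau_ge0 (compatible m) M).
- move=> eta q; have [S C] := maxw eta q.
  by split=> k; exact: longest_queue_service_rule.
- move=> eta x i; have [S _] := maxw eta x; rewrite muE.
  apply: (longest_queue_weight (S i)) => j; first exact: (chi_ge0 opt).
  exact: (chi_compatible opt).
- move=> eta x j; have [_ C] := maxw eta x; rewrite lamE.
  apply: (longest_queue_weight (C j)) => i; first exact: (chi_ge0 opt).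
  exact: (chi_compatible opt).
Qed.

Lemma max_weight_stationary_exists : \forall eta \near \oo,
  exists P : probability (state n) R, stationary (transition_rate (policy eta) (M eta)) P.
Proof.
by apply: filterS near_max_weight_regime => eta reg; exact: regime_stationary_exists reg.
Qed.

Lemma max_weight_loss (P : nat -> probability (state n) R) :
  (\forall eta \near \oo, stationary (transition_rate (policy eta) (M eta)) (P eta)) ->
  (limn_esup (fun eta : nat =>
     profit_loss m eta (policy eta) (P eta) * (eta%:R `^ (1 / 3))^-1%:E)
   <= (max_weight_bound m lam mu)%:E)%E.
Proof.
move=> statP; have [_ _ sc0 ss0] := mkt; have [_ lam0 mu0] := opt.
have [c [c0 pool_c pool_s]] := pooling_gap.
have nR : 0 < n%:R :> R by rewrite ltr0n.
pose Lam := \sum_j lam j + \sum_i mu i.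
pose mc := max_cost m.
have mc0 : 0 <= mc by exact: max_cost_ge0.
have Lam0 : 0 <= Lam by rewrite addr_ge0// sumr_ge0// => k _; exact: ltW.
apply/lee_addgt0Pr => e e0; rewrite -EFinD; apply: limn_esup_le_near.
(* The error [e * s] is split into thirds; the [2 * n] gap errors [nu ^ 2 * e1 * s] make up the
   first. *)
pose e1 := e / (6 * n%:R * nu ^+ 2).
have nu20 : 0 < nu ^+ 2 by rewrite exprn_gt0.
have e10 : 0 < e1 by rewrite divr_gt0// !mulr_gt0.
(* Second third: the term [2 * n * tau] of the mean total, weighted by [mc]. The added 1 makes the
   denominator positive from [0 <= mc] alone. *)
pose e2 := e / (3 * (2 * n%:R * mc + 1)).
have k0 : 0 < 2 * n%:R * mc + 1 by rewrite ltr_wpDl// !mulr_ge0// ltW.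
have e20 : 0 < e2 by rewrite divr_gt0// mulr_gt0.
have gaps := near_gaps opt (fun=> ltr01) (fun=> ltr01) nu_gt0 sigmaE mkt e10.
have regs := near_max_weight_regime.
have tau_e2 : \forall eta \near \oo, tau eta / eta%:R `^ (1 / 3) <= e2.
  have /cvgrPdist_le /(_ e2 e20) := tau_small.
  by apply: filterS => eta; rewrite sub0r normrN => /(le_trans (ler_norm _)).
near=> eta; set s := eta%:R `^ (1 / 3).
have eta0 : (0 < eta)%N by near: eta; exact: nbhs_infty_gt.
have s0 : 0 < s by exact: cube_root_gt0.
have s_small : 2 * nu * n%:R / c < s.
  by rewrite /s -/(cube_root R eta); near: eta; exact: cube_root_near.
(* Last third: the part of the mean total that does not grow with [eta]. *)
have s_large : mc * (4 * n%:R * Lam / c) * 3 / e < s.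
  by rewrite /s -/(cube_root R eta); near: eta; exact: cube_root_near.
have ts : tau eta / s <= e2 by rewrite /s; near: eta.
have reg : two_price_regime (compatible m) chi (M eta) eta lam mu (fun=> 1) (fun=> 1)
    (sigma eta) (tau eta) by near: eta.
have sP : stationary (transition_rate (policy eta) (M eta)) (P eta) by near: eta.
have [gc gs] : close_gaps m lam mu (fun=> 1) (fun=> 1) nu sigma e1 eta by near: eta.
have tight i j : compatible m i j -> marginal_revenue m lam j = marginal_cost m mu i.
  by move=> _; exact: (pooled_marginals mkt opt crp).
rewrite (profit_loss_formula reg sP eta0 tight (marginal_balanced mkt opt)
  (fluid_value_optimal opt)).
have sigma_s : sigma eta = nu * s ^+ 2 by rewrite sigmaE.
have eta_s : eta%:R = s ^+ 3 :> R by rewrite /s -/(cube_root R eta) cube_rootK.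
have small : 2 * sigma eta * n%:R <= eta%:R * c.
  rewrite sigma_s eta_s (_ : 2 * _ * _ = 2 * nu * n%:R * s ^+ 2); last by ring.
  rewrite (_ : s ^+ 3 * c = s * c * s ^+ 2); last by ring.
  by rewrite ler_pM2r ?exprn_gt0// -ler_pdivrMr// ltW.
have tot := max_weight_total n_gt0 reg (maxw eta) (fun j => ltW (lam0 j)) (fun i => ltW (mu0 i))
  c0 pool_c pool_s fluid_balanced server_neighbour customer_neighbour small sP eta0.
have [Ey Ez totB] := total_mean tot.
have nE : n%:R = (nu ^+ 3)^-1 :> R.
  have n3 : nu ^+ 3 != 0 by rewrite gt_eqF ?exprn_gt0.
  by apply: (mulIf n3); rewrite nu_cube mulVf.
have fracE : eta%:R * (\sum_j lam j + \sum_i mu i) / (2 * sigma eta * n%:R) = s * nu ^+ 2 * Lam / 2.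
  rewrite sigma_s eta_s nE -/Lam; field.
  by rewrite !gt_eqF.
rewrite fracE -/Lam in totB.
have ind (p : state n -> bool) : 0 <= mean (P eta) (fun x => (p x)%:R) <= 1.
  have bi : bounded_observable (fun x : state n => (p x)%:R : R) by exact: bounded_observable_indicator.
  rewrite mean_ge0//= -[leRHS](mean_cst (P eta) 1); apply: le_mean => //.
    exact: bounded_observable_cst.
  by move=> x; case: (p x).
have term (K g M0 : R) : 0 < K -> `|g - (1 * nu) ^+ 2 * K * s| <= e1 * (1 * nu) ^+ 2 * s ->
    0 <= M0 <= 1 -> g * M0 <= nu ^+ 2 * s * (K + e1).
  rewrite mul1r => K0; rewrite ler_norml => /andP[_ hg] /andP[M00 M01].
  have b0 : 0 <= nu ^+ 2 * s * (K + e1) by rewrite !mulr_ge0// ltW// addr_gt0.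
  apply: (@le_trans _ _ (nu ^+ 2 * s * (K + e1) * M0)); last by rewrite ler_piMr.
  by rewrite ler_wpM2r//; lra.
have sum_term (K g M0 : 'I_n -> R) : (forall k, 0 < K k) ->
    (forall k, `|g k - (1 * nu) ^+ 2 * K k * s| <= e1 * (1 * nu) ^+ 2 * s) ->
    (forall k, 0 <= M0 k <= 1) ->
    \sum_k g k * M0 k <= nu ^+ 2 * s * (\sum_k K k + n%:R * e1).
  move=> K0 hg hM; have -> : n%:R * e1 = \sum_(k < n) e1.
    by rewrite sumr_const card_ord mulr_natl.
  by rewrite -big_split mulr_sumr; apply: ler_sum => k _; exact: term.
have t1 := sum_term _ _ _ (demand_curvature_gt0 mkt opt) gc
  (fun j => ind (fun x => (tau eta < (customers x j)%:R)%R)).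
have t2 := sum_term _ _ _ (supply_curvature_gt0 mkt opt) gs
  (fun i => ind (fun x => (tau eta < (servers x i)%:R)%R)).
have cy : \sum_j customer_cost m j * mean (P eta) (fun x => (customers x j)%:R) <=
    mc * \sum_j mean (P eta) (fun x => (customers x j)%:R).
  rewrite mulr_sumr; apply: ler_sum => j _; rewrite ler_wpM2r ?customer_cost_le_max//.
  by rewrite -lee_fin -Ey; apply: expectation_ge0.
have cz : \sum_i server_cost m i * mean (P eta) (fun x => (servers x i)%:R) <=
    mc * \sum_i mean (P eta) (fun x => (servers x i)%:R).
  rewrite mulr_sumr; apply: ler_sum => i _; rewrite ler_wpM2r ?server_cost_le_max//.
  by rewrite -lee_fin -Ez; apply: expectation_ge0.
have ct := ler_wpM2l mc0 totB.
have he1 : 2 * n%:R * e1 * nu ^+ 2 = e / 3.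
  by rewrite /e1; field; rewrite !gt_eqF.
have he2 : mc * (2 * n%:R * tau eta) <= e / 3 * s.
  have h1 : tau eta <= e2 * s by rewrite -ler_pdivrMr.
  have h2 : e2 * (2 * n%:R * mc + 1) = e / 3.
    by rewrite /e2; field; rewrite gt_eqF.
  have h3 : mc * (2 * n%:R) * tau eta <= mc * (2 * n%:R) * (e2 * s).
    by rewrite ler_wpM2l// mulr_ge0// mulr_ge0// ltW.
  have h4 : 0 <= e2 * s by rewrite mulr_ge0 ?(ltW e20) ?(ltW s0).
  rewrite -h2; move: h3 h4; lra.
have he3 : mc * (4 * n%:R * Lam / c) <= e / 3 * s.
  by move: s_large; rewrite ltr_pdivrMr//; lra.
rewrite -EFinM lee_fin ler_pdivrMr// max_weight_boundE -nu_sqr -/mc -/Lam.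
have he1s : 2 * n%:R * e1 * nu ^+ 2 * s = e / 3 * s by rewrite he1.
move: t1 t2 cy cz ct he1s he2 he3.
lra.
Unshelve. all: by end_near. Qed.

End MaxWeightLoss.

(** Each of the [2 * n] curvature terms is at most [K ^ 2 / 2 + K] and the cost term at most
    [n * K ^ 2], in all [n * (2 * K ^ 2 + 2 * K)]; and [n * n ^ (- 2 / 3) = n ^ (1 / 3)]. *)
Lemma max_weight_bound_growth (R : realType) (K : R) (n : nat) (m : market R n)
    (lam mu : 'I_n -> R) (chi : 'I_n -> 'I_n -> R) :
  (0 < n)%N -> market_assumptions m -> positive_fluid_solution m lam mu chi ->
  data_bounded_by m lam mu K ->
  `|max_weight_bound m lam mu| <= (2 * K ^+ 2 + 2 * K) * n%:R `^ (1 / 3).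
Proof.
move=> n0 mkt [_ lam0 mu0] [hc hs].
have nR : 0 < n%:R :> R by rewrite ltr0n.
have K0 : 0 <= K by have [_ h _ _] := hc (Ordinal n0); exact: le_trans h.
have sum_le (f : 'I_n -> R) (b : R) : (forall k, f k <= b) -> \sum_k f k <= n%:R * b.
  move=> fb; rewrite mulr_natl -[X in _ *+ X]card_ord -sumr_const.
  by apply: ler_sum => k _.
have term (l d dd : R) : 0 < l -> l <= K -> `|d| <= K -> `|dd| <= K ->
    `|l * dd / 2 + d| <= K ^+ 2 / 2 + K.
  move=> l0 lK dK ddK; rewrite (le_trans (ler_normD _ _))// lerD//.
  rewrite !normrM (gtr0_norm l0) [`|2^-1|]gtr0_norm// ler_pM2r// expr2.
  by rewrite ler_pM// ltW.
have norm_sum (l d dd : 'I_n -> R) :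
    (forall k, `|l k * dd k / 2 + d k| <= K ^+ 2 / 2 + K) ->
    `|\sum_k (l k * dd k / 2 + d k)| <= n%:R * (K ^+ 2 / 2 + K).
  by move=> h; apply: le_trans (ler_norm_sum _ _ _) _; exact: sum_le.
have b1 := norm_sum mu (fun i => derive1 (supply m i) (mu i))
  (fun i => derive1n 2 (supply m i) (mu i))
  (fun i => let: And4 h1 h2 h3 _ := hs i in term _ _ _ (mu0 i) h1 h2 h3).
have b2 := norm_sum lam (fun j => derive1 (demand m j) (lam j))
  (fun j => derive1n 2 (demand m j) (lam j))
  (fun j => let: And4 h1 h2 h3 _ := hc j in term _ _ _ (lam0 j) h1 h2 h3).
have mcK : max_cost m <= K.
  rewrite ge_max; apply/andP; split; apply: bigmax_le => // k _.
    by have [] := hs k.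
  by have [] := hc k.
have sl : 0 <= \sum_j lam j <= n%:R * K.
  rewrite sumr_ge0/= => [|k _]; last exact: ltW.
  by apply: sum_le => k; have [] := hc k.
have sm : 0 <= \sum_i mu i <= n%:R * K.
  rewrite sumr_ge0/= => [|k _]; last exact: ltW.
  by apply: sum_le => k; have [] := hs k.
have b3 : `|max_cost m / 2 * (\sum_j lam j + \sum_i mu i)| <= K / 2 * (n%:R * K + n%:R * K).
  move: sl sm => /andP[sl0 slK] /andP[sm0 smK].
  rewrite ger0_norm; last by rewrite mulr_ge0 ?divr_ge0 ?max_cost_ge0// addr_ge0.
  by rewrite ler_pM ?divr_ge0 ?max_cost_ge0 ?addr_ge0// ?lerD// ler_pM2r.
have -> : n%:R `^ (1 / 3) = n%:R * n%:R `^ (- (2 / 3)) :> R.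
  transitivity (n%:R `^ 1 * n%:R `^ (- (2 / 3)) : R); last by rewrite powRr1// ltW.
  rewrite -powRD; last by rewrite (gt_eqF nR) implybT.
  by congr powR; field.
rewrite /max_weight_bound normrM [`|_ `^ _|]ger0_norm ?powR_ge0// mulrA.
rewrite ler_wpM2r ?powR_ge0//.
apply: le_trans (ler_normD _ _) _; apply: le_trans (lerD (ler_normB _ _) b3) _.
have := lerD b1 b2; lra.
Qed.

(** The bounds hold for every choice of stationary laws; existence for large [eta] is stated beside
    them so that they are not vacuous. In the lower bound the curves and the constant are fixed
    before [n], which gives growth of order [n] its meaning. *)
Theorem theorem5 (R : realType) :
  (* randomized matching: upper bound *)
  (forall (n : nat) (m : market R n) (lam mu : 'I_n -> R)
          (chi : 'I_n -> 'I_n -> R) (theta phi : 'I_n -> R) (gamma : R),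
    (0 < n)%N -> market_assumptions m -> perfect_matching (compatible m) ->
    positive_fluid_solution m lam mu chi ->
    (forall j, 0 < theta j) -> (forall i, 0 < phi i) -> 0 < gamma ->
    let policy (eta : nat) := two_price_policy eta lam mu theta phi
      (eta%:R `^ (2 / 3)) (gamma * eta%:R `^ (1 / 3)) in
    let rates (eta : nat) :=
      transition_rate (policy eta) (randomized_matching chi) in
    (\forall eta \near \oo, exists P : probability (state n) R,
      stationary (rates eta) P) /\
    (forall P : nat -> probability (state n) R,
      (\forall eta \near \oo, stationary (rates eta) (P eta)) ->
      exists C : R, \forall eta \near \oo,
        (`|profit_loss m eta (policy eta) (P eta)|
           <= (C * eta%:R `^ (1 / 3))%:E)%E)) /\
  (* randomized matching: lower bound *)
  (exists (f g : R -> R) (bf bg : \bar R),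
    forall gamma s0 : R, 0 < gamma -> 0 < s0 ->
    exists2 c : R, 0 < c &
    forall (n : nat) (theta phi sc ss : 'I_n -> R),
    (0 < n)%N -> (forall j, 0 < theta j) -> (forall i, 0 < phi i) ->
    (forall j, s0 <= sc j) -> (forall i, s0 <= ss i) ->
    exists (E : rel 'I_n) (lam mu : 'I_n -> R) (chi : 'I_n -> 'I_n -> R),
    let m := Market E (fun=> f) (fun=> g) (fun=> bf) (fun=> bg) sc ss in
    let policy (eta : nat) := two_price_policy eta lam mu theta phi
      (eta%:R `^ (2 / 3)) (gamma * eta%:R `^ (1 / 3)) in
    let rates (eta : nat) :=
      transition_rate (policy eta) (randomized_matching chi) in
    [/\ market_assumptions m,
        positive_fluid_solution m lam mu chi,
        perfect_matching E /\ complete_resource_pooling E lam mu,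
        (\forall eta \near \oo, exists P : probability (state n) R,
          stationary (rates eta) P)
      & forall P : nat -> probability (state n) R,
          (\forall eta \near \oo, stationary (rates eta) (P eta)) ->
          ((c * n%:R)%:E <=
            limn_einf (fun eta : nat =>
              profit_loss m eta (policy eta) (P eta)
              * (eta%:R `^ (1 / 3))^-1%:E))%E]) /\
  (* max-weight matching *)
  (forall (n : nat) (m : market R n) (lam mu : 'I_n -> R)
          (chi : 'I_n -> 'I_n -> R) (M : nat -> matching R n) (tau : nat -> R),
    (0 < n)%N -> market_assumptions m -> perfect_matching (compatible m) ->
    positive_fluid_solution m lam mu chi ->
    complete_resource_pooling (compatible m) lam mu ->
    (forall eta, max_weight_matching (compatible m) (M eta)) ->
    (forall eta, 0 <= tau eta) ->
    (fun eta : nat => tau eta / eta%:R `^ (1 / 3)) @ \oo --> (0 : R) ->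
    let policy (eta : nat) :=
      two_price_policy eta lam mu (fun=> 1) (fun=> 1)
        (n%:R `^ (- (1 / 3)) * eta%:R `^ (2 / 3)) (tau eta) in
    let rates (eta : nat) := transition_rate (policy eta) (M eta) in
    (\forall eta \near \oo, exists P : probability (state n) R,
      stationary (rates eta) P) /\
    (forall P : nat -> probability (state n) R,
      (\forall eta \near \oo, stationary (rates eta) (P eta)) ->
      (limn_esup (fun eta : nat =>
         profit_loss m eta (policy eta) (P eta)
         * (eta%:R `^ (1 / 3))^-1%:E)
       <= (max_weight_bound m lam mu)%:E)%E)) /\
  (* growth in n of the max-weight bound *)
  (forall K : R, exists C : R,
    forall (n : nat) (m : market R n) (lam mu : 'I_n -> R)
           (chi : 'I_n -> 'I_n -> R),
    (0 < n)%N -> market_assumptions m -> perfect_matching (compatible m) ->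
    positive_fluid_solution m lam mu chi ->
    complete_resource_pooling (compatible m) lam mu ->
    data_bounded_by m lam mu K ->
    `|max_weight_bound m lam mu| <= C * n%:R `^ (1 / 3)).
Proof.
split; [|split; [|split]].
- move=> n m lam mu chi theta phi gamma _ mkt _ opt th0 ph0 g0 policy rates; split.
    exact: (randomized_stationary_exists opt th0 ph0 g0).
  by move=> P; exact: (randomized_loss_bound mkt opt th0 ph0 g0).
- exists (fun x => 1 - x), (fun x => x), 1%:E, +oo%E => gamma s0 g0 s00.
  exists (s0 * gamma / 4); first by rewrite divr_gt0// mulr_gt0.
  move=> n theta phi sc ss n0 th0 ph0 scs sss.
  exists (fun _ _ => true), (fun=> 1 / 4), (fun=> 1 / 4), (@diagonal_flow R n).
  move=> m policy rates; split.
  + exact: linear_market_assumptions s00 scs sss.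
  + exact: linear_market_optimal.
  + split; last exact: linear_market_pooling.
    by exists 1%g.
  + exact: (linear_market_stationary_exists sc ss th0 ph0 g0).
  + by move=> P; exact: (linear_market_loss th0 ph0 g0 s00 scs sss).
- move=> n m lam mu chi M tau n0 mkt _ opt crp maxw tau0 tau_small policy rates; split.
    exact: (max_weight_stationary_exists n0 opt maxw tau0).
  by move=> P; exact: (max_weight_loss n0 mkt opt crp maxw tau0 tau_small).
- move=> K; exists (2 * K ^+ 2 + 2 * K) => n m lam mu chi n0 mkt _ opt _ bounded.
  exact: max_weight_bound_growth n0 mkt opt bounded.
Qed.
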